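(* Let $\ell$ be a positive integer and $M$ a known constant with $0<\nu\le M<\ell\le10$. Let $X$ be a stationary Gaussian process on $\mathbb R$ with covariance function $K(x,y)=\tilde K(x-y)$ of the form described in the context, with smoothness parameter $\nu$. Let $\varphi:\mathbb R\to\mathbb R$ be twice continuously differentiable with $\varphi(0)=0$, $\varphi(1)=1$, $\min_{0\le s\le1}\varphi^{(1)}(s)>0$, and let $t_i=t_{n,i}=\varphi((i-1)/(n-1))$, $i=1,\dots,n$. Suppose that $\tilde K^{(2\ell)}(\cdot)$ is a continuous function on an open interval containing $(0,1]$ such that $|\tilde K^{(2\ell)}(t)|\le C_\ell t^{2\nu-2\ell}$ for all $t\in(0,1]$, for some constant $C_\ell$. Let $\hat\nu_{a,\ell}\in[0,M]$ satisfy $$\Bigl\{\frac{V_{1,\ell}F_{\ell,n}(\hat\nu_{a,\ell})}{V_{2,\ell}}-1\Bigr\}^2=\min_{0\le\nu^*\le M}\Bigl\{\frac{V_{1,\ell}F_{\ell,n}(\nu^* )}{V_{2,\ell}}-1\Bigr\}^2 .$$ Then $\hat\nu_{a,\ell}\to\nu$ as $n\to\infty$ almost surely.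
   Context: Covariance model. $X$ is a stationary, isotropic Gaussian random field on $\mathbb R$ (dimension $d=1$) with constant mean $\mu$ and covariance function $$K(x,y)=\operatorname{Cov}\{X(x),X(y)\}=\sum_{j=0}^{\lfloor\nu\rfloor}\beta_j|x-y|^{2j}+\beta_\nu^*G_\nu(|x-y|)+r(x,y),\qquad x,y\in\mathbb R,$$ where $\nu>0$, $\beta_\nu^*\ne0$, $\beta_0,\dots,\beta_{\lfloor\nu\rfloor}$ are constants; $r(x,y)=O(|x-y|^{2\nu+\tau})$ as $|x-y|\to0$ for some constant $\tau>0$; and for any $\nu>0$, $G_\nu:[0,\infty)\to\mathbb R$ satisfies $G_\nu(0)=0$ and, for $s>0$, $G_\nu(s)=s^{2\nu}$ if $\nu\notin\mathbb Z$, $G_\nu(s)=s^{2\nu}\log(s)$ if $\nu\in\mathbb Z$. Write $\tilde K(x-y)=K(x,y)$, and $\tilde K^{(2\ell)}$ for the $2\ell$th derivative of $\tilde K$ where it exists. Quadratic variation. The points satisfy $0=t_1<\dots<t_n=1$; write $X_i=X(t_i)$. For $\theta\in\{1,2\}$, $\ell\in\{1,\dots,\lfloor(n-1)/\theta\rfloor\}$ and $1\le i\le n-\theta\ell$ define $$a_{\theta,\ell;i,k}=\frac{\ell!}{\prod_{0\le j\le\ell,\,j\ne k}(t_{i+\theta k}-t_{i+\theta j})},\quad k=0,\dots,\ell,\qquad \nabla_{\theta,\ell}X_i=\sum_{k=0}^\ell a_{\theta,\ell;i,k}X_{i+\theta k},$$ $$V_{\theta,\ell}=\sum_{i=1}^{n-\theta\ell}(\nabla_{\theta,\ell}X_i)^2,$$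 and, for $\nu^*\in(0,\ell)$, $$f_{\theta,\ell}(\nu^* )=2\beta_{\nu^*}^*\sum_{i=1}^{n-\theta\ell}\ \sum_{0\le k_1<k_2\le\ell}a_{\theta,\ell;i,k_1}a_{\theta,\ell;i,k_2}G_{\nu^*}(t_{i+\theta k_2}-t_{i+\theta k_1}),$$ with $\beta^*_{\nu^*}$ a nonzero constant. The function $F_{\ell,n}:[0,M]\to[0,\infty)$ is $F_{\ell,n}(\nu^* )=f_{2,\ell}(\nu^* )/f_{1,\ell}(\nu^* )$ for $\nu^*\in(0,M]$ and $F_{\ell,n}(0)=\lim_{\delta\to0+}f_{2,\ell}(\delta)/f_{1,\ell}(\delta)$; the constant $\beta^*_{\nu^*}$ cancels in the ratio, so $F_{\ell,n}$ does not depend on it. The integer $\ell$ is fixed as $n\to\infty$, and for all $n$ the observations come from the same realization of $X$. *)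

(* Defs.v *)
From HB Require Import structures.
From mathcomp Require Import all_boot all_order all_algebra.
From mathcomp Require Import all_classical all_reals all_analysis.

Set Implicit Arguments.
Unset Strict Implicit.
Unset Printing Implicit Defensive.

Import Order.TTheory GRing.Theory Num.Theory.
Import numFieldNormedType.Exports.

Local Open Scope classical_set_scope.
Local Open Scope ring_scope.

(* N(m, s^2), a point mass when s = 0: the library's [normal_prob m 0] is the
   uniform law on [0, 1], hence the case split. *)
Definition gaussian_law (R : realType) (m s : R) (A : set R) : \bar R :=
  if s == 0 then \d_m A else normal_prob m s A.

(* A family of random variables is Gaussian when all its finite-dimensional
   laws are multivariate normal (possibly singular), that is, when all finite
   linear combinations of its members are univariate normal. *)
Definition gaussian_process (R : realType) (d : measure_display)
    (T : measurableType d) (P : probability T R) (X : R -> {RV P >-> R}) : Prop :=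
  forall (k : nat) (c x : 'I_k -> R), exists m s : R,
    forall A : set R, measurable A ->
      P ((fun w => \sum_(i < k) c i * X (x i) w) @^-1` A) = gaussian_law m s A.

Definition is_min (R : realType) (A : set R) (m : R) : Prop :=
  A m /\ lbound A m.

Definition twice_continuously_differentiable (R : realType) (f : R -> R) : Prop :=
  [/\ forall x, derivable f x 1,
      forall x, derivable (derive1 f) x 1 &
      continuous (derive1n 2 f)].

(* [derive1n k f] is a total operator, so the existence of the derivatives of orders
   1, ..., k on the open interval is required separately. *)
Definition continuous_nth_derivative_on (R : realType) (k : nat) (f : R -> R)
    (a b : R) : Prop :=
  (forall j : nat, (j < k)%N ->
     forall t : R, t \in `]a, b[ -> derivable (derive1n j f) t 1) /\
  (forall t : R, t \in `]a, b[ -> {for t, continuous (derive1n k f)}).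

Definition G (R : realType) (nu s : R) : R :=
  if s == 0 then 0
  else if nu \is a Num.int then s `^ (2 * nu) * ln s
  else s `^ (2 * nu).

(* As |x - y| -> 0, uniformly in (x, y); the diagonal x = y is included. *)
Definition bigO_diagonal (R : realType) (r : R -> R -> R) (p : R) : Prop :=
  exists C delta : R, 0 < delta /\
    forall x y : R, `|x - y| < delta -> `|r x y| <= C * `|x - y| `^ p.

(* Below, points t and observations x are indexed from 1; only the values at
   1, ..., n are used. *)

Definition design (R : realType) (phi : R -> R) (n i : nat) : R :=
  phi ((i%:R - 1) / (n%:R - 1)).

Definition diff_coef (R : realType) (t : nat -> R) (theta l i k : nat) : R :=
  l`!%:R /
  \prod_(0 <= j < l.+1 | j != k) (t (i + theta * k)%N - t (i + theta * j)%N).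

Definition nabla (R : realType) (t : nat -> R) (theta l : nat)
    (x : nat -> R) (i : nat) : R :=
  \sum_(0 <= k < l.+1) diff_coef t theta l i k * x (i + theta * k)%N.

Definition quad_var (R : realType) (t : nat -> R) (n theta l : nat)
    (x : nat -> R) : R :=
  \sum_(1 <= i < (n - theta * l).+1) nabla t theta l x i ^+ 2.

Definition f_fun (R : realType) (betastar : R -> R) (t : nat -> R)
    (n theta l : nat) (nu : R) : R :=
  2 * betastar nu *
  \sum_(1 <= i < (n - theta * l).+1)
    \sum_(0 <= k1 < l.+1) \sum_(0 <= k2 < l.+1 | (k1 < k2)%N)
      diff_coef t theta l i k1 * diff_coef t theta l i k2 *
      G nu (t (i + theta * k2)%N - t (i + theta * k1)%N).

Definition F_fun (R : realType) (betastar : R -> R) (t : nat -> R)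
    (n l : nat) (nu : R) : R :=
  let ratio (v : R) := f_fun betastar t n 2 l v / f_fun betastar t n 1 l v in
  if nu == 0 then lim (ratio x @[x --> 0^'+]) else ratio nu.

(* When [quad_var t n 2 l x] vanishes (division by zero), this is constantly 1
   in nu, so that minimising it imposes no constraint. *)
Definition contrast (R : realType) (betastar : R -> R) (t : nat -> R)
    (n l : nat) (x : nat -> R) (nu : R) : R :=
  (quad_var t n 1 l x * F_fun betastar t n l nu / quad_var t n 2 l x - 1) ^+ 2.

(* Main.v *)
Require Import Defs.
From HB Require Import structures.
From mathcomp Require Import all_boot all_order all_algebra.
From mathcomp Require Import all_classical all_reals all_analysis.
From mathcomp Require Import measurable_realfun.
From mathcomp Require Import ring lra zify.

(** The generalised difference of order l annihilates the polynomials of degree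
below 2 l in the lag. For 0 < v < l it therefore sees only the homogeneous part
of [G v], also when v is an integer: rescaling the lag then produces a multiple
of its 2 v-th power, which is annihilated ([DG_affine]). Locally the design is
affine up to O(1/n), so stretching a window by theta multiplies its contribution
to [f_fun] by theta^(2v - 2l), and F tends to 2^(2v - 2l), uniformly for v in
[0, M] ([F_fun_close]). This limit is injective in v. Hence it is enough that
V_1 F(nu) / V_2 tends to 1 almost surely: a minimiser of the contrast then
satisfies F(nuhat) / F(nu) -> 1 ([min_contrast_ratio], [powR2_near1]). There are
two points to prove: V_theta / f_theta(nu) tends to 1 almost surely, and the
limit of F is uniform.

Uniformity is delicate near the integers: the difference applied to |a - b|^(2v)
vanishes at v = 1, ..., l - 1, where [G] takes the form with a logarithm, so the
relative errors must be controlled there. On equispaced nodes this difference is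
an exponential sum in v with l terms; Rolle's theorem shows that it has no other
zeros in (0, l) and that these are simple ([powform0_neq0], [powform1_neq0]). For
perturbed nodes it vanishes at the same integers, so the interpolation remainder
bounds the effect of the perturbation by the product of the factors v - p, which
the exponential sum itself dominates ([powform0_lower_bound], [DG_close]).

The mean of V_theta is f_theta(nu) up to a relative error of order n^(- tau)
([expected_variation_close]). For the fluctuations, V_theta is a sum of squares
of Gaussian variables, and the mean value theorem for divided differences,
applied in both arguments, bounds their covariances through the derivative of
order 2 l of the covariance function: they decay like |i - j|^(2nu - 2l) relative
to the variances ([covariance_decay]). Their Frobenius norm F is then smaller
than the mean of V_theta by a power of n, and the tail bound
P(|V - E V| >= u) <= 2 exp(1/64 - u / (16 F)) ([quadratic_tail]) is summable, so
that the Borel-Cantelli lemma applies ([variation_close_ae]).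

The tail bound is obtained without diagonalising a covariance matrix. For g
standard normal, exp(t Z^2 / 2) is the mean of exp(sqrt(t) g Z) and
exp(- t Z^2 / 2) that of cos(sqrt(t) g Z). Squares can thus be inserted one at a
time into an expectation of the exponential or cosine of a linear combination;
each one multiplies the mass by (1 - tau B_kk)^(-1/2) and changes the covariance
B by a rank-one matrix ([tilted_transform]). A potential function keeps track of
both effects ([tilt_mass_bound]). The transforms of linear combinations are what
the definition of a Gaussian process gives; their parameters are identified with
mean and variance by comparing with second-order expansions
([Rintegral_sqr_of_transforms]). *)

Set Implicit Arguments.
Unset Strict Implicit.
Unset Printing Implicit Defensive.

Import Order.TTheory GRing.Theory Num.Theory.
Import numFieldNormedType.Exports.

Local Open Scope classical_set_scope.
Local Open Scope ring_scope.

(** * The Rolle theorem for divided differences *)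

(** With the factor l!, the sum of [ddc l x k * g (x k)] approximates the l-th
    derivative of g. *)
Definition ddc (R : realType) (l : nat) (x : nat -> R) (k : nat) : R :=
  l`!%:R / \prod_(0 <= j < l.+1 | j != k) (x k - x j).

Definition nodes_up (R : realType) (l : nat) (x : nat -> R) :=
  forall k, (k < l)%N -> x k < x k.+1.

Lemma nodes_up_lt (R : realType) (l : nat) (x : nat -> R) :
  nodes_up l x -> forall i j, (i < j <= l)%N -> x i < x j.
Proof.
move=> incx i; elim=> [|j IHj] /andP[ij jm]; first by [].
move: ij; rewrite ltnS leq_eqVlt => /orP[/eqP -> //|ij]; first exact: incx.
by apply: (lt_trans (IHj _)); [rewrite ij ltnW|exact: incx].
Qed.

Lemma nodes_up_le (R : realType) (l : nat) (x : nat -> R) :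
  nodes_up l x -> forall i j, (i <= j <= l)%N -> x i <= x j.
Proof.
move=> incx i j /andP[]; rewrite leq_eqVlt => /orP[/eqP -> //|ij jl].
by apply/ltW/(nodes_up_lt incx); rewrite ij.
Qed.

Lemma nodes_up_neq (R : realType) (l : nat) (x : nat -> R) :
  nodes_up l x -> forall i j, (i <= l)%N -> (j <= l)%N -> j != i -> x i - x j != 0.
Proof.
move=> incx i j il jl; rewrite neq_ltn subr_eq0 => /orP[ij|ij].
  by rewrite gt_eqF // (nodes_up_lt incx) // ij.
by rewrite lt_eqF // (nodes_up_lt incx) // ij.
Qed.

Lemma rolle_nodes (R : realType) (n : nat) (f f' : R -> R) (x : nat -> R) :
  nodes_up n x ->
  (forall y, x 0%N <= y <= x n -> is_derive y 1 f (f' y)) ->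
  (forall k, (k <= n)%N -> f (x k) = 0) ->
  exists xi : nat -> R, forall k, (k < n)%N -> x k < xi k < x k.+1 /\ f' (xi k) = 0.
Proof.
move=> incx df fx0.
have zero k : exists xi, (k < n)%N -> x k < xi < x k.+1 /\ f' xi = 0.
  have [nk|kn] := leqP n k; first by exists 0 => kn'; exfalso; lia.
  have inx y : x k <= y <= x k.+1 -> x 0%N <= y <= x n.
    move=> /andP[ky yk].
    by rewrite (le_trans _ ky) ?(le_trans yk) // (nodes_up_le incx) //; lia.
  have dk y : y \in `]x k, x k.+1[ -> derivable f y 1.
    move=> /itvP yk; apply: ex_derive; apply: df => //; apply: inx.
    by rewrite !ltW ?yk.
  have ck : {within `[x k, x k.+1], continuous f}.
    apply: derivable_within_continuous => y yk.
    apply: ex_derive; apply: df => //; apply: inx.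
    by move: yk; rewrite in_itv.
  have fk : f (x k) = f (x k.+1) by rewrite !fx0 // ltnW.
  have [xi xik dxi] := Rolle (incx k kn) dk ck fk.
  exists xi => _; split; first by move: xik; rewrite in_itv.
  have xir : x 0%N <= xi <= x n by apply: inx; rewrite !ltW ?(itvP xik).
  have d2 := df xi xir.
  by rewrite -(derive_val (is_derive := d2)) (derive_val (is_derive := dxi)).
by have [xi Hxi] := choice zero; exists xi.
Qed.

(** The zeros of each derivative separate those of the previous one, so that one
    of them is lost at each step. *)
Lemma iterated_rolle (R : realType) (m : nat) (g_ : nat -> R -> R) (x : nat -> R) :
  (forall j, (j < m)%N -> forall y, x 0%N <= y <= x m ->
     is_derive y 1 (g_ j) (g_ j.+1 y)) ->
  nodes_up m x ->
  (forall k, (k <= m)%N -> g_ 0%N (x k) = 0) ->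
  exists2 xi, x 0%N <= xi <= x m & g_ m xi = 0.
Proof.
elim: m g_ x => [|m IHm] g_ x dg incx gx0.
  by exists (x 0%N); [rewrite lexx | exact: gx0].
have [z Hz] := rolle_nodes incx (dg 0%N isT) gx0.
have [|||xi xir gxi] := IHm (fun j => g_ j.+1) z.
- move=> j jm y /andP[yz0 yzm]; apply: dg => //.
  have [/andP[z0 _] _] := Hz 0%N isT; have [/andP[_ zm] _] := Hz m (leqnn _).
  by rewrite (le_trans (ltW z0)) ?(le_trans yzm) // ltW.
- move=> k km; have [/andP[_ zk] _] := Hz k (ltnW km).
  by have [/andP[zk1 _] _] := Hz k.+1 km; exact: lt_trans zk1.
- by move=> k km; have [] := Hz k km.
exists xi => //; move/andP: xir => [yz0 yzm].
have [/andP[z0 _] _] := Hz 0%N isT; have [/andP[_ zm] _] := Hz m (leqnn _).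
by rewrite (le_trans (ltW z0)) ?(le_trans yzm) // ltW.
Qed.

Lemma uniq_sorted_nodes (R : realType) (s : seq R) (n : nat) :
  uniq s -> size s = n.+1 ->
  exists2 x : nat -> R, nodes_up n x & forall k, (k <= n)%N -> x k \in s.
Proof.
move=> us ss; pose t := sort <=%R s.
have st : sorted <%R t by rewrite sort_lt_sorted.
have szt : size t = n.+1 by rewrite size_sort.
exists (nth 0 t) => k kn; last by rewrite -(mem_sort <=%R) mem_nth // szt.
by apply/(sortedP 0) => //; rewrite szt.
Qed.

Lemma count_neq_iota (l k : nat) : (k <= l)%N ->
  count (fun j => j != k) (index_iota 0 l.+1) = l.
Proof.
move=> kl; have := count_predC (pred1 k) (index_iota 0 l.+1).
rewrite count_uniq_mem ?iota_uniq // mem_index_iota /= ltnS kl size_iota add1n.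
by move=> -[].

Qed.

(** The Rolle argument applies to the difference of the function and its
    Lagrange interpolant, whose l-th derivative is constant. *)
Lemma divided_difference_mvt (R : realType) (l : nat) (g_ : nat -> R -> R) (x : nat -> R) :
  nodes_up l x ->
  (forall j, (j < l)%N -> forall y, x 0%N <= y <= x l ->
     is_derive y 1 (g_ j) (g_ j.+1 y)) ->
  exists2 xi, x 0%N <= xi <= x l &
    \sum_(0 <= k < l.+1) ddc l x k * g_ 0%N (x k) = g_ l xi.
Proof.
move=> incx dg.
(* The Lagrange interpolant p: its coefficient of degree l, times l!, is the
   left-hand side. *)
pose q k : {poly R} := \prod_(0 <= j < l.+1 | j != k) ('X - (x j)%:P).
pose w k := g_ 0%N (x k) / \prod_(0 <= j < l.+1 | j != k) (x k - x j).
pose p : {poly R} := \sum_(0 <= k < l.+1) w k *: q k.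
have szq k : (k <= l)%N -> size (q k) = l.+1.
  by move=> kl; rewrite /q -big_filter size_prod_XsubC size_filter count_neq_iota.
have lcq k : (k <= l)%N -> (q k)`_l = 1.
  move=> kl; have := lead_coef_prod_XsubC (index_iota 0 l.+1) (fun j => j != k) x.
  by rewrite lead_coefE -/(q k) szq.
have px k : (k <= l)%N -> p.[x k] = g_ 0%N (x k).
  move=> kl; rewrite /p horner_sum (bigD1_seq k) ?mem_index_iota ?iota_uniq //=.
  rewrite [X in _ + X]big1_seq ?addr0 => [|i /andP[ik]].
    rewrite hornerZ /q horner_prod /w.
    under [X in _ * X]eq_bigr do rewrite hornerXsubC.
    rewrite divfK // prodf_seq_neq0; apply/allP => j; rewrite mem_index_iota => /= jl.
    by apply/implyP => jk; exact: (nodes_up_neq incx).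
  rewrite mem_index_iota /= ltnS => il.
  apply/eqP; rewrite hornerZ /q horner_prod mulf_eq0 prodf_seq_eq0; apply/orP; right.
  apply/hasP; exists k; first by rewrite mem_index_iota.
  by rewrite eq_sym ik hornerXsubC subrr eqxx.
have [|||xi xir] := @iterated_rolle R l (fun j y => g_ j y - p^`(j).[y]) x.
- move=> j jl y yr.
  have d1 : is_derive y 1 (fun y => p^`(j).[y]) (p^`(j.+1).[y]).
    apply: DeriveDef; first exact: derivable_horner.
    by rewrite -derive1E -derivE.
  exact: (@is_deriveB _ _ _ _ _ _ _ _ _ (dg j jl y yr) d1).
- exact: incx.
- by move=> k kl; rewrite derivn0 px // subrr.
move=> /eqP; rewrite subr_eq0 => /eqP gxi; exists xi => //.
rewrite gxi.
have szp : (size p <= l.+1)%N.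
  rewrite /p; apply: (leq_trans (size_sum _ _ _)).
  apply/bigmax_leqP_seq => k; rewrite mem_index_iota /= ltnS => kl _.
  by rewrite (leq_trans (size_scale_leq _ _)) // szq.
have -> : p^`(l) = (l`!%:R * p`_l)%:P.
  apply/polyP => i; rewrite coef_derivn coefC.
  case: i => [|i] /=; first by rewrite addn0 ffactnn mulr_natl.
  by rewrite nth_default ?mul0rn // (leq_trans szp) // addnS ltnS leq_addr.
rewrite hornerC /p coef_sum mulr_sumr; apply: eq_big_nat => k /andP[_ kl].
by rewrite coefZ lcq // mulr1 /ddc /w mulrAC mulrA.
Qed.

Lemma ddc_poly (R : realType) (l : nat) (x : nat -> R) (j : nat) :
  nodes_up l x -> (j < l)%N -> \sum_(0 <= k < l.+1) ddc l x k * x k ^+ j = 0.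
Proof.
move=> incx jl.
have [|xi _] := @divided_difference_mvt R l (fun m y => (('X^j)^`(m) : {poly R}).[y]) x incx.
  move=> m ml y _.
  apply: DeriveDef; first exact: derivable_horner.
  by rewrite -derive1E -derivE.
rewrite [X in _ = X.[_] -> _]derivn_poly0 ?size_polyXn // horner0 => e.
rewrite -[RHS]e.
by apply: eq_bigr => k _; rewrite derivn0 hornerXn.
Qed.

(** * Differences of a kernel in both arguments *)

(** When H is a covariance function, this is the covariance of the divided
    differences at the nodes x and at the nodes y. *)
Definition bilin (R : realType) (l : nat) (x y : nat -> R) (H : R -> R -> R) : R :=
  \sum_(0 <= k < l.+1) \sum_(0 <= k' < l.+1)
    ddc l x k * ddc l y k' * H (x k) (y k').

Lemma eq_bilin (R : realType) (l : nat) (x y : nat -> R) (H H' : R -> R -> R) :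
  (forall k k', (k <= l)%N -> (k' <= l)%N -> H (x k) (y k') = H' (x k) (y k')) ->
  bilin l x y H = bilin l x y H'.
Proof.
move=> HH; apply: eq_big_nat => k /andP[_ kl]; apply: eq_big_nat => k' /andP[_ kl'].
by rewrite HH.
Qed.

Lemma bilinD (R : realType) (l : nat) (x y : nat -> R) (H H' : R -> R -> R) :
  bilin l x y (fun u v => H u v + H' u v) = bilin l x y H + bilin l x y H'.
Proof.
rewrite /bilin -big_split /=; apply: eq_bigr => k _.
by rewrite -big_split /=; apply: eq_bigr => k' _; rewrite mulrDr.
Qed.

Lemma bilinZ (R : realType) (l : nat) (x y : nat -> R) (H : R -> R -> R) (c : R) :
  bilin l x y (fun u v => c * H u v) = c * bilin l x y H.
Proof.
rewrite /bilin mulr_sumr; apply: eq_bigr => k _.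
by rewrite mulr_sumr; apply: eq_bigr => k' _; rewrite mulrCA.
Qed.

Lemma bilin_sum (R : realType) (l : nat) (x y : nat -> R) (I : Type) (s : seq I)
    (H : I -> R -> R -> R) :
  bilin l x y (fun u v => \sum_(i <- s) H i u v) = \sum_(i <- s) bilin l x y (H i).
Proof.
elim: s => [|i s IHs].
  rewrite big_nil /bilin big1 // => k _; rewrite big1 // => k' _.
  by rewrite big_nil mulr0.
rewrite big_cons -IHs -bilinD; apply: eq_bilin => k k' _ _.
by rewrite big_cons.
Qed.

(** Each term of the binomial expansion of (u - v)^N has degree less than l in u
    or in v. *)
Lemma bilin_poly (R : realType) (l : nat) (x y : nat -> R) (N : nat) :
  nodes_up l x -> nodes_up l y -> (N < 2 * l)%N ->
  bilin l x y (fun u v => (u - v) ^+ N) = 0.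
Proof.
move=> incx incy Nl.
rewrite (@eq_bilin _ _ _ _ _ (fun u v => \sum_(0 <= i < N.+1)
    ((-1) ^+ i *+ 'C(N, i)) * (u ^+ (N - i) * v ^+ i))); last first.
  move=> k k' _ _; rewrite exprBn big_mkord; apply: eq_bigr => i _.
  by rewrite -mulrA mulrnAl.
rewrite bilin_sum big1_seq // => i /andP[_]; rewrite mem_index_iota /= ltnS => iN.
rewrite (@bilinZ _ _ _ _ (fun u v => u ^+ (N - i) * v ^+ i)).
rewrite (_ : bilin _ _ _ _ = (\sum_(0 <= k < l.+1) ddc l x k * x k ^+ (N - i)) *
   (\sum_(0 <= k < l.+1) ddc l y k * y k ^+ i)); last first.
  rewrite mulr_suml; apply: eq_bigr => k _; rewrite mulr_sumr.
  by apply: eq_bigr => k' _; rewrite mulrACA.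
have [il|li] := ltnP i l; first by rewrite (ddc_poly incy il) !mulr0.
by rewrite (@ddc_poly _ _ x) ?mul0r ?mulr0 //; lia.
Qed.

Lemma bilin_even_poly (R : realType) (l : nat) (x y : nat -> R) (m : nat) :
  nodes_up l x -> nodes_up l y -> (m < l)%N ->
  bilin l x y (fun u v => `|u - v| ^+ (2 * m)) = 0.
Proof.
move=> incx incy ml.
rewrite (@eq_bilin _ _ _ _ _ (fun u v => (u - v) ^+ (2 * m))); last first.
  by move=> k k' _ _; rewrite exprM real_normK ?num_real // -exprM.
by rewrite bilin_poly // ltn_mul2l.
Qed.

Lemma ddc_affine (R : realType) (l : nat) (x : nat -> R) (c h : R) (k : nat) :
  (k <= l)%N -> ddc l (fun k => c + h * x k) k = h ^- l * ddc l x k.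
Proof.
move=> kl; rewrite /ddc.
under eq_bigr do rewrite opprD addrACA subrr add0r -mulrBr.
rewrite big_split /= big_const_seq count_neq_iota // iter_mulr_1 invfM.
by rewrite mulrCA.
Qed.

Lemma int_lt_natr (R : realType) (l : nat) (v : R) : 0 <= v -> v < l%:R ->
  v \is a Num.int -> exists2 p : nat, v = p%:R & (p < l)%N.
Proof.
move=> v0 vl vint; have /natrP[p vp] : v \is a Num.nat by rewrite natrEint vint.
by exists p => //; move: vl; rewrite vp ltr_nat.
Qed.

Lemma G_at0 (R : realType) (v : R) : G v 0 = 0. Proof. by rewrite /G eqxx. Qed.

(** The logarithm turns the scale factor into an additional multiple of s^(2v). *)
Lemma G_scale (R : realType) (v h s : R) : 0 < v -> 0 < h -> 0 <= s ->
  G v (h * s) = h `^ (2 * v) * G v s +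
    (if v \is a Num.int then h `^ (2 * v) * ln h else 0) * s `^ (2 * v).
Proof.
move=> v0 h0; rewrite le_eqVlt => /predU1P[<-|s0].
  by rewrite mulr0 !G_at0 powR0 ?mulr0 ?addr0 // gt_eqF // mulr_gt0.
rewrite /G mulf_eq0 !gt_eqF //= powRM ?ltW // lnM //.
by case: ifP => _; ring.
Qed.

Definition DG (R : realType) (l : nat) (v : R) (x : nat -> R) : R :=
  bilin l x x (fun a b => G v `|a - b|).

Lemma bilin_affine (R : realType) (l : nat) (x : nat -> R) (c h : R) (H : R -> R -> R) :
  bilin l (fun k => c + h * x k) (fun k => c + h * x k) H =
  h ^- (2 * l) * bilin l x x (fun a b => H (c + h * a) (c + h * b)).
Proof.
rewrite /bilin mulr_sumr; apply: eq_big_nat => k /andP[_ kl].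
rewrite mulr_sumr; apply: eq_big_nat => k' /andP[_ kl'].
rewrite !ddc_affine // mul2n -addnn exprD invfM.
by move: (h ^- l) (ddc l x k) (ddc l x k') (H _ _) => a b b' e; ring.
Qed.

(** The additional term of [G_scale] occurs for integer v only, where it is an
    even polynomial of degree 2 v < 2 l and is annihilated. *)
Lemma DG_affine (R : realType) (l : nat) (v : R) (x : nat -> R) (c h : R) :
  nodes_up l x -> 0 < h -> 0 < v -> v < l%:R ->
  DG l v (fun k => c + h * x k) = h `^ (2 * v - 2 * l%:R) * DG l v x.
Proof.
move=> incx h0 v0 vl; rewrite /DG bilin_affine.
rewrite (@eq_bilin _ _ _ _ _ (fun a b => h `^ (2 * v) * G v `|a - b| +
    (if v \is a Num.int then h `^ (2 * v) * ln h else 0) * `|a - b| `^ (2 * v))).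
  rewrite bilinD !bilinZ.
  rewrite (_ : (if v \is a Num.int then _ else _) * _ = 0).
    rewrite addr0 powRB ?(gt_eqF h0) ?implybT // -natrM powR_mulrn ?ltW // mulrA.
    by rewrite [h ^- _ * _]mulrC.
  case: ifP => [vint|_]; last by rewrite mul0r.
  have [p -> pl] := int_lt_natr (ltW v0) vl vint.
  rewrite (@eq_bilin _ _ _ _ _ (fun a b => `|a - b| ^+ (2 * p))).
    by rewrite bilin_even_poly ?mulr0.
  by move=> k k' _ _; rewrite -natrM powR_mulrn.
move=> k k' _ _; rewrite opprD addrACA subrr add0r -mulrBr normrM.
by rewrite (gtr0_norm h0) G_scale.
Qed.

Lemma sum_upper_triangle (R : realType) (n : nat) (F : nat -> nat -> R) :
  (forall i j, F i j = F j i) -> (forall i, F i i = 0) ->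
  \sum_(0 <= i < n) \sum_(0 <= j < n) F i j =
  2 * \sum_(0 <= i < n) \sum_(0 <= j < n | (i < j)%N) F i j.
Proof.
move=> symF diagF; rewrite mulr_natl mulr2n.
have -> : \sum_(0 <= i < n) \sum_(0 <= j < n) F i j =
  \sum_(0 <= i < n) \sum_(0 <= j < n)
     ((if (i < j)%N then F i j else 0) + (if (j < i)%N then F j i else 0)).
  apply: eq_bigr => i _; apply: eq_bigr => j _.
  by case: ltngtP => [| |->]; rewrite ?addr0 ?add0r ?diagF // symF.
under eq_bigr do rewrite big_split /=.
rewrite big_split /=; congr (_ + _); last rewrite exchange_big_nat /=.
all: by apply: eq_bigr => i _; rewrite [RHS]big_mkcond.
Qed.

(** [f_fun] sums over k1 < k2 with a factor 2: this is the full double sum,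
    since the kernel vanishes at 0. *)
Lemma f_fun_DG (R : realType) (betastar : R -> R) (t : nat -> R) (n theta l : nat) (v : R) :
  (forall i j, (0 < i)%N -> (i < j)%N -> (j <= n)%N -> t i < t j) -> (0 < theta)%N ->
  f_fun betastar t n theta l v =
  betastar v * \sum_(1 <= i < (n - theta * l).+1) DG l v (fun k => t (i + theta * k)%N).
Proof.
move=> inct theta0; rewrite /f_fun [2 * _]mulrC -mulrA mulr_sumr; congr (_ * _).
apply: eq_big_nat => i /andP[i0 il]; rewrite /DG /bilin sum_upper_triangle.
- congr (_ * _); apply: eq_bigr => k _.
  rewrite big_nat_cond [RHS]big_nat_cond.
  apply: eq_bigr => k' /andP[/andP[_ kl'] kk'].
  rewrite distrC gtr0_norm // subr_gt0; apply: inct; nia.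
- by move=> a b; rewrite distrC [ddc _ _ a * _]mulrC.
- by move=> a; rewrite subrr normr0 G_at0 mulr0.
Qed.

(** * Interpolation remainder and zeros of exponential sums *)

Lemma iterated_rolle_uniq (R : realType) (m : nat) (g_ : nat -> R -> R) (s : seq R) (a b : R) :
  (forall j, (j < m)%N -> forall y, a <= y <= b -> is_derive y 1 (g_ j) (g_ j.+1 y)) ->
  uniq s -> size s = m.+1 -> (forall y, y \in s -> a <= y <= b /\ g_ 0%N y = 0) ->
  exists2 xi, a <= xi <= b & g_ m xi = 0.
Proof.
move=> dg us ss gs; have [x incx xs] := uniq_sorted_nodes us ss.
have xab y : x 0%N <= y <= x m -> a <= y <= b.
  move=> /andP[y0 ym]; have [/andP[a0 _] _] := gs _ (xs 0%N (leq0n _)).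
  have [/andP[_ bm] _] := gs _ (xs m (leqnn _)).
  by rewrite (le_trans a0) ?(le_trans ym).
have [|||xi xir gxi] := @iterated_rolle R m g_ x.
- by move=> j jm y yx; apply: dg => //; exact: xab.
- exact: incx.
- by move=> k km; have [] := gs _ (xs k km).
by exists xi => //; exact: xab.
Qed.

(** The Rolle theorem, applied to f minus the multiple of the product of the
    factors y - p that also vanishes at v. *)
Lemma interpolation_remainder (R : realType) (m : nat) (f_ : nat -> R -> R) (s : seq R) (a b v : R) :
  (forall j, (j < m)%N -> forall y, a <= y <= b -> is_derive y 1 (f_ j) (f_ j.+1 y)) ->
  uniq s -> size s = m -> (forall y, y \in s -> a <= y <= b /\ f_ 0%N y = 0) ->
  a <= v <= b -> v \notin s ->
  exists2 xi, a <= xi <= b & f_ 0%N v * m`!%:R = f_ m xi * \prod_(p <- s) (v - p).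
Proof.
move=> df us ss fs vab vs.
pose q : {poly R} := \prod_(p <- s) ('X - p%:P).
have qE y : q.[y] = \prod_(p <- s) (y - p).
  by rewrite /q horner_prod; apply: eq_bigr => p _; rewrite hornerXsubC.
have szq : size q = m.+1 by rewrite /q size_prod_XsubC ss.
have lcq : q`_m = 1.
  have := monic_prod_XsubC s xpredT id.
  by rewrite -/q monicE lead_coefE szq => /eqP.
have qv : q.[v] != 0 by rewrite -rootE root_prod_XsubC.
pose kap := f_ 0%N v / q.[v].
have [|||y ys|xi xir] := @iterated_rolle_uniq R m
    (fun j y => f_ j y - kap * q^`(j).[y]) (v :: s) a b.
- move=> j jm y yab.
  have d1 : is_derive y 1 (fun y => kap * q^`(j).[y]) (kap * q^`(j.+1).[y]).
    have d0 : is_derive y 1 (fun y => q^`(j).[y]) (q^`(j.+1).[y]).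
      apply: DeriveDef; first exact: derivable_horner.
      by rewrite -derive1E -derivE.
    exact: (is_deriveZ kap d0).
  exact: (@is_deriveB _ _ _ _ _ _ _ _ _ (df j jm y yab) d1).
- by rewrite /= vs.
- by rewrite /= ss.
- move: ys; rewrite inE => /predU1P[->|ys].
    by split=> //; rewrite derivn0 /kap divfK // subrr.
  have [yab fy] := fs y ys; split=> //.
  rewrite derivn0 fy; have /rootP -> : root q y by rewrite root_prod_XsubC.
  by rewrite mulr0 subrr.
move=> /eqP; rewrite subr_eq0 => /eqP fxi; exists xi => //.
have qm : q^`(m) = (m`!%:R)%:P.
  apply/polyP => i; rewrite coef_derivn coefC.
  case: i => [|i] /=; first by rewrite addn0 ffactnn lcq.
  by rewrite nth_default ?mul0rn // szq addnS ltnS leq_addr.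
by rewrite fxi -qE qm hornerC mulrAC /kap divfK.
Qed.

Lemma is_derive_bigsum (R : realType) (I : Type) (r : seq I) (f : I -> R -> R)
    (f' : I -> R) (v : R) :
  (forall i, is_derive v 1 (f i) (f' i)) ->
  is_derive v 1 (fun y => \sum_(i <- r) f i y) (\sum_(i <- r) f' i).
Proof.
move=> df; elim: r => [|k r IHr].
  under eq_fun do rewrite big_nil.
  by rewrite big_nil; exact: is_derive_cst.
under eq_fun do rewrite big_cons.
by rewrite big_cons; exact: is_deriveD.
Qed.

Lemma is_derive_expRM (R : realType) (c a v : R) :
  is_derive v 1 (fun y => c * expR (y * a)) (c * a * expR (v * a)).
Proof.
have d1 : is_derive v 1 (fun y : R => y * a) a.
  by apply: is_derive_eq; rewrite scaler0 add0r scaler1.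
have d2 := @is_derive1_comp _ expR (fun y => y * a) v _ _ (is_derive_expR _) d1.
have -> : c * a * expR (v * a) = c *: (expR (v * a) * a).
  by rewrite -mulrA [a * _]mulrC.
exact: (is_deriveZ c d2).
Qed.

Definition expsum (R : realType) (b lam : nat -> R) (r : seq nat) (v : R) : R :=
  \sum_(k <- r) b k * expR (v * lam k).

Lemma is_derive_expsum (R : realType) (b lam : nat -> R) (r : seq nat) (v : R) :
  is_derive v 1 (expsum b lam r) (expsum (fun k => b k * lam k) lam r v).
Proof. by apply: is_derive_bigsum => k; exact: is_derive_expRM. Qed.

Lemma expsum_shift (R : realType) (b lam : nat -> R) (r : seq nat) (a v : R) :
  expsum b (fun k => lam k - a) r v = expR (- (v * a)) * expsum b lam r v.
Proof.
rewrite /expsum mulr_sumr; apply: eq_bigr => k _.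
by rewrite mulrBr addrC expRD mulrCA.
Qed.

(** Dividing by the j-th exponential makes the j-th term constant, so that
    differentiation removes it. *)
Lemma expsum_rolle_step (R : realType) (b lam : nat -> R) (j : nat) (r : seq nat) (v : R) :
  is_derive v 1 (expsum b (fun k => lam k - lam j) (j :: r))
    (expsum (fun k => b k * (lam k - lam j)) (fun k => lam k - lam j) r v).
Proof.
have := is_derive_expsum b (fun k => lam k - lam j) (j :: r) v.
by rewrite {2}/expsum big_cons subrr mulr0 mul0r add0r.
Qed.

Lemma nodes_interlaced_uniq (R : realType) (n : nat) (x xi : nat -> R) :
  nodes_up n x -> (forall k, (k < n)%N -> x k < xi k < x k.+1) ->
  uniq [seq xi k | k <- iota 0 n].
Proof.
move=> incx Hxi.
have lt_xi i j : (i < j)%N -> (j < n)%N -> xi i < xi j.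
  move=> ij jn; have /andP[_ xi1] := Hxi i (ltn_trans ij jn).
  have /andP[xj _] := Hxi j jn.
  rewrite (lt_le_trans xi1) // (le_trans _ (ltW xj)) // (nodes_up_le incx) //.
  by rewrite ij ltnW.
rewrite map_inj_in_uniq ?iota_uniq // => i j; rewrite !mem_iota !add0n /= => iN jN xij.
by case: (ltngtP i j) => // h; [have := lt_xi i j h jN|have := lt_xi j i h iN];
  rewrite xij ltxx.
Qed.

(** A nonzero exponential sum has fewer zeros than terms: dividing by one
    exponential and differentiating removes one term and, by the Rolle theorem,
    at most one zero. *)
Lemma expsum_zeros (R : realType) (b lam : nat -> R) (r : seq nat) (s : seq R) :
  uniq [seq lam k | k <- r] -> uniq s -> size s = size r ->
  (forall v, v \in s -> expsum b lam r v = 0) -> forall k, k \in r -> b k = 0.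
Proof.
elim: r b lam s => [//|j r IHr] b lam s /= /andP[jr ur] us ss zs.
have br k : k \in r -> b k = 0.
  have [x incx xs] := uniq_sorted_nodes us ss.
  have zx k' : (k' <= size r)%N -> expsum b (fun k => lam k - lam j) (j :: r) (x k') = 0.
    by move=> kr; rewrite expsum_shift zs ?mulr0 // xs.
  have [xi Hxi] := rolle_nodes incx (fun y _ => expsum_rolle_step b lam j r y) zx.
  move=> kr.
  have /eqP : (fun k => b k * (lam k - lam j)) k = 0.
    apply: (IHr (fun k => b k * (lam k - lam j)) (fun k => lam k - lam j)
      [seq xi k | k <- iota 0 (size r)] _ _ _ _ k kr).
    - by rewrite (map_comp (fun y => y - lam j) lam) map_inj_uniq //; exact: addIr.
    - by apply: (nodes_interlaced_uniq incx) => i ir; case: (Hxi i ir).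
    - by rewrite size_map size_iota.
    - move=> y /mapP[i]; rewrite mem_iota add0n => /= ir ->.
      by have [] := Hxi i ir.
  rewrite mulf_eq0 subr_eq0 => /orP[/eqP //|/eqP lkj].
  by move: jr; rewrite -lkj map_f.
move=> k; rewrite inE => /predU1P[->|]; last exact: br.
case: s us ss zs => [//|v s] _ _ /(_ v (mem_head _ _)) /eqP.
rewrite /expsum big_cons big1_seq ?addr0 ?mulf_eq0 ?expR_eq0 ?orbF => [/eqP //|i /andP[_ ir]].
by rewrite br // mul0r.
Qed.

(** * The power kernel on equispaced nodes *)

(** As a function of v this is smooth everywhere, including v = 0; it agrees
    with s^(2v) for v <> 0. *)
Definition powker (R : realType) (v s : R) : R := if s == 0 then 0 else expR (v * (2 * ln s)).

(** The j-th derivative in v of the double difference of |a - b|^(2v); the case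
    j = 1 is twice the difference of the kernel with a logarithm. *)
Definition powform (R : realType) (l : nat) (x : nat -> R) (j : nat) (v : R) : R :=
  bilin l x x (fun a b => (2 * ln `|a - b|) ^+ j * powker v `|a - b|).

Lemma is_derive_powform (R : realType) (l : nat) (x : nat -> R) (j : nat) (v : R) :
  is_derive v 1 (powform l x j) (powform l x j.+1 v).
Proof.
apply: is_derive_bigsum => k; apply: is_derive_bigsum => k'.
rewrite /powker; case: ifP => _.
  under eq_fun do rewrite !mulr0.
  by rewrite !mulr0; exact: is_derive_cst.
under eq_fun do rewrite mulrA.
rewrite exprSr mulrA mulrA.
exact: is_derive_expRM.
Qed.

Lemma powker_powR (R : realType) (v s : R) : 0 <= s -> v != 0 -> powker v s = s `^ (2 * v).
Proof.
move=> s0 v0; rewrite /powker /powR mulf_eq0 (negbTE v0) pnatr_eq0 /=.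
by case: ifP => // _; congr expR; ring.
Qed.

(** At the integer p the kernel is an even polynomial of degree 2 p < 2 l. *)
Lemma powform0_nat (R : realType) (l : nat) (x : nat -> R) (p : nat) :
  nodes_up l x -> (0 < p < l)%N -> powform l x 0 p%:R = 0.
Proof.
move=> incx /andP[p0 pl]; rewrite -(bilin_even_poly incx incx pl); apply: eq_bilin.
move=> k k' _ _; rewrite expr0 mul1r powker_powR ?pnatr_eq0 -?lt0n //.
by rewrite -natrM powR_mulrn.
Qed.

Lemma DG_nonint (R : realType) (l : nat) (x : nat -> R) (v : R) :
  0 < v -> v \isn't a Num.int -> DG l v x = powform l x 0 v.
Proof.
move=> v0 vi; apply: eq_bilin => k k' _ _; rewrite expr0 mul1r powker_powR ?gt_eqF //.
rewrite /G (negbTE vi); case: ifP => [/eqP ->|//].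
by rewrite powR0 // mulf_neq0 ?gt_eqF.
Qed.

Lemma DG_int (R : realType) (l : nat) (x : nat -> R) (v : R) :
  0 < v -> v \is a Num.int -> 2 * DG l v x = powform l x 1 v.
Proof.
move=> v0 vi; rewrite -bilinZ; apply: eq_bilin => k k' _ _.
rewrite expr1 powker_powR ?gt_eqF // /G vi.
case: ifP => [/eqP ->|_]; last by ring.
by rewrite powR0 ?mulr0 // mulf_neq0 ?gt_eqF.
Qed.

Definition idn (R : realType) (k : nat) : R := k%:R.
Arguments idn : clear implicits.

Lemma nodes_up_idn (R : realType) (l : nat) : nodes_up l (idn R).
Proof. by move=> k _; rewrite /idn ltr_nat. Qed.

Lemma ddc_neq0 (R : realType) (l : nat) (x : nat -> R) (k : nat) :
  nodes_up l x -> (k <= l)%N -> ddc l x k != 0.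
Proof.
move=> incx kl; rewrite /ddc mulf_neq0 ?invr_eq0 ?pnatr_eq0 -?lt0n ?fact_gt0 //.
rewrite prodf_seq_neq0; apply/allP => j; rewrite mem_index_iota => /= jl.
by apply/implyP => jk; exact: (nodes_up_neq incx).
Qed.

(** Coefficients of the exponential sum obtained on equispaced nodes by
    collecting the pairs of nodes at the same distance. *)
Definition gap_weight (R : realType) (l d : nat) : R :=
  \sum_(0 <= k < l.+1) \sum_(0 <= k' < l.+1)
    if `|k - k'|%N == d then ddc l (idn R) k * ddc l (idn R) k' else 0.

(** Only the two extreme nodes are at distance l. *)
Lemma gap_weight_top (R : realType) (l : nat) : (0 < l)%N -> gap_weight R l l != 0.
Proof.
move=> l0; rewrite /gap_weight sum_upper_triangle; first last.
- by move=> i; rewrite distnn eq_sym gtn_eqF.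
- by move=> i j; rewrite distnC mulrC.
rewrite mulf_neq0 ?pnatr_eq0 // big_ltn // [X in _ + X]big1_seq; last first.
  move=> i /andP[_]; rewrite mem_index_iota => /andP[i0 il].
  rewrite big1_seq // => j /andP[ij]; rewrite mem_index_iota => /andP[_ jl].
  by case: eqP => // e; exfalso; lia.
rewrite addr0 big_mkcond big_nat_recr //= l0 big1_seq ?add0r; last first.
  move=> j /andP[_]; rewrite mem_index_iota => /andP[_ jl].
  by case: ifP => // _; case: eqP => // e; exfalso; lia.
rewrite abszN absz_nat eqxx mulf_neq0 // ddc_neq0 //; exact: nodes_up_idn.
Qed.

Definition lograte (R : realType) (d : nat) : R := 2 * ln d%:R.

Lemma powform0_expsum (R : realType) (l : nat) (v : R) :
  powform l (idn R) 0 v = expsum (gap_weight R l) (lograte R) (index_iota 1 l.+1) v.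
Proof.
rewrite /expsum /gap_weight.
under [RHS]eq_bigr do rewrite mulr_suml.
rewrite exchange_big_nat /=; apply: eq_big_nat => k /andP[_ kl].
under [RHS]eq_bigr do rewrite mulr_suml.
rewrite exchange_big_nat /=; apply: eq_big_nat => k' /andP[_ kl'].
rewrite expr0 mul1r.
have dist : `|idn R k - idn R k'| = `|k - k'|%N%:R :> R.
  by rewrite /idn natr_absz intr_norm rmorphB.
rewrite dist /powker pnatr_eq0; have [->|d0] := eqVneq `|k - k'|%N 0%N.
  rewrite mulr0 big1_seq // => d /andP[_]; rewrite mem_index_iota => /andP[d1 _].
  by rewrite ltn_eqF ?mul0r.
rewrite (bigD1_seq `|k - k'|%N) ?iota_uniq ?mem_index_iota //=; last by lia.
rewrite eqxx big1 ?addr0 // => d dk; by rewrite eq_sym (negbTE dk) mul0r.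
Qed.

Lemma lograte_uniq (R : realType) (m n : nat) : (0 < m)%N ->
  uniq [seq lograte R k | k <- index_iota m n].
Proof.
move=> m0; rewrite map_inj_in_uniq ?iota_uniq // => i j.
rewrite !mem_index_iota => /andP[mi _] /andP[mj _] /(mulfI _) e.
apply/eqP; rewrite -(eqr_nat R); apply/eqP/(@ln_inj R); rewrite ?posrE ?ltr0n; try lia.
by apply: e; rewrite pnatr_eq0.
Qed.

Definition natpts (R : realType) (l : nat) : seq R := [seq k%:R | k <- index_iota 1 l].

Lemma natpts_uniq (R : realType) (l : nat) : uniq (natpts R l).
Proof.
by rewrite map_inj_uniq ?iota_uniq // => i j /eqP; rewrite eqr_nat => /eqP.
Qed.

Lemma mem_natpts (R : realType) (l : nat) (v : R) :
  reflect (exists2 p, (0 < p < l)%N & v = p%:R) (v \in natpts R l).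
Proof.
apply: (iffP mapP) => -[p]; rewrite ?mem_index_iota => pl vp; exists p => //.
by rewrite mem_index_iota.
Qed.

(** A zero outside 1, ..., l - 1 would be the l-th zero of an exponential sum
    with l terms. *)
Lemma powform0_neq0 (R : realType) (l : nat) (v : R) : (0 < l)%N ->
  v \notin natpts R l -> powform l (idn R) 0 v != 0.
Proof.
move=> l0 vn; apply/eqP => Qv.
have := gap_weight_top R l0; rewrite (@expsum_zeros R _ (lograte R) (index_iota 1 l.+1)
   (v :: natpts R l)) ?eqxx //.
- exact: lograte_uniq.
- by rewrite /= vn natpts_uniq.
- by rewrite /= size_map !size_iota; lia.
- move=> y; rewrite inE -powform0_expsum => /predU1P[-> //|/mem_natpts[p pl ->]].
  by rewrite powform0_nat //; exact: nodes_up_idn.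
- by rewrite mem_index_iota l0 /=.
Qed.

(** Distance 1 contributes a constant term, so the derivative of the sum has l -
    1 terms; it has l - 2 zeros strictly between the integers 1, ..., l - 1, and
    a double zero at p would give it one more. *)
Lemma powform1_neq0 (R : realType) (l p : nat) : (0 < p < l)%N ->
  powform l (idn R) 1 p%:R != 0.
Proof.
move=> /andP[p0 pl]; have l1 : (1 < l)%N by lia.
apply/eqP => Q1.
pose g := expsum (gap_weight R l) (fun k => lograte R k - lograte R 1) (index_iota 1 l.+1).
pose g' := expsum (fun k => gap_weight R l k * (lograte R k - lograte R 1))
  (fun k => lograte R k - lograte R 1) (index_iota 2 l.+1).
have riota : index_iota 1 l.+1 = 1%N :: index_iota 2 l.+1.
  by rewrite /index_iota subSS subn0 -(ltn_predK l1) /= !subSS subn0.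
have dg (y : R) : is_derive y 1 g (g' y) by rewrite /g riota; exact: expsum_rolle_step.
have gE (y : R) : g y = powform l (idn R) 0 y.
  rewrite /g expsum_shift powform0_expsum /lograte ln1 !mulr0 oppr0 expR0 mul1r.
  by rewrite /expsum; apply: eq_bigr => k _.
have g'p : g' p%:R = 0.
  rewrite -Q1 -(derive_val (is_derive := dg p%:R)).
  have d2 := is_derive_powform l (idn R) 0 p%:R.
  by rewrite -(derive_val (is_derive := d2)) (_ : g = powform l (idn R) 0) //; apply/funext.
have incx : nodes_up (l.-2) (fun k => k.+1%:R : R) by move=> k _; rewrite ltr_nat.
have gx k : (k <= l.-2)%N -> g k.+1%:R = 0.
  by move=> kl; rewrite gE powform0_nat //; [exact: nodes_up_idn|lia].
have [xi Hxi] := rolle_nodes incx (fun y _ => dg y) gx.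
have := gap_weight_top R (ltnW l1).
have /eqP : (fun k => gap_weight R l k * (lograte R k - lograte R 1)) l = 0.
  apply: (@expsum_zeros R (fun k => gap_weight R l k * (lograte R k - lograte R 1))
    (fun k => lograte R k - lograte R 1) (index_iota 2 l.+1)
   (p%:R :: [seq xi k | k <- iota 0 l.-2])).
  - rewrite (map_comp (fun y => y - lograte R 1) (lograte R)) map_inj_uniq.
      exact: lograte_uniq.
    exact: addIr.
  - rewrite /= (nodes_interlaced_uniq incx) ?andbT; last by move=> k kl; case: (Hxi k kl).
    apply/negP => /mapP[k]; rewrite mem_iota add0n => /= kl pk.
    have [] := Hxi k kl; rewrite -pk !ltr_nat => /andP[]; lia.
  - by rewrite /= size_map !size_iota; lia.
  - move=> y; rewrite inE => /predU1P[-> //|/mapP[k]].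
    by rewrite mem_iota add0n => /= kl ->; case: (Hxi k kl).
  - by rewrite mem_index_iota l1 /=.
rewrite mulf_eq0 => /orP[-> //|].
rewrite subr_eq0 /lograte ln1 mulr0 mulf_eq0 pnatr_eq0 /= ln_eq0 ?ltr0n ?(ltnW l1) //.
by rewrite pnatr_eq1 gtn_eqF.
Qed.

(** * Stability under perturbation of the nodes *)

Definition natprod (R : realType) (l : nat) (v : R) : R :=
  \prod_(p <- natpts R l) (v - p).

Lemma continuous_prod_subr (R : realType) (s : seq R) (P : pred R) :
  continuous (fun v : R => \prod_(p <- s | P p) (v - p)).
Proof.
move=> v.
rewrite (_ : (fun _ => _) = horner (\prod_(p <- s | P p) ('X - p%:P))).
  exact: continuous_horner.
apply/funext => y; rewrite horner_prod.
by apply: eq_bigr => p _; rewrite hornerXsubC.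
Qed.

(** The common factor w is v - p near the integer p and 1 elsewhere; this gives
    a quotient that extends continuously across the integers. *)
Lemma powform0_factor (R : realType) (l : nat) (v0 : R) : (0 < l)%N ->
  exists g h w : R -> R,
    [/\ forall v, powform l (idn R) 0 v = g v * w v, forall v, natprod l v = h v * w v,
        {for v0, continuous g}, {for v0, continuous h} & g v0 != 0].
Proof.
move=> l0; have [/mem_natpts[p pl vp]|vn] := boolP (v0 \in natpts R l).
  have [+ _] := is_derive1_caratheodory (powform l (idn R) 0) p%:R (powform l (idn R) 1 p%:R).
  case; first exact: is_derive_powform.
  move=> g [gE gc gp].
  exists g, (fun v => \prod_(q <- natpts R l | q != p%:R) (v - q)), (fun v => v - p%:R).
  split.
  - by move=> v; rewrite -gE powform0_nat ?subr0 //; exact: nodes_up_idn.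
  - move=> v; rewrite /natprod (bigD1_seq p%:R) ?natpts_uniq //= 1?mulrC //.
    by apply/mem_natpts; exists p.
  - by rewrite vp.
  - exact: continuous_prod_subr.
  - by rewrite vp gp powform1_neq0.
exists (powform l (idn R) 0), (natprod l), (fun=> 1); split.
- by move=> v; rewrite mulr1.
- by move=> v; rewrite mulr1.
- have dQ := is_derive_powform l (idn R) 0 v0.
  by apply: differentiable_continuous; apply/derivable1_diffP.
- exact: continuous_prod_subr.
- exact: powform0_neq0.
Qed.

(** Both functions have the same zeros, all simple, in [0, l]; the local bounds
    are made uniform by compactness. *)
Lemma powform0_lower_bound (R : realType) (l : nat) : (0 < l)%N ->
  exists2 c : R, 0 < c &
    forall v : R, 0 <= v <= l%:R -> c * `|natprod l v| <= `|powform l (idn R) 0 v|.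
Proof.
move=> l0.
have /compact_near_coveringP cov := @segment_compact R 0 l%:R.
have loc (v0 : R) : `[0, l%:R]%classic v0 ->
    \forall v \near v0 & c \near (0 : R)^'+,
       c * `|natprod l v| <= `|powform l (idn R) 0 v|.
  move=> _; have [g [h [w [gE hE gc hc g0]]]] := powform0_factor v0 l0.
  have n0 : 0 < `|g v0| by rewrite normr_gt0.
  have g1 : \forall v \near v0, `|g v0| / 2 <= `|g v|.
    by apply: (cvgr_norm_ge _ gc); rewrite ltr_pdivrMr // ltr_pMr // ltr1n.
  have h1 : \forall v \near v0, `|h v| <= `|h v0| + 1.
    by apply: (cvgr_norm_le _ hc); rewrite ltrDl.
  have c1 : \forall c \near (0:R)^'+, c <= `|g v0| / 2 / (`|h v0| + 1).
    by apply: nbhs_right_le; rewrite !divr_gt0 // ltr_wpDl.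
  have c2 : \forall c \near (0:R)^'+, 0 <= c by apply: nbhs_right_ge.
  near=> v c; rewrite /= gE hE !normrM mulrA ler_wpM2r //.
  have cp : 0 <= c by near: c.
  apply: (@le_trans _ _ (c * (`|h v0| + 1))).
    by rewrite ler_wpM2l //; near: v.
  apply: (@le_trans _ _ (`|g v0| / 2)); last by near: v.
  by rewrite -ler_pdivlMr ?ltr_wpDl //; near: c.
have := cov R _ (fun c v => c * `|natprod l v| <= `|powform l (idn R) 0 v|)
   (at_right_proper_filter _) loc.
move=> H; have : \forall c \near (0 : R)^'+, 0 < c /\
  `[0, l%:R]%classic `<=` (fun v => c * `|natprod l v| <= `|powform l (idn R) 0 v|).
  by near=> c; split; [near: c; exact: nbhs_right_gt|near: c].
move=> /filter_ex[c [c0 Hc]]; exists c => // v vl; apply: Hc.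

Unshelve. all: by end_near. Qed.

(** The convergence of the rescaled windows of the design to 0, 1, 2, ... holds
    along this filter, uniformly in the window. *)
Definition near_idn (R : realType) (l : nat) : set_system (nat -> R) :=
  filter_from [set e : R | 0 < e]
    (fun e => [set x | forall k, (k <= l)%N -> `|x k - k%:R| < e]).

Arguments near_idn : clear implicits.

Global Instance near_idn_filter (R : realType) (l : nat) : Filter (near_idn R l).
Proof.
apply: filter_from_filter; first by exists 1 => /=.
move=> e e' /= e0 e0'; exists (Num.min e e'); first by rewrite /= lt_min e0.
by move=> x /= H; split=> k kl; have := H k kl; rewrite lt_min => /andP[].
Qed.

Lemma cvg_near_idn (R : realType) (l k : nat) : (k <= l)%N ->
  (fun x : nat -> R => x k) @ near_idn R l --> (k%:R : R).
Proof.
move=> kl; apply/cvgrPdist_lt => e e0; exists e => // x /= Hx.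
by rewrite distrC Hx.
Qed.

Lemma cvg_ddc (R : realType) (l k : nat) (T : Type) (F : set_system T) (FF : Filter F)
    (y : T -> nat -> R) :
  (forall i, (i <= l)%N -> y t i @[t --> F] --> (i%:R : R)) -> (k <= l)%N ->
  ddc l (y t) k @[t --> F] --> ddc l (idn R) k.
Proof.
move=> cy kl; rewrite /ddc; apply: cvgM; first exact: cvg_cst.
apply: cvgV.
  rewrite prodf_seq_neq0; apply/allP => j; rewrite mem_index_iota => /= jl.
  by apply/implyP => jk; apply: (nodes_up_neq (@nodes_up_idn R l)).
rewrite [X in X @ _ --> _](_ : _ = fun t => \prod_(j <- index_iota 0 l.+1 | (j != k) && (j <= l)%N) (y t k - y t j)).
  rewrite [X in _ --> X](_ : _ = \prod_(j <- index_iota 0 l.+1 | (j != k) && (j <= l)%N) (idn R k - idn R j)).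
    by apply: cvg_big => [|j /andP[_ jl]]; [exact: mul_continuous|apply: cvgB; exact: cy].
  by rewrite big_nat_cond [RHS]big_nat_cond; apply: eq_bigl => j; rewrite ltnS; case: (j <= l)%N => //=; rewrite ?andbT.
apply/funext => t.
by rewrite big_nat_cond [RHS]big_nat_cond; apply: eq_bigl => j; rewrite ltnS; case: (j <= l)%N => //=; rewrite ?andbT.
Qed.

Lemma cvg_sum_le (R : realType) (l : nat) (T : Type) (F : set_system T) (FF : Filter F)
    (f : nat -> T -> R) (a : nat -> R) :
  (forall k, (k <= l)%N -> f k t @[t --> F] --> a k) ->
  \sum_(0 <= k < l.+1) f k t @[t --> F] --> \sum_(0 <= k < l.+1) a k.
Proof.
move=> cf; rewrite big_mkord; under eq_fun do rewrite big_mkord.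
apply: cvg_big => [|k _]; first exact: add_continuous.
by apply: cf; rewrite -ltnS.
Qed.

(** Joint continuity in the exponent and in the nodes, which is what compactness
    of the range of exponents turns into uniformity. *)
Lemma cvg_powform (R : realType) (l j : nat) (v0 : R) (T : Type) (F : set_system T)
    (FF : Filter F) (v : T -> R) (y : T -> nat -> R) :
  v t @[t --> F] --> v0 ->
  (forall i, (i <= l)%N -> y t i @[t --> F] --> (i%:R : R)) ->
  powform l (y t) j (v t) @[t --> F] --> powform l (idn R) j v0.
Proof.
move=> cv cy; apply: cvg_sum_le => k kl; apply: cvg_sum_le => k' kl'.
apply: cvgM; first by apply: cvgM; exact: cvg_ddc.
have [<-|kk] := eqVneq k k'.
  under eq_fun do rewrite subrr normr0 /powker eqxx mulr0.
  by rewrite subrr normr0 /powker eqxx mulr0; exact: cvg_cst.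
have s0 : 0 < `|idn R k - idn R k'|.
  rewrite normr_gt0; apply: (nodes_up_neq (@nodes_up_idn R l)) => //.
  by rewrite eq_sym.
have cs : `|y t k - y t k'| @[t --> F] --> `|idn R k - idn R k'|.
  by apply: cvg_norm; apply: cvgB; exact: cy.
have cln : 2 * ln `|y t k - y t k'| @[t --> F] --> 2 * ln `|idn R k - idn R k'|.
  apply: cvgM; first exact: cvg_cst.
  by apply: continuous_cvg => //; exact: continuous_ln.
apply: cvgM.
  exact: (cvg_comp _ _ cln (@exprn_continuous R j _)).
rewrite {2}/powker gt_eqF //.
apply: (@cvg_trans _ (expR (v t * (2 * ln `|y t k - y t k'|)) @[t --> F])).
  apply: near_eq_cvg; near=> t.
  by rewrite /powker gt_eqF //; near: t; exact: (cvgr_gt _ cs).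
exact: (cvg_comp _ _ (cvgM cv cln) (@continuous_expR R _)).
Unshelve. all: by end_near. Qed.

Lemma powform_uniform (R : realType) (l j : nat) (eps : R) : 0 < eps ->
  \forall x \near near_idn R l, forall v, 0 <= v <= l%:R ->
    `|powform l x j v - powform l (idn R) j v| <= eps.
Proof.
move=> eps0.
have /compact_near_coveringP cov := @segment_compact R 0 l%:R.
have loc (v0 : R) : `[0, l%:R]%classic v0 ->
    \forall v \near v0 & x \near near_idn R l, `|powform l x j v - powform l (idn R) j v| <= eps.
  move=> _.
  have c1 : powform l z.2 j z.1 @[z --> (nbhs v0, near_idn R l)] --> powform l (idn R) j v0.
    apply: cvg_powform; first exact: cvg_fst.
    by move=> i il; exact: (cvg_comp snd (fun x : nat -> R => x i) cvg_snd (cvg_near_idn il)).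
  have c2 : powform l (idn R) j z.1 @[z --> (nbhs v0, near_idn R l)] --> powform l (idn R) j v0.
    apply: cvg_powform; first exact: cvg_fst.
    by move=> i il; exact: cvg_cst.
  have c3 := cvgB c1 c2; rewrite subrr in c3.
  exact: (cvgr0_norm_le _ (c3 _) _ eps0).
have := cov _ _ (fun x v => `|powform l x j v - powform l (idn R) j v| <= eps) (near_idn_filter R l) loc.
apply: filterS => x Hx v vl; apply: Hx.
by rewrite /= in_itv.
Qed.

Lemma near_idn_nodes_up (R : realType) (l : nat) :
  \forall x \near near_idn R l, nodes_up l x.
Proof.
exists (2^-1) => /=; first by rewrite invr_gt0.
move=> x Hx k kl; have := Hx k (ltnW kl); have := Hx k.+1 kl.
rewrite -natr1 !ltr_norml => /andP[+ _] /andP[_]; lra.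
Qed.

(** Both functions vanish at 1, ..., l - 1, so the interpolation remainder
    bounds their difference by the product of the v - p times a uniformly small
    derivative, and [powform0_lower_bound] bounds that product. *)
Lemma powform0_close (R : realType) (l : nat) (eps : R) : (0 < l)%N -> 0 < eps ->
  \forall x \near near_idn R l, forall v, 0 <= v <= l%:R -> v \notin natpts R l ->
    `|powform l x 0 v - powform l (idn R) 0 v| <= eps * `|powform l (idn R) 0 v|.
Proof.
move=> l0 eps0; have [c c0 Hc] := powform0_lower_bound R l0.
have e0 : 0 < eps * c * (l.-1)`!%:R by rewrite !mulr_gt0 // ltr0n fact_gt0.
near=> x => v vl vn.
have incx : nodes_up l x by near: x; exact: near_idn_nodes_up.
(* Both terms of the difference vanish at 1, ..., l - 1. *)
have [||y ys|xi xir /eqP] := @interpolation_remainder R l.-1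
    (fun j y => powform l x j y - powform l (idn R) j y) (natpts R l) 0 l%:R v _ (natpts_uniq R l) _ _ vl vn.
- move=> j jl y _; exact: (@is_deriveB _ _ _ _ _ _ _ _ _ (is_derive_powform _ _ _ _) (is_derive_powform _ _ _ _)).
- by rewrite size_map size_iota subn1.
- have /mem_natpts[p /andP[p0 pl] ->] := ys.
  split; first by rewrite ler0n ler_nat ltnW.
  by rewrite !powform0_nat ?p0 ?pl ?subrr //; exact: nodes_up_idn.
rewrite -/(natprod l v) => E.
have Hxi : `|powform l x l.-1 xi - powform l (idn R) l.-1 xi| <= eps * c * (l.-1)`!%:R.
  by move: xi xir {E}; near: x; exact: powform_uniform.
have f0 : 0 < (l.-1)`!%:R :> R by rewrite ltr0n fact_gt0.
rewrite -(ler_pM2r f0) -[X in _ * X <= _](gtr0_norm f0) -normrM (eqP E) normrM.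
apply: (@le_trans _ _ (eps * c * (l.-1)`!%:R * `|natprod l v|)).
  by rewrite ler_wpM2r.
by rewrite mulrAC ler_wpM2r ?(ltW f0) // -mulrA ler_wpM2l ?(ltW eps0) // Hc.
Unshelve. all: by end_near. Qed.

(** At a common zero, a relative bound between functions passes to their
    derivatives. *)
Lemma derive_ratio_le (R : realType) (f g : R -> R) (p a b eps : R) :
  is_derive p 1 f a -> is_derive p 1 g b -> f p = 0 -> g p = 0 ->
  (\forall v \near p^', `|f v - g v| <= eps * `|g v|) ->
  `|a - b| <= eps * `|b|.
Proof.
move=> df dg fp gp H.
have [u [uE uc up]] := (is_derive1_caratheodory f p a).1 df.
have [w [wE wc wp]] := (is_derive1_caratheodory g p b).1 dg.
have c1 : eps * `|w v| - `|u v - w v| @[v --> p] --> eps * `|b| - `|a - b|.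
  rewrite -up -wp; apply: cvgB.
    by apply: cvgM; [exact: cvg_cst|exact: cvg_norm].
  by apply: cvg_norm; apply: cvgB.
rewrite -subr_ge0 leNgt; apply/negP => lt0.
have H2 : \forall v \near p^', eps * `|w v| - `|u v - w v| < 0.
  by apply: cvg_within; exact: (cvgr_lt _ c1).
have [v []] : exists v, [/\ v != p, eps * `|w v| - `|u v - w v| < 0 &
    `|f v - g v| <= eps * `|g v|].
  have : \forall v \near p^', [/\ v != p, eps * `|w v| - `|u v - w v| < 0 &
    `|f v - g v| <= eps * `|g v|].
    by near=> v; split; near: v => //; exact: nbhs_dnbhs_neq.
  by move/filter_ex.
move=> vp; rewrite subr_lt0 ltNge => /negP H3 H4; apply: H3.
move: H4; rewrite -[f v]subr0 -fp uE -[g v]subr0 -gp wE -mulrBl !normrM mulrA.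
by rewrite ler_pM2r // normr_gt0 subr_eq0.
Unshelve. all: by end_near. Qed.

Lemma natpts_punctured (R : realType) (l p : nat) : (0 < p < l)%N ->
  \forall v \near ((p%:R : R)^'), 0 <= v <= l%:R /\ v \notin natpts R l.
Proof.
move=> /andP[p0 pl]; exists 1 => //= v /= vp vnp.
have : `|p%:R - v| < 1 by [].
rewrite ltr_norml => /andP[H1 H2]; split.
  have p1 : (1 : R) <= p%:R by rewrite ler1n.
  have p2 : (p%:R : R) + 1 <= l%:R by rewrite natr1 ler_nat.
  by apply/andP; split; lra.
apply/negP => /mem_natpts[q _ vq]; move: H1 H2 vnp; rewrite vq.
have [qp|qp|->] := ltngtP q p; last by rewrite eqxx.
  have : (q%:R : R) + 1 <= p%:R by rewrite natr1 ler_nat.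
  by move=> h1 h2 h3; exfalso; lra.
have : (p%:R : R) + 1 <= q%:R by rewrite natr1 ler_nat.
by move=> h1 h2 h3; exfalso; lra.
Qed.

Lemma natpts_int (R : realType) (l : nat) (v : R) : 0 < v -> v < l%:R ->
  (v \in natpts R l) = (v \is a Num.int).
Proof.
move=> v0 vl; apply/mem_natpts/idP => [[p _ ->]|vi]; first by rewrite intr_nat.
have [p vp pl] := int_lt_natr (ltW v0) vl vi.
by exists p => //; rewrite pl -(ltr0n R) -vp v0.
Qed.

(** For integer v the bound is the limit of the one at nearby exponents, since
    both differences are then derivatives in v at a common zero. *)
Lemma DG_close (R : realType) (l : nat) (eps : R) : (0 < l)%N -> 0 < eps ->
  \forall x \near near_idn R l, nodes_up l x /\ forall v, 0 < v -> v < l%:R ->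
    `|DG l v x - DG l v (idn R)| <= eps * `|DG l v (idn R)|.
Proof.
move=> l0 eps0; near=> x; have incx : nodes_up l x by near: x; exact: near_idn_nodes_up.
split=> // v v0 vl.
have close : forall v, 0 <= v <= l%:R -> v \notin natpts R l ->
    `|powform l x 0 v - powform l (idn R) 0 v| <= eps * `|powform l (idn R) 0 v|.
  by near: x; exact: powform0_close.
have [vi|vi] := boolP (v \is a Num.int); last first.
  by rewrite !DG_nonint // close ?natpts_int // !ltW.
rewrite -(ler_pM2l (ltr0n R 2)) -[X in X * _](gtr0_norm (ltr0n R 2)) -normrM mulrBr.
rewrite mulrCA -[X in eps * (X * _)](gtr0_norm (ltr0n R 2)) -normrM !DG_int //.
have [p vp pl] := int_lt_natr (ltW v0) vl vi.
have p0l : (0 < p < l)%N by rewrite pl -(ltr0n R) -vp v0.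
apply: (derive_ratio_le (is_derive_powform l x 0 v) (is_derive_powform l (idn R) 0 v)).
- by rewrite vp powform0_nat.
- by rewrite vp powform0_nat //; exact: nodes_up_idn.
rewrite vp; have := @natpts_punctured R l p p0l.
by apply: filterS => y [yl yn]; exact: close.
Unshelve. all: by end_near. Qed.

Lemma DG_idn_neq0 (R : realType) (l : nat) (v : R) : 0 < v -> v < l%:R ->
  DG l v (idn R) != 0.
Proof.
move=> v0 vl; have l0 : (0 < l)%N by rewrite -(ltr0n R) (lt_trans v0).
have [vi|vi] := boolP (v \is a Num.int); last first.
  by rewrite DG_nonint // powform0_neq0 // natpts_int.
have [p vp pl] := int_lt_natr (ltW v0) vl vi.
have : 2 * DG l v (idn R) != 0.
  by rewrite DG_int // vp powform1_neq0 // pl -(ltr0n R) -vp v0.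
by rewrite mulf_eq0 pnatr_eq0.
Qed.

(** * Gaussian integrals *)

(** Completing the square. *)
Lemma gauss_expR_quadratic (R : realType) (al be x : R) : al < 1 ->
  expR (al * x ^+ 2 / 2 + be * x) * normal_pdf 0 1 x =
  (Num.sqrt (1 - al))^-1 * expR (be ^+ 2 / (2 * (1 - al))) *
  normal_pdf (be / (1 - al)) ((Num.sqrt (1 - al))^-1) x.
Proof.
move=> al1; have c0 : 0 < 1 - al by rewrite subr_gt0.
have s0 : 0 < Num.sqrt (1 - al) by rewrite sqrtr_gt0.
rewrite !normal_pdfE ?oner_neq0 ?invr_neq0 ?gt_eqF //.
have -> : normal_peak ((Num.sqrt (1 - al))^-1) = Num.sqrt (1 - al) * normal_peak 1.
  rewrite /normal_peak exprVn sqr_sqrtr ?(ltW c0) // expr1n mul1r -mulrnAr.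
  by rewrite sqrtrM ?invr_ge0 ?(ltW c0) // sqrtrV ?(ltW c0) // invfM invrK.
have -> : forall q e pk nf : R, q != 0 -> q^-1 * e * (q * pk * nf) = pk * (e * nf).
  by move=> q e pk nf q0; field.
  rewrite /normal_fun mulrCA -!expRD exprVn sqr_sqrtr ?(ltW c0) //.
  congr (_ * expR _); have c1 : 1 - al != 0 by rewrite gt_eqF.
  by field.
by rewrite gt_eqF.
Qed.

Lemma gauss_expR_tilt (R : realType) (m s lam x : R) : s != 0 ->
  expR (lam * (x - m)) * normal_pdf m s x =
  expR (lam ^+ 2 * s ^+ 2 / 2) * normal_pdf (m + lam * s ^+ 2) s x.
Proof.
move=> s0; rewrite !normal_pdfE // /normal_fun mulrCA [RHS]mulrCA -!expRD.
by congr (_ * expR _); field.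
Qed.

Lemma integral_gauss_expR_quadratic (R : realType) (al be : R) : al < 1 ->
  (\int[lebesgue_measure]_x (expR (al * x ^+ 2 / 2 + be * x) * normal_pdf 0 1 x)%:E =
   ((Num.sqrt (1 - al))^-1 * expR (be ^+ 2 / (2 * (1 - al))))%:E)%E.
Proof.
move=> al1; under eq_integral do rewrite gauss_expR_quadratic // EFinM.
rewrite integralZl //; last exact: integrable_normal_pdf.
by rewrite integral_normal_pdf mule1.
Qed.

Lemma integral_gauss_expR (R : realType) (m s lam : R) : s != 0 ->
  (\int[lebesgue_measure]_x (expR (lam * (x - m)) * normal_pdf m s x)%:E =
   (expR (lam ^+ 2 * s ^+ 2 / 2))%:E)%E.
Proof.
move=> s0; under eq_integral do rewrite gauss_expR_tilt // EFinM.
rewrite integralZl //; last exact: integrable_normal_pdf.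
by rewrite integral_normal_pdf mule1.
Qed.

Lemma integrable_gauss_expR (R : realType) (m s lam : R) : s != 0 ->
  lebesgue_measure.-integrable [set: R]
    (EFin \o (fun x => expR (lam * (x - m)) * normal_pdf m s x)).
Proof.
move=> s0; rewrite (_ : _ \o _ = fun x => (expR (lam ^+ 2 * s ^+ 2 / 2))%:E *
    (normal_pdf (m + lam * s ^+ 2) s x)%:E)%E; last first.
  by apply/funext => x /=; rewrite gauss_expR_tilt.
exact/integrableZl/integrable_normal_pdf.
Qed.

Lemma ge1D_expR_norm (R : realType) (x : R) : 1 + `|x| <= expR x + expR (- x).
Proof.
have [x0|x0] := leP 0 x.
  by rewrite ger0_norm // (le_trans (expR_ge1Dx x)) // lerDl expR_ge0.
by rewrite ltr0_norm // (le_trans (expR_ge1Dx (- x))) // lerDr expR_ge0.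
Qed.

Lemma integrable_gauss_norm1 (R : realType) (m s : R) : s != 0 ->
  lebesgue_measure.-integrable [set: R]
    (EFin \o (fun x => (1 + `|x - m|) * normal_pdf m s x)).
Proof.
move=> s0.
have mp : measurable_fun setT (fun x : R => (1 + `|x - m|) * normal_pdf m s x).
  apply: measurable_funM; last exact: measurable_normal_pdf.
  apply: measurable_funD => //; apply: measurableT_comp => //.
  exact: measurable_funB.
have i1 := integrable_gauss_expR m 1 s0.
have i2 := integrable_gauss_expR m (-1) s0.
apply: (le_integrable measurableT _ _ (integrableD measurableT i1 i2)).
  exact/measurable_EFinP.
move=> x _ /=; rewrite lee_fin !mul1r mulN1r -mulrDl !normrM.
rewrite ler_wpM2r // (le_trans _ (ler_norm _)) //.
by rewrite [X in X <= _]ger0_norm ?addr_ge0 // ge1D_expR_norm.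
Qed.

Section normal_cosine.
Variables (R : realType) (m s : R).
Hypothesis s0 : s != 0.

Let p := normal_pdf m s.

Lemma is_derive_normal_pdf (x : R) :
  is_derive x 1 (normal_pdf m s) (- (x - m) / s ^+ 2 * normal_pdf m s x).
Proof.
rewrite normal_pdfE //.
have d1 : is_derive x 1 (fun x : R => - (x - m) ^+ 2 / (s ^+ 2 *+ 2)) (- (x - m) / s ^+ 2).
  by apply: is_derive_eq; rewrite /GRing.scale /=; field.
have d2 := @is_derive1_comp _ expR _ x _ _ (is_derive_expR _) d1.
have d3 := is_deriveZ (normal_peak s) d2.
have -> : - (x - m) / s ^+ 2 * (normal_peak s * normal_fun m s x) =
  normal_peak s *: (expR (- (x - m) ^+ 2 / (s ^+ 2 *+ 2)) * (- (x - m) / s ^+ 2)).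
  by rewrite /normal_fun /GRing.scale /=; ring.
exact: d3.
Qed.

Lemma is_derive_sin_affine (a b x : R) :
  is_derive x 1 (fun x => sin (a + b * (x - m))) (b * cos (a + b * (x - m))).
Proof.
have d1 : is_derive x 1 (fun x : R => a + b * (x - m)) b.
  by apply: is_derive_eq; rewrite /GRing.scale /=; ring.
have d2 := @is_derive1_comp _ sin _ x _ _ (is_derive_sin _) d1.
by have -> : b * cos (a + b * (x - m)) = cos (a + b * (x - m)) * b by ring.
Qed.

Lemma measurable_affine (a b : R) : measurable_fun setT (fun x : R => a + b * (x - m)).
Proof. by apply: measurable_funD => //; apply: measurable_funM => //; exact: measurable_funB. Qed.

Lemma measurable_cos_affine (a b : R) : measurable_fun setT (fun x : R => cos (a + b * (x - m))).
Proof.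
apply: measurableT_comp; last exact: measurable_affine.
by apply: continuous_measurable_fun; exact: continuous_cos.
Qed.

Lemma measurable_sin_affine (a b : R) : measurable_fun setT (fun x : R => sin (a + b * (x - m))).
Proof.
apply: measurableT_comp; last exact: measurable_affine.
by apply: continuous_measurable_fun; exact: continuous_sin.
Qed.

Lemma integrable_dominated_norm1 (C : R) (f : R -> R) :
  measurable_fun setT f -> (forall x, `|f x| <= C * (1 + `|x - m|)) ->
  lebesgue_measure.-integrable [set: R] (EFin \o (fun x => f x * p x)).
Proof.
move=> mf Hf; have i1 := integrableZl measurableT C (integrable_gauss_norm1 m s0).
apply: (le_integrable measurableT _ _ i1).
  apply/measurable_EFinP; apply: measurable_funM => //; exact: measurable_normal_pdf.
move=> x _ /=; rewrite lee_fin !normrM mulrA.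
rewrite ler_wpM2r // (le_trans (Hf x)) // [`|1 + _|]ger0_norm ?addr_ge0 //.
by rewrite ler_wpM2r ?addr_ge0 // ler_norm.
Qed.

(** A crude polynomial bound of the tail, enough for boundary terms to vanish. *)
Lemma normal_pdf_le_inv (x : R) : p x <= normal_peak s * (2 * s ^+ 2) / (2 * s ^+ 2 + (x - m) ^+ 2).
Proof.
have s2 : 0 < s ^+ 2 by rewrite exprn_even_gt0.
have d0 : 0 < 2 * s ^+ 2 + (x - m) ^+ 2 by rewrite ltr_pwDl ?sqr_ge0 // mulr_gt0.
rewrite /p normal_pdfE // -mulrA ler_wpM2l ?normal_peak_ge0 //.
have q0 : 0 < 2 * s ^+ 2 / (2 * s ^+ 2 + (x - m) ^+ 2) by rewrite divr_gt0 // mulr_gt0.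
rewrite /normal_fun mulNr expRN -[leRHS]invrK lef_pV2 ?posrE ?expR_gt0 ?invr_gt0 //.
apply: le_trans (expR_ge1Dx _); rewrite invfM invrK le_eqVlt; apply/orP; left; apply/eqP.
by field.
Qed.

(** The fundamental theorem of calculus on growing intervals: the boundary terms
    vanish because H is dominated by the density. *)
Lemma integral_derive_eq0 (H h : R -> R) (C : R) : 0 <= C ->
  (forall x : R, is_derive x 1 H (h x)) -> continuous h ->
  (forall x, `|H x| <= C * p x) ->
  lebesgue_measure.-integrable [set: R] (EFin \o h) ->
  (\int[lebesgue_measure]_x (h x)%:E = 0)%E.
Proof.
move=> C0 dH ch HC ih.
pose E n : set R := `[m - n.+1%:R, m + n.+1%:R]%classic.
pose h_ n x := ((h \_ (E n)) x)%:E.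
have mh : measurable_fun setT h by exact: continuous_measurable_fun.
have [||||| _ _ lim1] := @dominated_convergence _ _ R lebesgue_measure setT measurableT h_ (EFin \o h) (abse \o (EFin \o h)).
- move=> n; apply/measurable_EFinP.
  have mE : measurable (E n) by exact: measurable_itv.
  by apply: (measurable_restrictT h mE).1; exact: measurable_funTS.
- exact/measurable_EFinP.
- apply: aeW => x _; apply: (@cvg_trans _ ((h x)%:E @[n --> \oo])); last exact: cvg_cst.
  apply: near_eq_cvg; near=> n; rewrite /h_ patchE mem_set // /E /= in_itv /=.
  have xn : `|x - m| <= n.+1%:R.
    have : `|x - m| <= n%:R by near: n; exact: nbhs_infty_ger.
    by move/le_trans; apply; rewrite ler_nat.
  by move: xn; rewrite ler_norml lerBlDl lerBrDl.
- exact: integrable_abse.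
- apply: aeW => x n _; rewrite /h_ patchE /=; case: ifP => _ //.
  by rewrite normr0 lee_fin.
pose D n := H (m + n.+1%:R) - H (m - n.+1%:R).
have DE n : (\int[lebesgue_measure]_x h_ n x = (D n)%:E)%E.
  transitivity (\int[lebesgue_measure]_(x in E n) (h x)%:E)%E.
    by rewrite [RHS]integral_mkcond; apply: eq_integral => x _; rewrite /h_ !patchE; case: ifP.
  rewrite EFinB; apply: continuous_FTC2.
  - by rewrite ltrD2l (@lt_trans _ _ 0) ?oppr_lt0 ?ltr0n.
  - exact: continuous_subspaceT.
  - have cH (x : R) : {for x, continuous H}.
      have dHx := dH x.
      by apply: differentiable_continuous; apply/derivable1_diffP.
    split=> [x _||]; [exact: ex_derive|apply: cvg_at_right_filter; exact: cH|].
    by apply: cvg_at_left_filter; exact: cH.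
  - by move=> x _; rewrite derive1E; have dHx := dH x; rewrite derive_val.
have D0 : D n @[n --> \oo] --> (0 : R).
  pose K := normal_peak s * (2 * s ^+ 2).
  have s2 : 0 < s ^+ 2 by rewrite exprn_even_gt0.
  have s22 : 0 < 2 * s ^+ 2 by rewrite mulr_gt0.
  have K0 : 0 <= K by rewrite mulr_ge0 ?normal_peak_ge0 // ltW.
  have Hb (u : R) n : u ^+ 2 = n.+1%:R ^+ 2 -> `|H (m + u)| <= C * K * n.+1%:R^-1.
    move=> un; apply: (le_trans (HC _)); rewrite -mulrA ler_wpM2l //.
    apply: (le_trans (normal_pdf_le_inv _)); rewrite -/K ler_wpM2l //.
    rewrite addrAC subrr add0r un lef_pV2 ?posrE ?ltr0n //.
      rewrite ler_wpDl ?(ltW s22) // expr2 ler_peMl ?ler0n //.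
      by rewrite ler1n.
    by rewrite addr_gt0 // exprn_gt0.
  apply/norm_cvg0P.
  apply: (@squeeze_cvgr _ _ _ _ (cst 0) (fun n => 2 * (C * K) * n.+1%:R^-1)).
  - apply: nearW => n; rewrite normr_ge0 /= /D (le_trans (ler_normB _ _)) //.
    by rewrite -mulrA mulr_natl mulr2n lerD // Hb // sqrrN.
  - exact: cvg_cst.
  - rewrite -[X in _ --> X](mulr0 (2 * (C * K))).
    by apply: cvgM; [exact: cvg_cst|exact: cvg_harmonic].
have lim2 : (D n)%:E @[n --> \oo] --> 0%E by apply: cvg_EFin D0; exact: nearW.
apply: (cvg_unique _ lim1); rewrite // (_ : [sequence _]_n = EFin \o D) //.
by apply/funext => n /=; rewrite DE.
Unshelve. all: by end_near. Qed.

Lemma continuous_affine_sub (a b : R) : continuous (fun x : R => a + b * (x - m)).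
Proof.
move=> x; apply: cvgD; first exact: cvg_cst.
by apply: cvgM; [exact: cvg_cst|apply: cvgB => //; exact: cvg_cst].
Qed.

(** Integration by parts, in the form of a derivative of mean zero. *)
Lemma integral_gauss_sin_by_parts (a b : R) :
  \int[lebesgue_measure]_x ((x - m) * sin (a + b * (x - m)) * p x) =
  s ^+ 2 * b * \int[lebesgue_measure]_x (cos (a + b * (x - m)) * p x).
Proof.
have i1 : lebesgue_measure.-integrable [set: R]
    (EFin \o (fun x => cos (a + b * (x - m)) * p x)).
  apply: (@integrable_dominated_norm1 1); first exact: measurable_cos_affine.
  by move=> x; rewrite mul1r (le_trans (cos_max _)) // lerDl.
have i2 : lebesgue_measure.-integrable [set: R]
    (EFin \o (fun x => (x - m) * sin (a + b * (x - m)) * p x)).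
  apply: (@integrable_dominated_norm1 1).
    by apply: measurable_funM; [exact: measurable_funB|exact: measurable_sin_affine].
  move=> x; rewrite mul1r normrM (@le_trans _ _ (`|x - m| * 1)) //.
    by rewrite ler_wpM2l // sin_max.
  by rewrite mulr1 lerDr.
have i3 : lebesgue_measure.-integrable [set: R]
    (EFin \o (fun x => s ^+ 2 * b * (cos (a + b * (x - m)) * p x))).
  exact: (integrableZl measurableT (s ^+ 2 * b) i1).
apply/esym/eqP; rewrite -subr_eq0 -RintegralZl // -RintegralB //.
apply/eqP; rewrite /Rintegral; have -> // : forall u, u = 0%E -> fine u = 0 :> R by move=> u ->.
transitivity (\int[lebesgue_measure]_x ((s ^+ 2 * b * cos (a + b * (x - m)) -
    (x - m) * sin (a + b * (x - m))) * p x)%:E)%E.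
  by apply: eq_integral => x _; congr EFin; ring.
apply: (@integral_derive_eq0 (fun x => s ^+ 2 * (sin (a + b * (x - m)) * p x))
  (fun x => (s ^+ 2 * b * cos (a + b * (x - m)) - (x - m) * sin (a + b * (x - m))) * p x)
  (s ^+ 2)).
- exact: sqr_ge0.
- move=> x; have d1 := is_deriveM (is_derive_sin_affine a b x) (is_derive_normal_pdf x).
  have d2 := is_deriveZ (s ^+ 2) d1; apply: is_derive_eq.
  rewrite /GRing.scale /= /p; have s2 : s ^+ 2 != 0 by rewrite expf_neq0.
  by field.
- move=> x; apply: cvgM; last exact: continuous_normal_pdf.
  apply: cvgB.
    apply: cvgM; first exact: cvg_cst.
    apply: (cvg_comp _ _ (@continuous_affine_sub a b x)); exact: continuous_cos.
  apply: cvgM; first by apply: cvgB => //; exact: cvg_cst.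
  apply: (cvg_comp _ _ (@continuous_affine_sub a b x)); exact: continuous_sin.
- move=> x; rewrite normrM (ger0_norm (sqr_ge0 s)) ler_wpM2l ?sqr_ge0 // normrM.
  by rewrite [`|p x|]ger0_norm ?normal_pdf_ge0 // ler_piMl ?normal_pdf_ge0 // sin_max.
- apply: (@integrable_dominated_norm1 (`|s ^+ 2 * b| + 1)).
    apply: measurable_funB; apply: measurable_funM => //.
    + exact: measurable_cos_affine.
    + exact: measurable_funB.
    + exact: measurable_sin_affine.
  move=> x; rewrite (le_trans (ler_normB _ _)) // [leRHS]mulrDl lerD ?mul1r //.
    by rewrite normrM ler_wpM2l // (le_trans (cos_max _)) // lerDl.
  by rewrite normrM (le_trans (ler_wpM2l _ (sin_max _))) // mulr1 lerDr.
Qed.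

(** As a function of b the mean satisfies y' = - s^2 b y. *)
Lemma is_derive_mean_cos (a b : R) :
  is_derive b 1 (fun b => \int[lebesgue_measure]_x (cos (a + b * (x - m)) * p x))
    (- (s ^+ 2 * b * \int[lebesgue_measure]_x (cos (a + b * (x - m)) * p x))).
Proof.
have bI : `]b - 1, b + 1[%classic b by rewrite /= in_itv /= ltrBlDr ltrDl ltr01.
have dcos (y x : R) : is_derive y 1 (fun y : R => cos (a + y * (x - m)) * p x)
    (- ((x - m) * sin (a + y * (x - m)) * p x)).
  have d1 : is_derive y 1 (fun y : R => a + y * (x - m)) (x - m).
    by apply: is_derive_eq; rewrite /GRing.scale /=; ring.
  have d2 := @is_derive1_comp _ cos _ y _ _ (is_derive_cos _) d1.
  have d3 := is_deriveZ (p x) d2.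
  rewrite (_ : (fun y => cos (a + y * (x - m)) * p x) =
     p x \*: (cos \o (fun y : R => a + y * (x - m)))); last first.
    by apply/funext => z /=; rewrite mulrC.
  apply: is_derive_eq; rewrite /GRing.scale /=; ring.
have partE y x : partial1of2 (fun y x => cos (a + y * (x - m)) * p x) y x =
    - ((x - m) * sin (a + y * (x - m)) * p x).
  by rewrite /partial1of2 derive1E; have d := dcos y x; rewrite derive_val.
have icos y : lebesgue_measure.-integrable [set: R] (EFin \o (fun x => cos (a + y * (x - m)) * p x)).
  apply: (@integrable_dominated_norm1 1); first exact: measurable_cos_affine.
  by move=> x; rewrite mul1r (le_trans (cos_max _)) // lerDl.
have H1 := @derivable_under_integral R _ _ lebesgue_measure
  (fun y x => cos (a + y * (x - m)) * p x) setT measurableT b _ _ bI _ _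
  (fun x => (1 + `|x - m|) * p x).
have H2 := @differentiation_under_integral R _ _ lebesgue_measure
  (fun y x => cos (a + y * (x - m)) * p x) setT measurableT b _ _ bI _ _
  (fun x => (1 + `|x - m|) * p x).
have G0 x : 0 <= (1 + `|x - m|) * p x by rewrite mulr_ge0 ?addr_ge0 ?normal_pdf_ge0.
have Gub y x : `|partial1of2 (fun y x => cos (a + y * (x - m)) * p x) y x| <= (1 + `|x - m|) * p x.
  rewrite partE normrN normrM [`|p x|]ger0_norm ?normal_pdf_ge0 //.
  rewrite ler_wpM2r ?normal_pdf_ge0 // normrM (le_trans (ler_wpM2l _ (sin_max _))) //.
  by rewrite mulr1 lerDr.
have iG := integrable_gauss_norm1 m s0.
apply: DeriveDef.
  exact: H1.
rewrite -derive1E H2 //.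
rewrite -integral_gauss_sin_by_parts.
under eq_Rintegral do rewrite partE -mulN1r.
rewrite RintegralZl ?mulN1r //.
apply: (@integrable_dominated_norm1 1).
  by apply: measurable_funM; [exact: measurable_funB|exact: measurable_sin_affine].
move=> x; rewrite mul1r normrM (le_trans (ler_wpM2l _ (sin_max _))) //.
by rewrite mulr1 lerDr.
Qed.

(** The ordinary differential equation of [is_derive_mean_cos] is solved by its
    integrating factor. *)
Lemma mean_cos (a b : R) :
  \int[lebesgue_measure]_x (cos (a + b * (x - m)) * p x) =
  cos a * expR (- (b ^+ 2 * s ^+ 2 / 2)).
Proof.
pose F b := \int[lebesgue_measure]_x (cos (a + b * (x - m)) * p x).
pose E (b : R) := expR (s ^+ 2 / 2 * b ^+ 2).
have dE (y : R) : is_derive y 1 E (s ^+ 2 * y * E y).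
  have d1 : is_derive y 1 (fun y : R => s ^+ 2 / 2 * y ^+ 2) (s ^+ 2 * y).
    by apply: is_derive_eq; rewrite /GRing.scale /=; field.
  have d2 := @is_derive1_comp _ expR _ y _ _ (is_derive_expR _) d1.
  by rewrite mulrC.
have dFE (y : R) : is_derive y 1 (fun y => F y * E y) 0.
  have d1 := is_deriveM (is_derive_mean_cos a y) (dE y).
  apply: is_derive_eq; rewrite /GRing.scale /= -/(F y); ring.
have F0 : F 0 * E 0 = cos a.
  rewrite /E expr0n /= mulr0 expR0 mulr1 /F.
  under eq_Rintegral do rewrite mul0r addr0.
  rewrite RintegralZl //; last exact: integrable_normal_pdf.
  by rewrite /Rintegral integral_normal_pdf /= mulr1.
have const : F b * E b = F 0 * E 0.
  exact: (is_derive_0_is_cst b 0 dFE).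
apply: (@mulIf _ (E b)); first by rewrite gt_eqF // expR_gt0.
rewrite -/(F b) const F0 -[RHS]mulrA -expRD.
by rewrite (_ : _ + _ = 0) ?expR0 ?mulr1 //; ring.
Qed.

End normal_cosine.

(** * Transforms and moments of a Gaussian variable *)

Lemma integral_normal_prob (R : realType) (m s : R) (h : R -> \bar R) : s != 0 ->
  measurable_fun setT h -> (forall x, 0 <= h x)%E ->
  (\int[normal_prob m s]_x h x =
   \int[lebesgue_measure]_x (h x * (normal_pdf m s x)%:E))%E.
Proof.
move=> s0 mh h0.
pose nu : {finite_measure set _ -> \bar R} := normal_prob m s.
have numu : nu `<< (@lebesgue_measure R) by exact: normal_prob_dominates.
rewrite -(Radon_Nikodym_SigmaFinite.change_of_variables numu h0 measurableT mh).
have fi := Radon_Nikodym_SigmaFinite.f_integrable numu.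
have pdfae : ae_eq (@lebesgue_measure R) setT (Radon_Nikodym_SigmaFinite.f nu lebesgue_measure)
    (fun x => (normal_pdf m s x)%:E).
  apply: integral_ae_eq => //.
    by apply/measurable_EFinP; exact: measurable_normal_pdf.
  by move=> E _ mE; rewrite -Radon_Nikodym_SigmaFinite.f_integral.
apply: ae_eq_integral => //.
- by apply: emeasurable_funM => //; exact: (measurable_int _ fi).
- apply: emeasurable_funM => //; apply/measurable_EFinP; exact: measurable_normal_pdf.
- exact: ae_eqe_mul2l.
Qed.

Section gaussian_law_transform.
Variables (R : realType) (d : measure_display) (T : measurableType d).
Variables (P : probability T R) (Y : T -> R) (m s : R).
Hypothesis mY : measurable_fun setT Y.
Hypothesis lawY : forall A : set R, measurable A -> P (Y @^-1` A) = gaussian_law m s A.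

(** The degenerate law s = 0 is a point mass, hence the case distinction. *)
Lemma integral_gaussian_law (h : R -> R) :
  measurable_fun setT h -> (forall x, 0 <= h x) ->
  (\int[P]_w (h (Y w))%:E = if (s == 0)%R then (h m)%:E
    else \int[lebesgue_measure]_x (h x * normal_pdf m s x)%:E)%E.
Proof.
move=> mh h0; have mY' : @measurable_fun _ _ T (measurableTypeR R) setT Y by exact: mY.
pose Z : {mfun T >-> measurableTypeR R} :=
  HB.pack Y (isMeasurableFun.Build _ _ T (measurableTypeR R) Y mY').
have mEh : measurable_fun setT (EFin \o h) by exact/measurable_EFinP.
have -> : (\int[P]_w (h (Y w))%:E = \int[distribution P Z]_y (h y)%:E)%E.
  by rewrite (@ge0_integral_distribution _ _ _ _ _ P Z (EFin \o h)) // => y; rewrite lee_fin.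
case: ifPn => [s0|s0].
  rewrite (eq_measure_integral (@dirac _ (measurableTypeR R) m R)) => [|A mA _]; last first.
    by have := lawY mA; rewrite /gaussian_law s0.
  by rewrite integral_dirac //= diracT mul1e.
transitivity (\int[normal_prob m s]_x (h x)%:E)%E.
  rewrite [LHS](eq_measure_integral (normal_prob m s)) // => A mA _.
  by have := lawY mA; rewrite /gaussian_law (negbTE s0).
by rewrite (@integral_normal_prob _ m s (EFin \o h)).
Qed.

Lemma expectation_expR_gaussian (lam : R) :
  (\int[P]_w (expR (lam * (Y w - m)))%:E = (expR (lam ^+ 2 * s ^+ 2 / 2))%:E)%E.
Proof.
rewrite (@integral_gaussian_law (fun y => expR (lam * (y - m)))).
- case: eqVneq => [->|s0]; last exact: integral_gauss_expR.
  by rewrite subrr mulr0 expr0n /= mulr0 mul0r.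
- apply: measurableT_comp => //; apply: measurable_funM => //.
  exact: measurable_funB.
- by move=> x; exact: expR_ge0.
Qed.

(** The constant 1 makes the integrand nonnegative, so that the law of Y can be
    used before integrability is known. *)
Lemma expectation_1cos_gaussian (b : R) :
  (\int[P]_w (1 + cos (b * (Y w - m)))%:E = (1 + expR (- (b ^+ 2 * s ^+ 2 / 2)))%:E)%E.
Proof.
have mc : measurable_fun setT (fun y : R => cos (b * (y - m))).
  apply: measurableT_comp; first by apply: continuous_measurable_fun; exact: continuous_cos.
  by apply: measurable_funM => //; exact: measurable_funB.
rewrite (@integral_gaussian_law (fun y => 1 + cos (b * (y - m)))).
- case: eqVneq => [->|s0].
    by rewrite subrr mulr0 expr0n /= mulr0 mul0r oppr0 expR0 cos0.
  have icos : lebesgue_measure.-integrable [set: R]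
      (EFin \o (fun x => cos (b * (x - m)) * normal_pdf m s x)).
    apply: (integrable_dominated_norm1 s0 (C := 1)) => // x.
    by rewrite mul1r (le_trans (cos_max _)) // lerDl.
  under eq_integral do rewrite mulrDl mul1r EFinD.
  rewrite integralD //; last exact: integrable_normal_pdf.
  rewrite integral_normal_pdf EFinD; congr (_ + _)%E.
  have := mean_cos m s0 0 b; rewrite cos0 mul1r => <-.
  under [in RHS]eq_Rintegral do rewrite add0r.
  by rewrite /Rintegral fineK //; exact: (integrable_fin_num measurableT icos).
- exact: measurable_funD.
- by move=> x; rewrite -lerBlDl add0r cos_geN1.
Qed.

End gaussian_law_transform.

Lemma norm_sin_le (R : realType) (x : R) : `|sin x| <= `|x|.
Proof.
wlog x0 : x / 0 <= x.
  move=> H; have [|/ltW x0] := leP 0 x; first exact: H.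
  by rewrite -normrN -sinN -[leRHS]normrN H // oppr_ge0.
have [|c _] := @MVT_segment R sin cos 0 x x0 (fun y _ => is_derive_sin y).
  exact/continuous_subspaceT/continuous_sin.
rewrite sin0 !subr0 => ->; by rewrite normrM ler_piMl // cos_max.
Qed.

Lemma cos_ge_quadratic (R : realType) (x : R) : 1 - x ^+ 2 / 2 <= cos x.
Proof.
pose t := x / 2.
have -> : x = t *+ 2 by rewrite -mulr_natr divfK.
rewrite cos_mulr2n cos2sin2.
have : sin t ^+ 2 <= t ^+ 2.
  by rewrite -(real_normK (num_real (sin _))) -(real_normK (num_real t)) ler_sqr ?nnegrE ?norm_sin_le.
by move: (sin t) => u; rewrite -[_ *+ 2]mulr_natr -[(1 - _) *+ 2]mulr_natr => ut; nra.
Qed.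

(** Half-angle formulas reduce the claim to the bound of sinh by its tangent at
    0. *)
Lemma cosh_ge_quadratic (R : realType) (x : R) : 2 + x ^+ 2 <= expR x + expR (- x).
Proof.
have amgm (y : R) : 0 <= expR y + expR (- y) - 2.
  have -> : expR y + expR (- y) - 2 = (expR (y / 2) - expR (- (y / 2))) ^+ 2.
    rewrite sqrrB -expRD subrr expR0 -!expRM_natl.
    by rewrite (_ : 2 * (y / 2) = y) 1?(_ : 2 * - (y / 2) = - y); [ring|field|field].
  exact: sqr_ge0.
have sinh_ge (y : R) : 0 <= y -> 2 * y <= expR y - expR (- y).
  move=> y0; rewrite -subr_ge0.
  have dN (z : R) : is_derive z 1 (fun z : R => expR (- z)) (- expR (- z)).
    have d1 : is_derive z 1 (fun z : R => - z) (-1) by apply: is_derive_eq.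
    have := @is_derive1_comp _ expR _ z _ _ (is_derive_expR _) d1.
    by rewrite mulrN1.
  have df (z : R) : is_derive z 1 (fun z : R => expR z - expR (- z) - 2 * z)
      (expR z + expR (- z) - 2).
    have d1 := is_deriveB (is_deriveB (is_derive_expR z) (dN z)) (is_deriveZ 2 (is_derive_id z 1)).
    by apply: is_derive_eq; rewrite opprK [2%:A]mulr1.
  have [|c _] := @MVT_segment R _ _ 0 y y0 (fun z _ => df z).
    apply: derivable_within_continuous => z _.
    by have d := df z; exact: ex_derive.
  rewrite oppr0 expR0 subrr mulr0 !subr0 => ->.
  by rewrite addr0 mulr_ge0.
have {}sinh_ge (y : R) : (2 * y) ^+ 2 <= (expR y - expR (- y)) ^+ 2.
  wlog y0 : y / 0 <= y.
    move=> H; have [|/ltW y0] := leP 0 y; first exact: H.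
    have := H (- y); rewrite oppr_ge0 => /(_ y0).
    by rewrite opprK mulrN sqrrN -[X in _ <= X]sqrrN opprB.
  have y2 : 0 <= 2 * y by rewrite mulr_ge0.
  by rewrite ler_sqr ?nnegrE ?sinh_ge // (le_trans y2) // sinh_ge.
have := sinh_ge (x / 2).
rewrite sqrrB -expRD subrr expR0 -!expRM_natl mulrCA divff // mulr1.
rewrite mulrN mulrCA divff // mulr1; lra.
Qed.

Lemma expR_le_1D2x (R : realType) (u : R) : u <= 2^-1 -> 0 <= u -> expR u <= 1 + 2 * u.
Proof.
move=> u1 u0.
have e0 := expR_gt0 u.
have := expR_ge1Dx (- u); rewrite expRN => H.
have H2 : (1 - u) * expR u <= 1.
  by rewrite -ler_pdivlMr // div1r.
nra.
Qed.

Lemma expR_le_second_order (R : realType) (u : R) : u <= 2^-1 -> 0 <= u ->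
  expR u <= 1 + u + 2 * u ^+ 2.
Proof.
move=> u1 u0.
have e0 := expR_gt0 u.
have := expR_ge1Dx (- u); rewrite expRN => H.
have H2 : (1 - u) * expR u <= 1.
  by rewrite -ler_pdivlMr // div1r.
nra.
Qed.

(** Lets an error proportional to h tend to 0. *)
Lemma le_of_le_vanishing (R : realType) (a b K : R) : 0 <= K ->
  (forall h : R, 0 < h -> h <= 1 -> a <= b + h * K) -> a <= b.
Proof.
move=> K0 H; rewrite leNgt; apply/negP => ba.
have k1 : 0 < K + 1 by rewrite ltr_wpDl.
pose h := Num.min 1 ((a - b) / (2 * (K + 1))).
have h0 : 0 < h by rewrite lt_min ltr01 divr_gt0 ?subr_gt0 ?mulr_gt0.
have h1 : h <= 1 by rewrite ge_min lexx.
have h2 : h * (2 * (K + 1)) <= a - b.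
  by rewrite -ler_pdivlMr ?mulr_gt0 // ge_min lexx orbT.
have := H h h0 h1; nra.
Qed.

Section moments_from_transforms.
Variables (R : realType) (d : measure_display) (T : measurableType d).
Variables (P : probability T R) (U : T -> R) (s2 : R).
Hypothesis mU : measurable_fun setT U.
Hypothesis s2_ge0 : 0 <= s2.
Hypothesis expU : forall lam : R,
  (\int[P]_w (expR (lam * U w))%:E = (expR (lam ^+ 2 * s2 / 2))%:E)%E.
Hypothesis cosU : forall b : R,
  (\int[P]_w (1 + cos (b * U w))%:E = (1 + expR (- (b ^+ 2 * s2 / 2)))%:E)%E.

Lemma measurable_expR_transform (lam : R) : measurable_fun setT (fun w => expR (lam * U w)).
Proof. by apply: measurableT_comp => //; exact: measurable_funM. Qed.

Lemma measurable_cos_transform (lam : R) : measurable_fun setT (fun w => cos (lam * U w)).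
Proof.
apply: measurableT_comp; last exact: measurable_funM.
by apply: continuous_measurable_fun; exact: continuous_cos.
Qed.

Lemma integrable_expR_transform (lam : R) : P.-integrable setT (EFin \o (fun w => expR (lam * U w))).
Proof.
apply/integrableP; split; first exact/measurable_EFinP/measurable_expR_transform.
under eq_integral do rewrite /= ger0_norm ?expR_ge0 //.
by rewrite expU ltry.
Qed.

Lemma integrable_cosh (lam : R) :
  P.-integrable setT (EFin \o (fun w => expR (lam * U w) + expR (- (lam * U w)))).
Proof.
rewrite (_ : _ \o _ = (EFin \o (fun w => expR (lam * U w))) \+
  (EFin \o (fun w => expR (- lam * U w)))); last first.
  by apply/funext => w /=; rewrite mulNr.
apply: integrableD => //; exact: integrable_expR_transform.
Qed.

Lemma Rintegral_expR_transform (lam : R) :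
  \int[P]_w expR (lam * U w) = expR (lam ^+ 2 * s2 / 2).
Proof. by rewrite /Rintegral expU. Qed.

Lemma Rintegral_cosh (lam : R) :
  \int[P]_w (expR (lam * U w) + expR (- (lam * U w))) = 2 * expR (lam ^+ 2 * s2 / 2).
Proof.
under eq_Rintegral do rewrite -mulNr.
rewrite RintegralD //; try exact: integrable_expR_transform.
by rewrite !Rintegral_expR_transform sqrrN mulr_natl mulr2n.
Qed.

Lemma integrable_of_transforms : P.-integrable setT (EFin \o U).
Proof.
apply: (le_integrable measurableT _ _ (integrable_cosh 1)); first exact/measurable_EFinP.
move=> w _ /=; rewrite lee_fin mul1r [leRHS]ger0_norm ?addr_ge0 ?expR_ge0 //.
by rewrite (le_trans _ (ge1D_expR_norm _)) // lerDr.
Qed.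

Lemma integrable_sqr_of_transforms : P.-integrable setT (EFin \o (fun w => U w ^+ 2)).
Proof.
apply: (le_integrable measurableT _ _ (integrable_cosh 1)).
  by apply/measurable_EFinP; exact: measurable_funX.
move=> w _ /=; rewrite lee_fin mul1r [leRHS]ger0_norm ?addr_ge0 ?expR_ge0 //.
by rewrite ger0_norm ?sqr_ge0 // (le_trans _ (cosh_ge_quadratic _)) // lerDr.
Qed.

Lemma Rintegral_cst1 (c : R) : \int[P]_w (cst c w) = c.
Proof.
rewrite /Rintegral; have -> : (\int[P]_w (cst c w)%:E = c%:E * P setT)%E.
  by rewrite -integral_cst.
by rewrite probability_setT mule1.
Qed.

Lemma integrable_cst (c : R) : P.-integrable setT (EFin \o (cst c : T -> R)).
Proof. exact: finite_measure_integrable_cst. Qed.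

(** exp(x) >= 1 + x bounds the mean on both sides by terms of second order in
    lam. *)
Lemma Rintegral_of_transforms : \int[P]_w U w = 0.
Proof.
have iU := integrable_of_transforms.
have lin (lam : R) : 1 + lam * \int[P]_w U w <= expR (lam ^+ 2 * s2 / 2).
  rewrite -Rintegral_expR_transform -RintegralZl // -[X in X + _](Rintegral_cst1 1).
  rewrite -RintegralD //; last exact: (integrableZl measurableT lam iU).
    apply: le_Rintegral => //.
    - exact: (integrableD measurableT (integrable_cst 1) (integrableZl measurableT lam iU)).
    - exact: integrable_expR_transform.
    - by move=> w _; exact: expR_ge1Dx.
  exact: integrable_cst.
have s21 : 0 < s2 + 1 by rewrite ltr_wpDl.
have key (e : R) : e ^+ 2 = 1 -> e * \int[P]_w U w <= 0.
  move=> e1; apply: (@le_of_le_vanishing _ _ _ 1) => // h h0 h1.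
  rewrite add0r mulr1.
  (* For this lam the second-order term lam^2 s2 is at most h lam. *)
  pose lam := h / (s2 + 1).
  have lam0 : 0 < lam by rewrite divr_gt0.
  have lamh : lam * (s2 + 1) = h by rewrite divfK ?gt_eqF.
  have ls0 : 0 <= lam * s2 by rewrite mulr_ge0 // ltW.
  have lam1 : lam <= 1 by lra.
  have := lin (lam * e); rewrite exprMn e1 mulr1.
  have u0 : 0 <= lam ^+ 2 * s2 / 2 by rewrite divr_ge0 // mulr_ge0 // sqr_ge0.
  have u1 : lam ^+ 2 * s2 / 2 <= 2^-1.
    by rewrite -[leRHS]mul1r ler_pM2r ?invr_gt0 //; nra.
  have := expR_le_1D2x u1 u0 => H1 H2.
  have : lam * (e * \int[P]_w U w) <= lam * (lam * s2).
    by rewrite mulrA; lra.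
  rewrite ler_pM2l // => /le_trans; apply; nra.
apply/eqP; rewrite eq_le; apply/andP; split.
  by rewrite -[leLHS]mul1r key ?expr1n.
by rewrite -oppr_le0 -mulN1r key // sqrrN expr1n.
Qed.

(** The bounds cosh(x) >= 1 + x^2/2 and cos(x) >= 1 - x^2/2 give the two
    inequalities as lam tends to 0. *)
Lemma Rintegral_sqr_of_transforms : \int[P]_w (U w ^+ 2) = s2.
Proof.
have iU := integrable_sqr_of_transforms.
pose E2 := \int[P]_w (U w ^+ 2).
have quad (c lam : R) : \int[P]_w (c + lam * U w ^+ 2) = c + lam * E2.
  rewrite /E2 -RintegralZl // -[X in X + _](Rintegral_cst1 c) -RintegralD //.
    exact: integrable_cst.
  exact: (integrableZl measurableT lam iU).
have iquad (c lam : R) : P.-integrable setT (EFin \o (fun w => c + lam * U w ^+ 2)).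
  exact: (integrableD measurableT (integrable_cst c) (integrableZl measurableT lam iU)).
have up (lam : R) : 2 + lam ^+ 2 * E2 <= 2 * expR (lam ^+ 2 * s2 / 2).
  rewrite -Rintegral_cosh -quad; apply: le_Rintegral => //.
    exact: integrable_cosh.
  by move=> w _; rewrite -exprMn; exact: cosh_ge_quadratic.
have icos (lam : R) : P.-integrable setT (EFin \o (fun w => 1 + cos (lam * U w))).
  apply/integrableP; split.
    by apply/measurable_EFinP; apply: measurable_funD => //; exact: measurable_cos_transform.
  under eq_integral => w _.
    rewrite /= ger0_norm; last by rewrite -lerBlDl add0r cos_geN1.
    over.
  by rewrite cosU ltry.
have dn (lam : R) : 2 - lam ^+ 2 / 2 * E2 <= 1 + expR (- (lam ^+ 2 * s2 / 2)).
  rewrite -[leRHS]/(fine (_%:E)) -cosU -mulNr -quad; apply: le_Rintegral => //.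
  move=> w _; have := cos_ge_quadratic (lam * U w); rewrite exprMn; lra.
have s21 : 0 < s2 + 1 by rewrite ltr_wpDl.
have small (h : R) : 0 < h -> h <= 1 -> exists lam : R,
   [/\ 0 < lam ^+ 2, lam ^+ 2 * s2 <= 1 & lam ^+ 2 * s2 <= h].
  move=> h0 h1; exists (h / (s2 + 1)).
  set lam := h / (s2 + 1).
  have lam0 : 0 < lam by rewrite divr_gt0.
  have lamh : lam * (s2 + 1) = h by rewrite divfK ?gt_eqF.
  have ls0 : 0 <= lam * s2 by rewrite mulr_ge0 // ltW.
  have lam1 : lam <= 1 by lra.
  by split; [rewrite exprn_gt0|nra|nra].
apply/eqP; rewrite eq_le; apply/andP; split.
- apply: (@le_of_le_vanishing _ _ _ s2) => // h h0 h1.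
  have [lam [l0 l1 l2]] := small h h0 h1.
  have := up lam; move: l0 l1 l2; set L := lam ^+ 2 => l0 l1 l2.
  have u0 : 0 <= L * s2 / 2 by rewrite divr_ge0 // mulr_ge0 // ltW.
  have u1 : L * s2 / 2 <= 2^-1 by rewrite -[leRHS]mul1r ler_pM2r ?invr_gt0.
  have H1 := expR_le_second_order u1 u0 => H2.
  have : L * E2 <= L * (s2 + h * s2).
    apply: (@le_trans _ _ (L * s2 + (L * s2) * (L * s2))).
      have -> : L * s2 + L * s2 * (L * s2) = 2 * (L * s2 / 2 + 2 * (L * s2 / 2) ^+ 2) by field.
      lra.
    have q : 0 <= (h - L * s2) * (L * s2).
      by rewrite mulr_ge0 ?subr_ge0 // mulr_ge0 // ltW.
    lra.
  by rewrite ler_pM2l.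
- apply: (@le_of_le_vanishing _ _ _ s2) => // h h0 h1.
  have [lam [l0 l1 l2]] := small h h0 h1.
  have := dn lam; move: l0 l1 l2; set L := lam ^+ 2 => l0 l1 l2.
  have u0 : 0 <= L * s2 / 2 by rewrite divr_ge0 // mulr_ge0 // ltW.
  have H1 : expR (- (L * s2 / 2)) * (1 + L * s2 / 2) <= 1.
    by rewrite expRN mulrC ler_pdivrMr ?expR_gt0 // mul1r expR_ge1Dx.
  have e0 := expR_gt0 (- (L * s2 / 2)).
  move=> H2.
  have : L * s2 <= L * (E2 + h * s2).
    set u := L * s2 / 2 in u0 H1 e0 H2.
    have uE : L * s2 = 2 * u by rewrite /u; field.
    have H3 : u - u ^+ 2 <= 1 - expR (- u) by nra.
    have H4 : u <= h by rewrite /u; nra.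
    rewrite mulrDr mulrCA uE; nra.
  by rewrite ler_pM2l.
Qed.

End moments_from_transforms.

(** * Rank-one updates of a covariance *)

(** The covariance of a centred Gaussian vector after reweighting by exp(tau
    Z_k^2 / 2). *)
Definition cov_tilt (R : realType) (tau : R) (k : nat) (B : nat -> nat -> R) (i j : nat) : R :=
  B i j + tau / (1 - tau * B k k) * (B i k * B k j).

Fixpoint tilted_cov (R : realType) (S : nat -> nat -> R) (tau : R) (k : nat) : nat -> nat -> R :=
  if k is k'.+1 then cov_tilt tau k' (tilted_cov S tau k') else S.

(** The expectation of exp(tau/2 (Z_0^2 + ... + Z_(k-1)^2)), as a product of
    successive normalisations. *)
Fixpoint tilt_mass (R : realType) (S : nat -> nat -> R) (tau : R) (k : nat) : R :=
  if k is k'.+1 then tilt_mass S tau k' * (Num.sqrt (1 - tau * tilted_cov S tau k' k' k'))^-1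
  else 1.

Section tilt_bound.
Variables (R : realType) (N : nat).
Implicit Types (B S : nat -> nat -> R).

Definition sq_norm (k : nat) B : R := \sum_(k <= i < N) \sum_(k <= j < N) B i j ^+ 2.
Definition row_sq (k : nat) B : R := \sum_(k.+1 <= j < N) B k j ^+ 2.
Definition trace_from (k : nat) B : R := \sum_(k <= i < N) B i i.

Lemma sq_norm_split (k : nat) B : (forall i j, B i j = B j i) -> (k < N)%N ->
  sq_norm k B = B k k ^+ 2 + 2 * row_sq k B + sq_norm k.+1 B.
Proof.
move=> symB kN; rewrite /sq_norm [LHS](big_ltn kN) [X in X + _](big_ltn kN).
have -> : \sum_(k.+1 <= i < N) \sum_(k <= j < N) B i j ^+ 2 =
    row_sq k B + \sum_(k.+1 <= i < N) \sum_(k.+1 <= j < N) B i j ^+ 2.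
  rewrite /row_sq -big_split /=; apply: eq_bigr => i _.
  by rewrite (big_ltn kN) symB.
by rewrite /row_sq; ring.
Qed.

Lemma sq_norm_ge0 (k : nat) B : 0 <= sq_norm k B.
Proof. by apply: sumr_ge0 => i _; apply: sumr_ge0 => j _; exact: sqr_ge0. Qed.

Lemma row_sq_ge0 (k : nat) B : 0 <= row_sq k B.
Proof. by apply: sumr_ge0 => j _; exact: sqr_ge0. Qed.

Lemma trace_split (k : nat) B : (k < N)%N -> trace_from k B = B k k + trace_from k.+1 B.
Proof. by move=> kN; rewrite /trace_from big_ltn. Qed.

Lemma trace_cov_tilt (k : nat) (tau : R) B : (forall i j, B i j = B j i) ->
  trace_from k.+1 (cov_tilt tau k B) =
  trace_from k.+1 B + tau / (1 - tau * B k k) * row_sq k B.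
Proof.
move=> symB; rewrite /trace_from /row_sq mulr_sumr -big_split /=.
by apply: eq_bigr => i _; rewrite /cov_tilt [B i k]symB expr2.
Qed.

Let cross (k : nat) B : R :=
  \sum_(k.+1 <= i < N) \sum_(k.+1 <= j < N) B i j * (B k i * B k j).

Let sum_sqr_rank1 (k : nat) (lam : R) B :
  \sum_(k.+1 <= i < N) \sum_(k.+1 <= j < N) (B i j + lam * (B k i * B k j)) ^+ 2 =
  sq_norm k.+1 B + 2 * lam * cross k B + lam ^+ 2 * row_sq k B ^+ 2.
Proof.
have -> : row_sq k B ^+ 2 = \sum_(k.+1 <= i < N) \sum_(k.+1 <= j < N) (B k i ^+ 2 * B k j ^+ 2).
  rewrite expr2 /row_sq mulr_suml; apply: eq_bigr => i _.
  by rewrite mulr_sumr.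
rewrite /sq_norm /cross !mulr_sumr -!big_split /=; apply: eq_bigr => i _.
rewrite !mulr_sumr -!big_split /=; apply: eq_bigr => j _.
by ring.
Qed.

(** Cauchy-Schwarz, from the sign of a sum of squares as a quadratic polynomial
    in lam. *)
Lemma cross_bound (k : nat) (F : R) B : 0 < F -> sq_norm k.+1 B <= F ^+ 2 ->
  `|cross k B| <= F * row_sq k B.
Proof.
move=> F0 SF; have x0 := row_sq_ge0 k B.
have pos lam : 0 <= sq_norm k.+1 B + 2 * lam * cross k B + lam ^+ 2 * row_sq k B ^+ 2.
  rewrite -sum_sqr_rank1; apply: sumr_ge0 => i _; apply: sumr_ge0 => j _; exact: sqr_ge0.
move: x0; rewrite le_eqVlt => /predU1P[x0|x0].
  rewrite -x0 mulr0 normr_le0; apply/eqP.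
  have := pos (F ^+ 2); have := pos (- F ^+ 2).
  have := pos ((F ^+ 2 + 1) * cross k B); have := pos (- (F ^+ 2 + 1) * cross k B).
  rewrite -!x0 !expr0n /= !mulr0 !addr0 => H1 _ _ _.
  apply/eqP; rewrite -sqrf_eq0 eq_le sqr_ge0 andbT.
  have c0 := sqr_ge0 (cross k B).
  have F2 : 0 < F ^+ 2 by rewrite exprn_gt0.
  have f1 : 0 <= F ^+ 2 * cross k B ^+ 2 by rewrite mulr_ge0 // ltW.
  rewrite leNgt; apply/negP => cp.
  have := pos (- (F ^+ 2 / cross k B ^+ 2) * cross k B).
  rewrite -x0 expr0n /= mulr0 addr0.
  have -> : 2 * (- (F ^+ 2 / cross k B ^+ 2) * cross k B) * cross k B = - 2 * F ^+ 2.
    by field; rewrite -sqrf_eq0 gt_eqF.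
  lra.
have H1 := pos (F / row_sq k B); have H2 := pos (- (F / row_sq k B)).
have x1 : row_sq k B != 0 by rewrite gt_eqF.
have e1 : (F / row_sq k B) ^+ 2 * row_sq k B ^+ 2 = F ^+ 2 by field.
rewrite sqrrN in H2; rewrite e1 in H1 H2.
have e2 : F / row_sq k B * cross k B = F * (cross k B / row_sq k B) by field.
have H3 : - F <= cross k B / row_sq k B.
  rewrite -(ler_pM2l F0); have : 2 * (F * F) + 2 * (F * (cross k B / row_sq k B)) >= 0.
    by rewrite -e2; move: H1 SF; rewrite expr2; lra.
  lra.
have H4 : cross k B / row_sq k B <= F.
  rewrite -(ler_pM2l F0); have : 2 * (F * F) - 2 * (F * (cross k B / row_sq k B)) >= 0.
    by rewrite -e2; move: H2 SF; rewrite expr2; lra.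
  lra.
by rewrite ler_norml -mulNr -ler_pdivlMr // H3 -ler_pdivrMr.
Qed.

(** The square norm of the remaining block drops by the entries of row k; a
    rank-one update gives back only a small part of the off-diagonal ones. *)
Lemma sq_norm_cov_tilt (k : nat) (tau F : R) B : (forall i j, B i j = B j i) ->
  (k < N)%N -> 0 < F -> sq_norm k B <= F ^+ 2 -> `|tau| * F <= 8^-1 ->
  [/\ `|tau * B k k| <= 8^-1, tau * (tau / (1 - tau * B k k)) <= 2 * tau ^+ 2 &
    sq_norm k.+1 (cov_tilt tau k B) <= sq_norm k B - B k k ^+ 2 - row_sq k B].
Proof.
move=> symB kN F0 SF tF.
have x0 := row_sq_ge0 k B; have S0 := sq_norm_ge0 k.+1 B.
have SE := sq_norm_split symB kN.
have a2 : B k k ^+ 2 <= F ^+ 2 by have := sqr_ge0 (B k k); lra.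
have aF : `|B k k| <= F by rewrite -ler_sqr ?nnegrE ?(ltW F0) // real_normK ?num_real.
have ta : `|tau * B k k| <= 8^-1.
  by rewrite normrM (le_trans _ tF) // ler_wpM2l.
have [ta1 ta2] : tau * B k k <= 8^-1 /\ - 8^-1 <= tau * B k k.
  by move: ta; rewrite ler_norml => /andP[].
have d0 : 0 < 1 - tau * B k k by lra.
(* The bound 1/8 on tau F makes tp F at most (1/8) / (7/8) = 1/7. *)
set tp := tau / (1 - tau * B k k).
have tpE : tp * (1 - tau * B k k) = tau by rewrite /tp divfK // gt_eqF.
have tp2 : tau * tp <= 2 * tau ^+ 2.
  rewrite /tp mulrA ler_pdivrMr // -expr2.
  have := sqr_ge0 tau; nra.
have tpF : `|tp| * F <= 7^-1.
  rewrite /tp normf_div (gtr0_norm d0) mulrAC ler_pdivrMr //.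
  by apply: (le_trans tF); lra.
split => //.
have -> : sq_norm k.+1 (cov_tilt tau k B) =
   \sum_(k.+1 <= i < N) \sum_(k.+1 <= j < N) (B i j + tp * (B k i * B k j)) ^+ 2.
  by apply: eq_bigr => i _; apply: eq_bigr => j _; rewrite /cov_tilt [B i k]symB.
clearbody tp; rewrite sum_sqr_rank1 SE.
have SF' : sq_norm k.+1 B <= F ^+ 2 by have := sqr_ge0 (B k k); lra.
have cb := cross_bound F0 SF'.
have H1 : 2 * tp * cross k B <= 2 * 7^-1 * row_sq k B.
  rewrite -!mulrA ler_wpM2l // (le_trans (ler_norm _)) // normrM.
  apply: (@le_trans _ _ (`|tp| * (F * row_sq k B))); first by rewrite ler_wpM2l.
  by rewrite mulrA ler_wpM2r.
have H2 : tp ^+ 2 * row_sq k B ^+ 2 <= 49^-1 * row_sq k B.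
  have xF : row_sq k B <= F ^+ 2 by have := sqr_ge0 (B k k); lra.
  have : (`|tp| * F) ^+ 2 <= 7^-1 ^+ 2.
    by rewrite ler_sqr ?nnegrE // mulr_ge0 // ltW.
  rewrite exprMn real_normK ?num_real // => H.
  rewrite expr2 mulrA ler_wpM2r // (@le_trans _ _ (tp ^+ 2 * F ^+ 2)) //.
    by rewrite ler_wpM2l // sqr_ge0.
  by apply: (le_trans H); lra.
lra.
Qed.

Lemma invsqrt_le_expR (x : R) : `|x| <= 8^-1 ->
  (Num.sqrt (1 - x))^-1 <= expR ((x + x ^+ 2) / 2).
Proof.
rewrite ler_norml => /andP[x1 x2].
have d0 : 0 < 1 - x by lra.
have s0 : 0 < Num.sqrt (1 - x) by rewrite sqrtr_gt0.
rewrite -[leLHS]mul1r ler_pdivrMr //.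
have e0 := expR_ge0 ((x + x ^+ 2) / 2).
rewrite -ler_sqr ?nnegrE ?ler01 ?mulr_ge0 ?(ltW s0) // expr1n exprMn sqr_sqrtr ?(ltW d0) //.
rewrite -expRM_natl mulrCA divff // mulr1.
have [x0|x0] := leP x 0.
  apply: (@le_trans _ _ ((1 + (x + x ^+ 2)) * (1 - x))).
    have -> : (1 + (x + x ^+ 2)) * (1 - x) = 1 - x * x ^+ 2 by ring.
    by rewrite lerDl oppr_ge0 mulr_le0_ge0 // sqr_ge0.
  by rewrite ler_wpM2r ?(ltW d0) // expR_ge1Dx.
have -> : x + x ^+ 2 = 2 * ((x + x ^+ 2) / 2) by field.
rewrite expRM_natl.
have H1 : 1 + (x + x ^+ 2) / 2 <= expR ((x + x ^+ 2) / 2) by exact: expR_ge1Dx.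
have H2 : (1 + (x + x ^+ 2) / 2) ^+ 2 <= expR ((x + x ^+ 2) / 2) ^+ 2.
  rewrite ler_sqr ?nnegrE //; nra.
apply: (@le_trans _ _ ((1 + (x + x ^+ 2) / 2) ^+ 2 * (1 - x))); last first.
  by rewrite ler_wpM2r // ltW.
have -> : (1 + (x + x ^+ 2) / 2) ^+ 2 * (1 - x) =
   1 + x ^+ 2 * ((1 - x) * (1 + x) ^+ 2 / 4 - x) by field.
rewrite lerDl mulr_ge0 ?sqr_ge0 //; nra.
Qed.

Variables (S : nat -> nat -> R) (tau F : R).
Hypothesis symS : forall i j, S i j = S j i.
Hypothesis F_gt0 : 0 < F.
Hypothesis SF : sq_norm 0 S <= F ^+ 2.
Hypothesis tauF : `|tau| * F <= 8^-1.

Let Bk := tilted_cov S tau.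

Lemma tilted_cov_sym (k : nat) : forall i j, Bk k i j = Bk k j i.
Proof.
rewrite /Bk; elim: k => [|k IHk] //= i j; rewrite /cov_tilt IHk; congr (_ + _ * _).
by rewrite [RHS]mulrC; congr (_ * _); exact: IHk.
Qed.

Lemma sq_norm_tilted (k : nat) : (k <= N)%N -> sq_norm k (Bk k) <= F ^+ 2.
Proof.
elim: k => [//|k IHk] kN.
have [_ _ H] := sq_norm_cov_tilt (tilted_cov_sym k) kN F_gt0 (IHk (ltnW kN)) tauF.
apply: (le_trans H); rewrite -addrA -opprD (le_trans _ (IHk (ltnW kN))) // gerBl.
by rewrite addr_ge0 ?sqr_ge0 ?row_sq_ge0.
Qed.

Lemma tilted_diag_small (k : nat) : (k < N)%N -> `|tau * Bk k k k| <= 8^-1.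
Proof.
move=> kN.
by have [] := sq_norm_cov_tilt (tilted_cov_sym k) kN F_gt0 (sq_norm_tilted (ltnW kN)) tauF.
Qed.

Lemma tilt_mass_ge0 (k : nat) : 0 <= tilt_mass S tau k.
Proof. by elim: k => [|k IHk] //=; rewrite mulr_ge0 // invr_ge0 sqrtr_ge0. Qed.

(** The exponent compensates each normalisation: its first term follows the
    trace, which the update changes at second order in tau, and its second term
    pays for that change. *)
Lemma tilt_mass_potential (k : nat) : (k <= N)%N ->
  tilt_mass S tau k * expR (tau / 2 * trace_from k (Bk k) + tau ^+ 2 * sq_norm k (Bk k)) <=
  expR (tau / 2 * trace_from 0 S + tau ^+ 2 * sq_norm 0 S).
Proof.
elim: k => [_|k IHk kN]; first by rewrite mul1r.
apply: le_trans (IHk (ltnW kN)); rewrite /= -mulrA ler_wpM2l ?tilt_mass_ge0 //.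
have [ta tp H] := sq_norm_cov_tilt (tilted_cov_sym k) kN F_gt0 (sq_norm_tilted (ltnW kN)) tauF.
rewrite -/(Bk k).
apply: (@le_trans _ _ (expR ((tau * Bk k k k + (tau * Bk k k k) ^+ 2) / 2) *
   expR (tau / 2 * trace_from k.+1 (Bk k.+1) + tau ^+ 2 * sq_norm k.+1 (Bk k.+1)))).
  by rewrite ler_wpM2r ?expR_ge0 // invsqrt_le_expR.
rewrite -expRD ler_expR [trace_from k.+1 _]trace_cov_tilt; last exact: tilted_cov_sym.
rewrite (trace_split _ kN).
have x0 := row_sq_ge0 k (Bk k).
have t0 := sqr_ge0 tau.
have H' := ler_wpM2l t0 H.
have H2 := ler_wpM2r x0 tp.
have e1 : (tau * Bk k k k) ^+ 2 = tau ^+ 2 * Bk k k k ^+ 2 by rewrite exprMn.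
have e2 : 0 <= tau ^+ 2 * Bk k k k ^+ 2 by rewrite mulr_ge0 // sqr_ge0.
move: H2 H'; rewrite -/Bk -/(Bk k) e1.
set tp' := tau / (1 - _).
move: e2; set b2 := Bk k k k ^+ 2; set b := Bk k k k; set x := row_sq _ _.
set T1 := trace_from _ _; rewrite -[cov_tilt tau k _]/(Bk k.+1).
set S1 := sq_norm k.+1 _; set S0 := sq_norm k _ => e2 H2 H'.
rewrite -mulrA in H2.
rewrite -subr_ge0.
have -> : tau / 2 * (b + T1) + tau ^+ 2 * S0 -
  ((tau * b + tau ^+ 2 * b2) / 2 + (tau / 2 * (T1 + tp' * x) + tau ^+ 2 * S1)) =
  (tau ^+ 2 * (S0 - b2 - x) - tau ^+ 2 * S1) + tau ^+ 2 * b2 / 2 +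
  (2 * tau ^+ 2 * x - tau * (tp' * x)) / 2.
  by field.
apply: addr_ge0; last by rewrite divr_ge0 // subr_ge0.
by apply: addr_ge0; [rewrite subr_ge0|rewrite divr_ge0].
Qed.

Lemma tilt_mass_bound :
  tilt_mass S tau N <= expR (tau / 2 * trace_from 0 S + tau ^+ 2 * F ^+ 2).
Proof.
have := tilt_mass_potential (leqnn N).
rewrite /trace_from /sq_norm !(big_geq (leqnn N)) !mulr0 addr0 expR0 mulr1 => H.
by apply: (le_trans H); rewrite ler_expR lerD2l ler_wpM2l ?sqr_ge0.
Qed.

End tilt_bound.

(** * Exponential moments of a sum of squares *)

Lemma integrable_gauss_expR_quadratic (R : realType) (al be : R) : al < 1 ->
  lebesgue_measure.-integrable [set: R]
    (fun x => (expR (al * x ^+ 2 / 2 + be * x) * normal_pdf 0 1 x)%:E).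
Proof.
move=> al1; under eq_fun do rewrite gauss_expR_quadratic // EFinM.
exact/integrableZl/integrable_normal_pdf.
Qed.

Lemma mean_cos_std (R : realType) (a b : R) :
  (\int[lebesgue_measure]_x (cos (a + b * x) * normal_pdf 0 1 x)%:E =
   (cos a * expR (- (b ^+ 2 / 2)))%:E)%E.
Proof.
have icos : lebesgue_measure.-integrable [set: R]
    (EFin \o (fun x => cos (a + b * x) * normal_pdf 0 1 x)).
  apply: (integrable_dominated_norm1 (m := 0) (oner_neq0 R) (C := 1)) => [|x].
    by have := measurable_cos_affine 0 a b; under eq_fun do rewrite subr0.
  by rewrite mul1r (le_trans (cos_max _)) // lerDl.
have := mean_cos 0 (oner_neq0 R) a b; rewrite expr1n mulr1 => <-.
under [in RHS]eq_Rintegral do rewrite subr0.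
by rewrite /Rintegral fineK //; exact: (integrable_fin_num measurableT icos).
Qed.

Lemma mean_expR_std (R : realType) (a b : R) :
  (\int[lebesgue_measure]_x (expR (a + b * x) * normal_pdf 0 1 x)%:E =
   (expR a * expR (b ^+ 2 / 2))%:E)%E.
Proof.
transitivity (\int[lebesgue_measure]_x ((expR a)%:E *
   (expR (0 * x ^+ 2 / 2 + b * x) * normal_pdf 0 1 x)%:E))%E.
  apply: eq_integral => x _; rewrite -EFinM !mul0r add0r mulrA -expRD.
  by [].
rewrite ge0_integralZl //.
- by rewrite integral_gauss_expR_quadratic ?ltr01 // subr0 sqrtr1 invr1 mul1r mulr1.
- apply/measurable_EFinP; apply: measurable_funM; last exact: measurable_normal_pdf.
  under eq_fun do rewrite !mul0r add0r.
  by apply: measurableT_comp => //; exact: measurable_funM.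
- by move=> x _; rewrite lee_fin mulr_ge0 ?expR_ge0 ?normal_pdf_ge0.
Qed.

Section quadratic_forms.
Variables (R : realType) (N : nat).
Implicit Types (B : nat -> nat -> R) (c : nat -> R).

Definition qform B c : R := \sum_(0 <= i < N) \sum_(0 <= j < N) c i * c j * B i j.
Definition rowform B c (k : nat) : R := \sum_(0 <= i < N) c i * B i k.
Definition bump_coef c (k : nat) (a : R) (i : nat) : R := c i + a * (i == k)%:R.

Lemma sum_delta (k : nat) (f : nat -> R) : (k < N)%N ->
  \sum_(0 <= i < N) (i == k)%:R * f i = f k.
Proof.
move=> kN; rewrite (bigD1_seq k) ?mem_index_iota ?iota_uniq //= eqxx mul1r.
by rewrite big1 ?addr0 // => i ik; rewrite (negbTE ik) mul0r.
Qed.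

Lemma qform_bump B c (k : nat) (a : R) : (forall i j, B i j = B j i) -> (k < N)%N ->
  qform B (bump_coef c k a) = qform B c + 2 * a * rowform B c k + a ^+ 2 * B k k.
Proof.
move=> symB kN.
have -> : a ^+ 2 * B k k = \sum_(0 <= i < N) (i == k)%:R * (\sum_(0 <= j < N) (j == k)%:R * (a ^+ 2 * B i j)).
  by rewrite !sum_delta.
have -> : 2 * a * rowform B c k = \sum_(0 <= i < N) \sum_(0 <= j < N) (j == k)%:R * (a * (c i * B i j)) +
   \sum_(0 <= i < N) (i == k)%:R * (\sum_(0 <= j < N) a * (c j * B i j)).
  rewrite sum_delta // [X in X + _](_ : _ = a * rowform B c k); last first.
    by rewrite /rowform mulr_sumr; apply: eq_bigr => i _; rewrite sum_delta.
  rewrite -mulr_sumr (_ : \sum_(0 <= j < N) c j * B k j = rowform B c k); last first.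
    by apply: eq_bigr => j _; rewrite symB.
  by ring.
rewrite /qform -!big_split /=; apply: eq_bigr => i _.
rewrite !mulr_sumr -!big_split /=; apply: eq_bigr => j _.
by rewrite /bump_coef; ring.
Qed.

Lemma qform_cov_tilt B c (k : nat) (tau : R) : (forall i j, B i j = B j i) ->
  qform (cov_tilt tau k B) c = qform B c + tau / (1 - tau * B k k) * rowform B c k ^+ 2.
Proof.
move=> symB; rewrite /qform expr2 {2}/rowform mulr_sumr mulr_sumr -big_split /=.
apply: eq_bigr => i _.
rewrite /rowform mulr_suml mulr_sumr -big_split /=; apply: eq_bigr => j _.
by rewrite /cov_tilt [B k j]symB; ring.
Qed.

End quadratic_forms.

Section tilt.
Variables (R : realType) (d : measure_display) (T : measurableType d).
Variables (P : probability T R) (N : nat) (Z : nat -> T -> R) (S : nat -> nat -> R).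
Hypothesis symS : forall i j, S i j = S j i.

Definition lincomb (c : nat -> R) (w : T) : R := \sum_(0 <= i < N) c i * Z i w.
Definition tilt_weight (tau : R) (k : nat) (w : T) : R :=
  expR (tau / 2 * \sum_(0 <= i < k) Z i w ^+ 2).

Lemma lincomb_bump (c : nat -> R) (k : nat) (a : R) (w : T) : (k < N)%N ->
  lincomb (bump_coef c k a) w = lincomb c w + a * Z k w.
Proof.
move=> kN; rewrite -(sum_delta (fun i => a * Z i w) kN) -big_split /=.
by apply: eq_bigr => i _; rewrite /bump_coef; ring.
Qed.

Lemma tilt_weightS (tau : R) (k : nat) (w : T) :
  tilt_weight tau k.+1 w = tilt_weight tau k w * expR (tau / 2 * Z k w ^+ 2).
Proof. by rewrite /tilt_weight big_nat_recr //= mulrDr expRD. Qed.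

Variables (e : R -> R) (sg t : R).
Hypothesis sg1 : sg ^+ 2 = 1.
Hypothesis t_ge0 : 0 <= t.
Hypothesis mean_e : forall a b : R,
  (\int[lebesgue_measure]_x (e (a + b * x) * normal_pdf 0 1 x)%:E =
   (e a * expR (sg * (b ^+ 2 / 2)))%:E)%E.
Hypothesis transform_e : forall c : nat -> R,
  (\int[P]_w (e (lincomb c w))%:E = (expR (sg * (qform N S c / 2)))%:E)%E.
Hypothesis swap_e : forall (k : nat) (c : nat -> R), (k < N)%N ->
  (\int[P]_w \int[lebesgue_measure]_x
     (e (lincomb c w + Num.sqrt t * Z k w * x) * normal_pdf 0 1 x * tilt_weight (sg * t) k w)%:E =
   \int[lebesgue_measure]_x \int[P]_w
     (e (lincomb c w + Num.sqrt t * Z k w * x) * normal_pdf 0 1 x * tilt_weight (sg * t) k w)%:E)%E.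
Hypothesis integrable_e : forall a b : R, lebesgue_measure.-integrable [set: R]
  (EFin \o (fun x => e (a + b * x) * normal_pdf 0 1 x)).
Hypothesis tilt_small : forall k, (k < N)%N -> sg * t * tilted_cov S (sg * t) k k k < 1.
Hypothesis integrable_eW : forall (k : nat) (c : nat -> R) (r : R), (k <= N)%N ->
  (\int[P]_w (e (lincomb c w) * tilt_weight (sg * t) k w)%:E = r%:E)%E ->
  P.-integrable setT (EFin \o (fun w => e (lincomb c w) * tilt_weight (sg * t) k w)).

Let tau := sg * t.

(** Induction on k. The k-th square is linearised by an auxiliary standard
    normal x; exchanging the integrals leaves the transform of a linear
    combination with coefficient sqrt(t) x added at k, known by induction, and a
    Gaussian integral in x. The function e is the exponential for sg = 1 and the
    cosine for sg = -1. *)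
Lemma tilted_transform (k : nat) (c : nat -> R) : (k <= N)%N ->
  (\int[P]_w (e (lincomb c w) * tilt_weight tau k w)%:E =
   (tilt_mass S tau k * expR (sg * (qform N (tilted_cov S tau k) c / 2)))%:E)%E.
Proof.
elim: k c => [|k IHk] c kN.
  rewrite mul1r -transform_e; apply: eq_integral => w _.
  by rewrite /tilt_weight big_geq // mulr0 expR0 mulr1.
have symB i j : tilted_cov S tau k i j = tilted_cov S tau k j i.
  elim: {c IHk kN} k i j => [|k IHk] //= i j; rewrite /cov_tilt IHk.
  by congr (_ + _ * _); rewrite mulrC; congr (_ * _); exact: IHk.
have sE : Num.sqrt t ^+ 2 = t by rewrite sqr_sqrtr.
(* The integral over x linearises the square of Z k. *)
transitivity (\int[P]_w \int[lebesgue_measure]_x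
   (e (lincomb c w + Num.sqrt t * Z k w * x) * normal_pdf 0 1 x * tilt_weight tau k w)%:E)%E.
  apply: eq_integral => w _.
  under [RHS]eq_integral do rewrite EFinM.
  rewrite integralZr //; last exact: integrable_e.
  rewrite mean_e -EFinM tilt_weightS exprMn sE; congr EFin.
  by rewrite -!mulrA; congr (_ * _); rewrite mulrC; congr (expR _ * _); rewrite /tau; field.
rewrite swap_e //.
transitivity (\int[lebesgue_measure]_x
   ((tilt_mass S tau k * expR (sg * (qform N (tilted_cov S tau k) c / 2)))%:E *
   (expR (tau * tilted_cov S tau k k k * x ^+ 2 / 2 +
      sg * Num.sqrt t * rowform N (tilted_cov S tau k) c k * x) * normal_pdf 0 1 x)%:E))%E.
  apply: eq_integral => x _.
  transitivity (\int[P]_w ((normal_pdf 0 1 x)%:E *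
      (e (lincomb (bump_coef c k (Num.sqrt t * x)) w) * tilt_weight tau k w)%:E))%E.
    apply: eq_integral => w _; rewrite lincomb_bump // -EFinM; congr EFin.
    rewrite mulrCA mulrA; congr (e _ * _ * _).
    by congr (_ + _); ring.
  rewrite integralZl //; last exact: integrable_eW (ltnW kN) (IHk _ (ltnW kN)).
  rewrite IHk ?(ltnW kN) // -!EFinM; congr EFin.
  rewrite qform_bump //; set q := qform _ _ _; set L := rowform _ _ _ _.
  set b := tilted_cov _ _ _ _ _; clearbody q L b.
  have -> : sg * ((q + 2 * (Num.sqrt t * x) * L + (Num.sqrt t * x) ^+ 2 * b) / 2) =
     sg * (q / 2) + (tau * b * x ^+ 2 / 2 + sg * Num.sqrt t * L * x).
    by rewrite exprMn sE /tau; field.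
  by rewrite [expR (_ + (_ + _))]expRD; ring.
rewrite integralZl //; last exact: integrable_gauss_expR_quadratic (tilt_small kN).
rewrite integral_gauss_expR_quadratic; last exact: tilt_small.
rewrite -EFinM /= qform_cov_tilt //; congr EFin.
rewrite mulrACA; congr (_ * _).
rewrite -expRD; congr expR.
have d0 : 1 - tau * tilted_cov S tau k k k != 0 by rewrite gt_eqF // subr_gt0 tilt_small.
rewrite !exprMn sE sg1 mul1r.
have -> : t = sg * tau by rewrite /tau mulrA -expr2 sg1 mul1r.
by field.
Qed.

End tilt.

Section tilt_instances.
Variables (R : realType) (d : measure_display) (T : measurableType d).
Variables (P : probability T R) (N : nat) (Z : nat -> T -> R).
Hypothesis mZ : forall i, measurable_fun setT (Z i).

Lemma measurable_lincomb (c : nat -> R) : measurable_fun setT (lincomb N Z c).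
Proof. by apply: measurable_sum => i; exact: measurable_funM. Qed.

Lemma measurable_tilt_weight (tau : R) (k : nat) : measurable_fun setT (tilt_weight Z tau k).
Proof.
apply: measurableT_comp => //; apply: measurable_funM => //.
by apply: measurable_sum => i; exact: measurable_funX.
Qed.

Lemma measurable_swap (e : R -> R) (tau s : R) (k : nat) (c : nat -> R) :
  measurable_fun setT e ->
  measurable_fun setT (fun z : T * measurableTypeR R =>
    e (lincomb N Z c z.1 + s * Z k z.1 * z.2) * normal_pdf 0 1 z.2 * tilt_weight Z tau k z.1).
Proof.
move=> me; apply: measurable_funM; first apply: measurable_funM.
- apply: measurableT_comp => //; apply: measurable_funD.
    by apply: measurableT_comp; [exact: measurable_lincomb|exact: measurable_fst].
  apply: measurable_funM; last exact: measurable_snd.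
  apply: measurable_funM => //.
  by apply: measurableT_comp => //; exact: measurable_fst.
- by apply: measurableT_comp; [exact: measurable_normal_pdf|exact: measurable_snd].
- by apply: measurableT_comp; [exact: measurable_tilt_weight|exact: measurable_fst].
Qed.

Lemma swap_expR (tau s : R) (k : nat) (c : nat -> R) :
  (\int[P]_w \int[lebesgue_measure]_x
     (expR (lincomb N Z c w + s * Z k w * x) * normal_pdf 0 1 x * tilt_weight Z tau k w)%:E =
   \int[lebesgue_measure]_x \int[P]_w
     (expR (lincomb N Z c w + s * Z k w * x) * normal_pdf 0 1 x * tilt_weight Z tau k w)%:E)%E.
Proof.
have mf := @measurable_swap expR tau s k c (@measurable_expR R).
rewrite (@fubini_tonelli _ _ _ _ _ P (@lebesgue_measure R) (fun z : T * measurableTypeR R =>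
   (expR (lincomb N Z c z.1 + s * Z k z.1 * z.2) * normal_pdf 0 1 z.2 * tilt_weight Z tau k z.1)%:E)) //.
  exact/measurable_EFinP.
by move=> z; rewrite lee_fin !mulr_ge0 ?expR_ge0 ?normal_pdf_ge0.
Qed.

Lemma tilt_weight_le1 (tau : R) (k : nat) (w : T) : tau <= 0 -> tilt_weight Z tau k w <= 1.
Proof.
move=> t0; rewrite /tilt_weight expR_le1 mulr_le0_ge0 ?pmulr_lle0 ?invr_gt0 //.
by apply: sumr_ge0 => i _; exact: sqr_ge0.
Qed.

Lemma swap_cos (tau s : R) (k : nat) (c : nat -> R) : tau <= 0 ->
  (\int[P]_w \int[lebesgue_measure]_x
     (cos (lincomb N Z c w + s * Z k w * x) * normal_pdf 0 1 x * tilt_weight Z tau k w)%:E =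
   \int[lebesgue_measure]_x \int[P]_w
     (cos (lincomb N Z c w + s * Z k w * x) * normal_pdf 0 1 x * tilt_weight Z tau k w)%:E)%E.
Proof.
move=> t0.
have mf := @measurable_swap cos tau s k c (continuous_measurable_fun (@continuous_cos R)).
have mEf := (measurable_EFinP _ _).2 mf.
rewrite (@Fubini _ _ _ _ _ P (@lebesgue_measure R) (fun z : T * measurableTypeR R =>
   (cos (lincomb N Z c z.1 + s * Z k z.1 * z.2) * normal_pdf 0 1 z.2 * tilt_weight Z tau k z.1)%:E)) //.
apply/integrable12ltyP => //.
apply: (@le_lt_trans _ _ (\int[P]_w (cst 1%E w))%E); last first.
  by rewrite integral_cst // mul1e (le_lt_trans (probability_le1 P measurableT)) ?ltry.
apply: ge0_le_integral => //.
- by move=> w _; exact: integral_ge0.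
- have mabs := measurableT_comp (@abse_measurable R setT) mEf.
  exact: (@measurable_fun_fubini_tonelli_F _ _ _ _ _ lebesgue_measure _ mabs (fun=> abse_ge0 _)).
move=> w _; rewrite -[leRHS](integral_normal_pdf 0 (1 : R)).
apply: ge0_le_integral => //.
- have msec := measurableT_comp mEf (@pair1_measurable _ _ T (measurableTypeR R) w).
  exact: (measurableT_comp (@abse_measurable R setT) msec).
- by apply/measurable_EFinP; exact: measurable_normal_pdf.
move=> x _; rewrite /= lee_fin !normrM (ger0_norm (normal_pdf_ge0 _ _ _)) (ger0_norm (expR_ge0 _)).
rewrite -[leRHS]mulr1 ler_pM // ?mulr_ge0 ?normal_pdf_ge0 ?expR_ge0 //.
  by rewrite ler_piMl ?normal_pdf_ge0 // cos_max.
exact: tilt_weight_le1.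
Qed.
End tilt_instances.

(** * Concentration of a sum of squares *)

Section quadratic_tail.
Variables (R : realType) (d : measure_display) (T : measurableType d).
Variables (P : probability T R) (N : nat) (Z : nat -> T -> R) (S : nat -> nat -> R).
Hypothesis symS : forall i j, S i j = S j i.
Hypothesis mZ : forall i, measurable_fun setT (Z i).
Hypothesis expZ : forall c : nat -> R,
  (\int[P]_w (expR (lincomb N Z c w))%:E = (expR (qform N S c / 2))%:E)%E.
Hypothesis cosZ : forall c : nat -> R,
  (\int[P]_w (cos (lincomb N Z c w))%:E = (expR (- (qform N S c / 2)))%:E)%E.
Variable F : R.
Hypothesis F_gt0 : 0 < F.
Hypothesis SF : sq_norm N 0 S <= F ^+ 2.

Lemma qform0 (B : nat -> nat -> R) : qform N B (fun=> 0) = 0.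
Proof. by apply: big1 => i _; apply: big1 => j _; rewrite !mul0r. Qed.

Lemma lincomb0 (w : T) : lincomb N Z (fun=> 0) w = 0.
Proof. by apply: big1 => i _; rewrite mul0r. Qed.

(** A positive tau needs the exponential and a negative one the cosine, which
    keeps the integrands bounded. *)
Lemma integral_tilt_weight (tau : R) : `|tau| * F <= 8^-1 ->
  (\int[P]_w (tilt_weight Z tau N w)%:E = (tilt_mass S tau N)%:E)%E.
Proof.
move=> tauF.
have small k : (k < N)%N -> tau * tilted_cov S tau k k k < 1.
  move=> kN; have := tilted_diag_small symS F_gt0 SF tauF kN.
  by rewrite ler_norml => /andP[_]; lra.
have mW k := measurable_tilt_weight mZ tau k.
have [t0|t0] := leP 0 tau.
  have := @tilted_transform R d T P N Z S symS expR 1 tau (expr1n _ _) t0.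
  rewrite !mul1r => H; transitivity (\int[P]_w (expR (lincomb N Z (fun=> 0) w) * tilt_weight Z tau N w)%:E)%E.
    by apply: eq_integral => w _; rewrite lincomb0 expR0 mul1r.
  rewrite H //.
  - by rewrite qform0 mul0r mul1r expR0 mulr1.
  - by move=> a b; rewrite mul1r mean_expR_std.
  - by move=> c; rewrite mul1r expZ.
  - by move=> k c kN; rewrite swap_expR.
  - move=> a b; have := integrableZl measurableT (expR a) (integrable_gauss_expR_quadratic b (@ltr01 R)).
    apply: eq_integrable => // x _ /=; rewrite -EFinM; congr EFin.
    by rewrite !mul0r add0r expRD mulrA.
  move=> k c r kN Hr; apply/integrableP; split.
    apply/measurable_EFinP; apply: measurable_funM => //.
    by apply: measurableT_comp => //; exact: measurable_lincomb.
  under eq_integral do rewrite /= ger0_norm ?mulr_ge0 ?expR_ge0 //.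
  by rewrite Hr ltry.
have nt0 : 0 <= - tau by rewrite oppr_ge0 ltW.
have := @tilted_transform R d T P N Z S symS cos (-1) (- tau) (etrans (sqrrN 1) (expr1n _ _)) nt0.
rewrite !mulN1r opprK => H.
transitivity (\int[P]_w (cos (lincomb N Z (fun=> 0) w) * tilt_weight Z tau N w)%:E)%E.
  by apply: eq_integral => w _; rewrite lincomb0 cos0 mul1r.
rewrite H //.
- by rewrite qform0 mul0r mulN1r oppr0 expR0 mulr1.
- by move=> a b; rewrite mulN1r mean_cos_std.
- by move=> c; rewrite mulN1r cosZ.
- by move=> k c kN; rewrite swap_cos // ltW.
- move=> a b; apply: (integrable_dominated_norm1 (m := 0) (oner_neq0 R) (C := 1)) => [|x].
    by have := measurable_cos_affine 0 a b; under eq_fun do rewrite subr0.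
  by rewrite mul1r (le_trans (cos_max _)) // lerDl.
move=> k c r kN _; apply: (@le_integrable _ _ _ P _ measurableT _ (EFin \o cst 1)).
- apply/measurable_EFinP; apply: measurable_funM => //.
  by apply: measurableT_comp; [exact: continuous_measurable_fun (@continuous_cos R)|exact: measurable_lincomb].
- move=> w _; rewrite /= lee_fin normr1 normrM (ger0_norm (expR_ge0 _)) -[leRHS]mulr1.
  by rewrite ler_pM ?expR_ge0 ?cos_max // tilt_weight_le1 // ltW.
exact: finite_measure_integrable_cst.
Qed.

Let V (w : T) : R := \sum_(0 <= i < N) Z i w ^+ 2.

Lemma measurable_sumsq : measurable_fun setT V.
Proof. by apply: measurable_sum => i; exact: measurable_funX. Qed.

(** Markov's inequality for the exponential of tau/2 times the sum of squares. *)
Lemma one_sided_tail (tau b : R) : `|tau| * F <= 8^-1 ->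
  (P [set w | (b <= tau / 2 * (V w - trace_from N 0 S))%R] <= (expR (tau ^+ 2 * F ^+ 2 - b))%:E)%E.
Proof.
move=> tauF; set A := [set w | _].
have mA : measurable A.
  have mf : measurable_fun setT (fun w => tau / 2 * (V w - trace_from N 0 S)).
    by apply: measurable_funM => //; apply: measurable_funB => //; exact: measurable_sumsq.
  by rewrite /A -[X in measurable X]setTI; exact: measurable_fun_le.
set tr := trace_from N 0 S.
have eb : (0 < expR (tau / 2 * tr + b)) by exact: expR_gt0.
rewrite -(@lee_pmul2l _ (expR (tau / 2 * tr + b))%:E) ?lte_fin //.
rewrite -EFinM -expRD.
apply: (@le_trans _ _ (tilt_mass S tau N)%:E); last first.
  rewrite lee_fin (le_trans (tilt_mass_bound symS F_gt0 SF tauF)) // ler_expR.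
  by rewrite /tr; lra.
rewrite -integral_tilt_weight // -integral_cst //.
apply: (@le_trans _ _ (\int[P]_(w in A) (tilt_weight Z tau N w)%:E)%E).
  apply: ge0_le_integral => //.
  - by move=> w _; rewrite lee_fin ltW.
  - apply/measurable_EFinP; apply: measurable_funTS; exact: measurable_tilt_weight.
  move=> w Aw; rewrite /= lee_fin ler_expR; move: Aw; rewrite /A /= -/tr -/(V w).
  by rewrite mulrBr; lra.
apply: ge0_subset_integral => //; last by move=> w _; rewrite lee_fin expR_ge0.
by apply/measurable_EFinP; exact: measurable_tilt_weight.
Qed.

(** The one-sided bounds at tau = 1/(8F) and tau = -1/(8F), the extreme values
    at which the exponential moments are controlled. *)
Lemma quadratic_tail (u : R) :
  (P [set w | (u <= `|V w - trace_from N 0 S|)%R] <= (2 * expR (64^-1 - u / (16 * F)))%:E)%E.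
Proof.
have F1 : F != 0 by rewrite gt_eqF.
have t1 : `|(8 * F)^-1| * F <= 8^-1.
  by rewrite ger0_norm ?invr_ge0 ?mulr_ge0 ?(ltW F_gt0) // invfM -mulrA mulVf // mulr1.
have t2 : `|- (8 * F)^-1| * F <= 8^-1 by rewrite normrN.
have e64 : (8 * F)^-1 ^+ 2 * F ^+ 2 = 64^-1 by field.
have H1 := one_sided_tail (u / (16 * F)) t1.
have H2 := one_sided_tail (u / (16 * F)) t2.
rewrite sqrrN in H2; rewrite e64 in H1 H2.
rewrite mulrDl mul1r EFinD; apply: le_trans (leeD H1 H2).
have mS (a b : R) : measurable [set w | a <= b * (V w - trace_from N 0 S)].
  have mf : measurable_fun setT (fun w => b * (V w - trace_from N 0 S)).
    by apply: measurable_funM => //; apply: measurable_funB => //; exact: measurable_sumsq.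
  by rewrite -[X in measurable X]setTI; exact: measurable_fun_le.
have mN : measurable [set w | u <= `|V w - trace_from N 0 S|].
  have mf : measurable_fun setT (fun w => `|V w - trace_from N 0 S|).
    by apply: measurableT_comp => //; apply: measurable_funB => //; exact: measurable_sumsq.
  by rewrite -[X in measurable X]setTI; exact: measurable_fun_le.
apply: le_trans (measureU2 P (mS _ _) (mS _ _)).
apply: le_measure; rewrite ?inE //; first exact: measurableU.
move=> w /=; rewrite ler_normr => /orP[H|H]; [left|right].
  rewrite (_ : u / (16 * F) = (8 * F)^-1 / 2 * u); last by field.
  by rewrite ler_wpM2l // divr_ge0 // invr_ge0 mulr_ge0 // ltW.
rewrite (_ : u / (16 * F) = (8 * F)^-1 / 2 * u); last by field.
rewrite !mulNr -mulrN.
by rewrite ler_wpM2l // divr_ge0 // invr_ge0 mulr_ge0 // ltW.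
Qed.

End quadratic_tail.

(** * Linear combinations of a Gaussian process *)

Lemma Rintegral_sum (R : realType) (d : measure_display) (T : measurableType d)
    (m : {measure set T -> \bar R}) (I : Type) (s : seq I) (h : I -> T -> R) :
  (forall i, m.-integrable setT (EFin \o h i)) ->
  m.-integrable setT (EFin \o (fun w => \sum_(i <- s) h i w)) /\
  \int[m]_w (\sum_(i <- s) h i w) = \sum_(i <- s) \int[m]_w h i w.
Proof.
move=> ih; elim: s => [|i s [IH1 IH2]].
  rewrite big_nil; split.
    by apply: eq_integrable (integrable0 _ _) => // w _ /=; rewrite big_nil.
  under eq_Rintegral do rewrite big_nil.
  by rewrite Rintegral_cst // mul0r.
split.
  apply: eq_integrable (integrableD measurableT (ih i) IH1) => // w _ /=.
  by rewrite big_cons.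
under eq_Rintegral do rewrite big_cons.
by rewrite RintegralD // IH2 big_cons.
Qed.

Section gaussian_observations.
Variables (R : realType) (d : measure_display) (T : measurableType d).
Variables (P : probability T R) (X : R -> {RV P >-> R}) (mu : R) (Kt : R -> R).
Hypothesis hgauss : gaussian_process X.
Hypothesis hmean : forall x : R, ('E_P[X x] = mu%:E)%E.
Hypothesis hcov : forall x y : R, (covariance P (X x) (X y) = (Kt (x - y))%:E)%E.

(** A linear combination of observations is encoded by the list of its
    coefficients and points, so that combinations of divided differences are
    obtained by concatenation. *)
Definition obs (s : seq (R * R)) (w : T) : R := \sum_(p <- s) p.1 * X p.2 w.
Definition obs_var (s : seq (R * R)) : R :=
  \sum_(p <- s) \sum_(q <- s) p.1 * q.1 * Kt (p.2 - q.2).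

Lemma measurable_obs (s : seq (R * R)) : measurable_fun setT (obs s).
Proof. by apply: measurable_sum => p; exact: measurable_funM. Qed.

Lemma obs_law (s : seq (R * R)) : exists m sd : R, forall A : set R, measurable A ->
  P (obs s @^-1` A) = gaussian_law m sd A.
Proof.
have [m [sd H]] := hgauss (fun i : 'I_(size s) => (tnth (in_tuple s) i).1)
  (fun i => (tnth (in_tuple s) i).2).
exists m, sd; rewrite (_ : obs s = (fun w : T =>
    \sum_(i < size s) (tnth (in_tuple s) i).1 * X (tnth (in_tuple s) i).2 w)) //.
by apply/funext => w; rewrite /obs big_tnth.
Qed.

(** The parameters of a Gaussian law are its mean and standard deviation. *)
Lemma obs_moments (s : seq (R * R)) : exists m sd : R,
  [/\ P.-integrable setT (EFin \o obs s), \int[P]_w obs s w = m,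
    P.-integrable setT (EFin \o (fun w => (obs s w - m) ^+ 2)),
    \int[P]_w ((obs s w - m) ^+ 2) = sd ^+ 2 &
    (forall lam, (\int[P]_w (expR (lam * (obs s w - m)))%:E = (expR (lam ^+ 2 * sd ^+ 2 / 2))%:E)%E) /\
    (forall b, (\int[P]_w (1 + cos (b * (obs s w - m)))%:E =
       (1 + expR (- (b ^+ 2 * sd ^+ 2 / 2)))%:E)%E)].
Proof.
have [m [sd H]] := obs_law s; exists m, sd.
have mY := measurable_obs s.
have e1 := expectation_expR_gaussian mY H.
have c1 := expectation_1cos_gaussian mY H.
have mU : measurable_fun setT (fun w => obs s w - m) by exact: measurable_funB.
have iU := integrable_of_transforms mU e1.
have i0 := Rintegral_of_transforms mU (sqr_ge0 sd) e1.
have iC : P.-integrable setT (EFin \o (cst m : T -> R)) by exact: finite_measure_integrable_cst.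
have iY : P.-integrable setT (EFin \o obs s).
  apply: eq_integrable (integrableD measurableT iU iC) => // w _ /=.
  by rewrite -EFinD subrK.
split => //.
- have := RintegralB measurableT iY iC; rewrite Rintegral_cst1 => h.
  by apply/eqP; rewrite -subr_eq0 -h; apply/eqP; exact: i0.
- exact: integrable_sqr_of_transforms mU e1.
- exact: Rintegral_sqr_of_transforms mU (sqr_ge0 sd) e1 c1.
Qed.

Lemma obs1 (x : R) : obs [:: (1, x)] = X x.
Proof. by apply/funext => w; rewrite /obs big_seq1 mul1r. Qed.

Lemma integrable_X (x : R) : P.-integrable setT (EFin \o X x).
Proof. by have [m [sd []]] := obs_moments [:: (1, x)]; rewrite obs1. Qed.

Lemma Rintegral_X (x : R) : \int[P]_w X x w = mu.
Proof. by have := hmean x; rewrite unlock /Rintegral => ->. Qed.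

Lemma integrable_cov (x y : R) : P.-integrable setT (EFin \o (fun w => (X x w - mu) * (X y w - mu))).
Proof.
have sq z : P.-integrable setT (EFin \o (fun w => (X z w - mu) ^+ 2)).
  have [m [sd [_ Em Hi _ _]]] := obs_moments [:: (1, z)].
  by move: Em Hi; rewrite obs1 Rintegral_X => <-.
have mX z : measurable_fun setT (fun w => X z w - mu) by exact: measurable_funB.
apply: le_integrable (integrableD measurableT (sq x) (sq y)) => //.
  by apply/measurable_EFinP; exact: measurable_funM.
move=> w _; rewrite /= lee_fin normrM.
set a := X x w - mu; set b := X y w - mu.
have := sqr_ge0 (`|a| - `|b|); rewrite sqrrB !real_normK ?num_real //.
rewrite (ger0_norm (addr_ge0 (sqr_ge0 _) (sqr_ge0 _))).
have := sqr_ge0 a; have := sqr_ge0 b; nra.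
Qed.

Lemma Rintegral_cov (x y : R) : \int[P]_w ((X x w - mu) * (X y w - mu)) = Kt (x - y).
Proof.
have := hcov x y; rewrite unlock !hmean /= unlock /Rintegral => H.
by rewrite (_ : Kt (x - y) = fine (Kt (x - y))%:E) // -H.
Qed.

Lemma obs_centered (s : seq (R * R)) (w : T) : \sum_(p <- s) p.1 = 0 ->
  obs s w = \sum_(p <- s) p.1 * (X p.2 w - mu).
Proof.
move=> s0; under [RHS]eq_bigr do rewrite mulrBr.
by rewrite big_split /= sumrN -mulr_suml s0 mul0r subr0.
Qed.

Lemma Rintegral_obs_sqr (s : seq (R * R)) : \sum_(p <- s) p.1 = 0 ->
  \int[P]_w (obs s w ^+ 2) = obs_var s.
Proof.
move=> s0.
transitivity (\int[P]_w (\sum_(p <- s) \sum_(q <- s) p.1 * q.1 * ((X p.2 w - mu) * (X q.2 w - mu)))).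
  apply: eq_Rintegral => w _; rewrite obs_centered // expr2 mulr_suml.
  apply: eq_bigr => p _; rewrite mulr_sumr; apply: eq_bigr => q _; ring.
have i1 (p q : R * R) : P.-integrable setT (EFin \o (fun w => p.1 * q.1 * ((X p.2 w - mu) * (X q.2 w - mu)))).
  by apply: eq_integrable (integrableZl measurableT (p.1 * q.1) (integrable_cov p.2 q.2)).
have i2 p := Rintegral_sum s (i1 p).
have [_ ->] := Rintegral_sum s (fun p => (i2 p).1).
apply: eq_bigr => p _; rewrite (i2 p).2; apply: eq_bigr => q _.
by rewrite RintegralZl ?Rintegral_cov //; exact: integrable_cov.
Qed.

(** A zero sum of the coefficients removes the unknown mean mu. *)
Lemma obs_transforms (s : seq (R * R)) : \sum_(p <- s) p.1 = 0 ->
  (\int[P]_w (expR (obs s w))%:E = (expR (obs_var s / 2))%:E)%E /\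
  (\int[P]_w (cos (obs s w))%:E = (expR (- (obs_var s / 2)))%:E)%E.
Proof.
move=> s0; have [m [sd [_ Em _ E2 [e1 c1]]]] := obs_moments s.
have m0 : m = 0.
  rewrite -Em.
  have i1 (p : R * R) : P.-integrable setT (EFin \o (fun w => p.1 * X p.2 w)).
    by apply: eq_integrable (integrableZl measurableT p.1 (integrable_X p.2)).
  have [_ ->] := Rintegral_sum s i1.
  rewrite (eq_bigr (fun p => p.1 * mu)) => [|p _]; last first.
    by rewrite RintegralZl ?Rintegral_X //; exact: integrable_X.
  by rewrite -mulr_suml s0 mul0r.
have E3 : sd ^+ 2 = obs_var s.
  rewrite -(Rintegral_obs_sqr s0) -E2 m0; apply: eq_Rintegral => w _.
  by rewrite subr0.
split.
  have := e1 1; rewrite expr1n mul1r E3 => <-.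
  by apply: eq_integral => w _; rewrite m0 subr0 mul1r.
have := c1 1; rewrite expr1n mul1r E3 m0.
under eq_integral do rewrite subr0 mul1r EFinD.
have ic : P.-integrable setT (EFin \o (fun w => cos (obs s w))).
  apply: (@le_integrable _ _ _ P _ measurableT _ (EFin \o cst 1)).
  - apply/measurable_EFinP; apply: measurableT_comp; last exact: measurable_obs.
    by apply: continuous_measurable_fun; exact: continuous_cos.
  - by move=> w _; rewrite /= lee_fin normr1 cos_max.
  exact: finite_measure_integrable_cst.
rewrite integralD //; last exact: finite_measure_integrable_cst.
have -> : (\int[P]_w 1%:E = 1%:E)%E.
  have := @integral_cst _ _ _ P _ measurableT (1%E : \bar R).
  by move=> ->; rewrite mul1e; exact: probability_setT.
have fc := integrable_fin_num measurableT ic.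
rewrite EFinD -(fineK fc) -!EFinD => -[/addrI ->].
by [].
Qed.

End gaussian_observations.

Section divided_differences_of_observations.
Variables (R : realType) (d : measure_display) (T : measurableType d).
Variables (P : probability T R) (X : R -> {RV P >-> R}) (mu : R) (Kt : R -> R).
Hypothesis hgauss : gaussian_process X.
Hypothesis hmean : forall x : R, ('E_P[X x] = mu%:E)%E.
Hypothesis hcov : forall x y : R, (covariance P (X x) (X y) = (Kt (x - y))%:E)%E.
Variables (N l : nat) (x : nat -> nat -> R).
Hypothesis l_gt0 : (0 < l)%N.
Hypothesis x_up : forall i, (i < N)%N -> nodes_up l (x i).

Definition ddX (i : nat) (w : T) : R := \sum_(0 <= k < l.+1) ddc l (x i) k * X (x i k) w.
Definition dd_cov (i j : nat) : R := bilin l (x i) (x j) (fun u v => Kt (u - v)).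

Lemma Kt_sym (u v : R) : Kt (u - v) = Kt (v - u).
Proof. by have := hcov u v; rewrite covarianceC hcov => -[]. Qed.

Lemma dd_cov_sym (i j : nat) : dd_cov i j = dd_cov j i.
Proof.
rewrite /dd_cov /bilin exchange_big /=; apply: eq_bigr => k _; apply: eq_bigr => k' _.
by rewrite Kt_sym [ddc l (x i) _ * _]mulrC.
Qed.

Definition dd_list (c : nat -> R) : seq (R * R) :=
  flatten [seq [seq (c i * ddc l (x i) k, x i k) | k <- index_iota 0 l.+1] | i <- index_iota 0 N].

Lemma sum_dd_list (c : nat -> R) (f : R * R -> R) :
  \sum_(p <- dd_list c) f p =
  \sum_(0 <= i < N) \sum_(0 <= k < l.+1) f (c i * ddc l (x i) k, x i k).
Proof.
rewrite /dd_list big_flatten big_map; apply: eq_bigr => i _.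
by rewrite big_map.
Qed.

Lemma dd_list_zero_sum (c : nat -> R) : \sum_(p <- dd_list c) p.1 = 0.
Proof.
rewrite sum_dd_list big_nat; apply: big1 => i /andP[_ iN] /=.
rewrite -mulr_sumr; have := ddc_poly (x_up iN) l_gt0.
by under eq_bigr do rewrite expr0 mulr1; move=> ->; rewrite mulr0.
Qed.

Lemma obs_dd_list (c : nat -> R) (w : T) : obs X (dd_list c) w = lincomb N ddX c w.
Proof.
rewrite /obs sum_dd_list; apply: eq_bigr => i _ /=; rewrite /ddX mulr_sumr.
by apply: eq_bigr => k _; rewrite mulrA.
Qed.

Lemma obs_var_dd_list (c : nat -> R) : obs_var Kt (dd_list c) = qform N dd_cov c.
Proof.
rewrite /obs_var sum_dd_list; apply: eq_bigr => i _ /=.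
transitivity (\sum_(0 <= k < l.+1) \sum_(0 <= j < N) \sum_(0 <= k' < l.+1)
    c i * ddc l (x i) k * (c j * ddc l (x j) k') * Kt (x i k - x j k')).
  by apply: eq_bigr => k _; rewrite sum_dd_list.
rewrite exchange_big /=; apply: eq_bigr => j _.
rewrite /dd_cov /bilin mulr_sumr; apply: eq_bigr => k _.
rewrite mulr_sumr; apply: eq_bigr => k' _; ring.
Qed.

Lemma measurable_ddX (i : nat) : measurable_fun setT (ddX i).
Proof. by apply: measurable_sum => k; exact: measurable_funM. Qed.

Lemma dd_tail (F u : R) : 0 < F -> sq_norm N 0 dd_cov <= F ^+ 2 ->
  (P [set w | (u <= `|\sum_(0 <= i < N) ddX i w ^+ 2 - \sum_(0 <= i < N) dd_cov i i|)%R]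
     <= (2 * expR (64^-1 - u / (16 * F)))%:E)%E.
Proof.
move=> F0 SF.
have tr c := obs_transforms hgauss hmean hcov (dd_list_zero_sum c).
apply: (quadratic_tail dd_cov_sym measurable_ddX _ _ F0 SF) => c; have [h1 h2] := tr c.
  by rewrite -obs_var_dd_list -h1; apply: eq_integral => w _; rewrite obs_dd_list.
by rewrite -obs_var_dd_list -h2; apply: eq_integral => w _; rewrite obs_dd_list.
Qed.

Lemma qform_dd_ge0 (c : nat -> R) : 0 <= qform N dd_cov c.
Proof.
rewrite -obs_var_dd_list -(Rintegral_obs_sqr hgauss hmean hcov (dd_list_zero_sum c)).
by apply: Rintegral_ge0 => w _; exact: sqr_ge0.
Qed.

(** Positivity of the variance of the sum and of the difference of two divided
    differences. *)
Lemma dd_cov_le_diag (i j : nat) : (i < N)%N -> (j < N)%N ->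
  `|dd_cov i j| <= (dd_cov i i + dd_cov j j) / 2.
Proof.
move=> iN jN.
have pos (e : R) : 0 <= dd_cov i i + 2 * e * dd_cov i j + e ^+ 2 * dd_cov j j.
  have := qform_dd_ge0 (bump_coef (bump_coef (fun=> 0) i 1) j e).
  rewrite !(qform_bump _ _ dd_cov_sym) // qform0.
  have -> : rowform N dd_cov (fun=> 0) i = 0 by apply: big1 => k _; rewrite mul0r.
  have -> : rowform N dd_cov (bump_coef (fun=> 0) i 1) j = dd_cov i j.
    rewrite -(sum_delta (fun k => dd_cov k j) iN).
    by apply: eq_bigr => k _; rewrite /bump_coef add0r mul1r.
  by rewrite mulr0 !add0r expr1n mul1r.
have := pos 1; have := pos (-1); rewrite sqrrN expr1n => h1 h2.
rewrite ler_norml; apply/andP; split; lra.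
Qed.

End divided_differences_of_observations.

(** * The design *)

Lemma mvt_everywhere (R : realType) (f : R -> R) (a b : R) : a <= b ->
  (forall x : R, derivable f x 1) ->
  exists2 c : R, a <= c <= b & f b - f a = derive1 f c * (b - a).
Proof.
move=> ab df.
have idf (x : R) : is_derive x 1 f (derive1 f x).
  by apply: DeriveDef => //; rewrite derive1E.
have cf : {within `[a, b], continuous f}.
  apply: continuous_subspaceT => x; apply: differentiable_continuous.
  exact/derivable1_diffP.
have [c cab e] := MVT_segment ab (fun x _ => idf x) cf.
by exists c => //; move: cab; rewrite in_itv.
Qed.

(** Only the positive minimum, the maximum and the Lipschitz constant of the
    derivative on [0, 1] matter for the design. *)
Lemma C2_bounds (R : realType) (phi : R -> R) :
  twice_continuously_differentiable phi ->
  (exists2 m : R, is_min (derive1 phi @` `[0, 1]) m & 0 < m) ->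
  exists m c L : R, [/\ 0 < m, 0 <= L,
    forall x, 0 <= x <= 1 -> m <= derive1 phi x <= c &
    forall x y, 0 <= x <= 1 -> 0 <= y <= 1 ->
      `|derive1 phi x - derive1 phi y| <= L * `|x - y|].
Proof.
move=> [d1 d2 c2] [m [_ lbm] m0].
have cont1 : continuous (derive1 phi).
  by move=> x; apply: differentiable_continuous; exact/derivable1_diffP.
have [xc _ cmax] := @EVT_max R (derive1 phi) 0 1 ler01 (continuous_subspaceT cont1).
have cn : continuous (fun x => `|derive1n 2 phi x|).
  by move=> x; apply: continuous_comp; [exact: c2|exact: norm_continuous].
have [xl _ Lmax] := @EVT_max R (fun x => `|derive1n 2 phi x|) 0 1 ler01 (continuous_subspaceT cn).
pose K : R := `|derive1n 2 phi xl|.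
have LmaxK (z : R) : 0 <= z <= 1 -> `|derive1 (derive1 phi) z| <= K.
  by move=> z01; apply: (Lmax z); rewrite in_itv.
have K0 : 0 <= K by exact: normr_ge0.
clearbody K; clear Lmax cn.
have wlogL (x y : R) : 0 <= x -> y <= 1 -> x <= y ->
    `|derive1 phi y - derive1 phi x| <= K * `|y - x|.
  move=> x0 y1 xy; have [z /andP[xz zy] e] := mvt_everywhere xy d2.
  rewrite e normrM; apply: ler_wpM2r => //; apply: LmaxK.
  by rewrite (le_trans x0 xz) (le_trans zy y1).
exists m, (derive1 phi xc), K; split => //.
  move=> x x01; rewrite cmax ?in_itv // andbT; apply: lbm.
  by exists x => //=; rewrite in_itv.
move=> x y /andP[x0 x1] /andP[y0 y1]; have [xy|/ltW yx] := leP x y.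
  by rewrite distrC [X in _ * X]distrC; exact: wlogL.
exact: wlogL.
Qed.

Section design.
Variables (R : realType) (phi : R -> R) (m c L : R).
Hypothesis m_gt0 : 0 < m.
Hypothesis L_ge0 : 0 <= L.
Hypothesis phi_derivable : forall x : R, derivable phi x 1.
Hypothesis phi_slope : forall x, 0 <= x <= 1 -> m <= derive1 phi x <= c.
Hypothesis phi_lip : forall x y, 0 <= x <= 1 -> 0 <= y <= 1 ->
  `|derive1 phi x - derive1 phi y| <= L * `|x - y|.

Lemma max_slope_gt0 : 0 < c.
Proof. by have /andP[h1 h2] := @phi_slope 0 (introT andP (conj (lexx 0) ler01)); exact: lt_le_trans m_gt0 (le_trans h1 h2). Qed.

Definition grid (n i : nat) : R := (i%:R - 1) / (n%:R - 1).

Lemma mesh_gt0 (n : nat) : (1 < n)%N -> 0 < n%:R - 1 :> R.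
Proof. by move=> n1; rewrite subr_gt0 ltr1n. Qed.

Lemma grid01 (n i : nat) : (1 < n)%N -> (0 < i)%N -> (i <= n)%N -> 0 <= grid n i <= 1.
Proof.
move=> n1 i0 iN; have s0 := mesh_gt0 n1.
rewrite /grid divr_ge0 ?(ltW s0) ?subr_ge0 ?ler1n //=.
by rewrite ler_pdivrMr // mul1r lerD2r ler_nat.
Qed.

Lemma grid_sub (n i j : nat) : grid n j - grid n i = (j%:R - i%:R) / (n%:R - 1).
Proof. by rewrite /grid -mulrBl; congr (_ / _); ring. Qed.

Lemma grid_le (n i j : nat) : (1 < n)%N -> (i <= j)%N -> grid n i <= grid n j.
Proof.
move=> n1 ij; rewrite -subr_ge0 grid_sub divr_ge0 ?(ltW (mesh_gt0 n1)) //.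
by rewrite subr_ge0 ler_nat.
Qed.

Lemma design_mvt (n i j : nat) : (1 < n)%N -> (0 < i)%N -> (i <= j)%N -> (j <= n)%N ->
  exists xi, [/\ 0 <= xi <= 1, grid n i <= xi <= grid n j &
    design phi n j - design phi n i = derive1 phi xi * ((j%:R - i%:R) / (n%:R - 1))].
Proof.
move=> n1 i0 ij jn.
have [xi /andP[h1 h2] e] := mvt_everywhere (grid_le n1 ij) phi_derivable.
have /andP[a1 _] := grid01 n1 i0 (leq_trans ij jn).
have /andP[_ b1] := grid01 n1 (leq_trans i0 ij) jn.
exists xi; split; last by rewrite -grid_sub -e.
  by rewrite (le_trans a1 h1) (le_trans h2 b1).
by rewrite h1 h2.
Qed.

Lemma design_increment (n i j : nat) : (1 < n)%N -> (0 < i)%N -> (i <= j)%N -> (j <= n)%N ->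
  m * ((j%:R - i%:R) / (n%:R - 1)) <= design phi n j - design phi n i
    <= c * ((j%:R - i%:R) / (n%:R - 1)).
Proof.
move=> n1 i0 ij jn; have [xi [x01 _ ->]] := design_mvt n1 i0 ij jn.
have /andP[h1 h2] := phi_slope x01.
have s0 : 0 <= (j%:R - i%:R) / (n%:R - 1) :> R.
  by rewrite divr_ge0 ?(ltW (mesh_gt0 n1)) // subr_ge0 ler_nat.
by rewrite !ler_wpM2r.
Qed.

Lemma design_increasing (n i j : nat) : (1 < n)%N -> (0 < i)%N -> (i < j)%N -> (j <= n)%N ->
  design phi n i < design phi n j.
Proof.
move=> n1 i0 ij jn; have /andP[h _] := design_increment n1 i0 (ltnW ij) jn.
rewrite -subr_gt0; apply: lt_le_trans h.
by rewrite mulr_gt0 // divr_gt0 ?mesh_gt0 // subr_gt0 ltr_nat.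
Qed.

(** The local spacing of the design. *)
Definition step (n i : nat) : R := derive1 phi (grid n i) / (n%:R - 1).

Lemma step_bounds (n i : nat) : (1 < n)%N -> (0 < i)%N -> (i <= n)%N ->
  m / (n%:R - 1) <= step n i <= c / (n%:R - 1).
Proof.
move=> n1 i0 iN; have /andP[h1 h2] := phi_slope (grid01 n1 i0 iN).
by rewrite /step !ler_wpM2r // invr_ge0 ltW // mesh_gt0.
Qed.

Lemma step_gt0 (n i : nat) : (1 < n)%N -> (0 < i)%N -> (i <= n)%N -> 0 < step n i.
Proof.
move=> n1 i0 iN; have /andP[h _] := step_bounds n1 i0 iN.
by apply: lt_le_trans h; rewrite divr_gt0 // mesh_gt0.
Qed.

(** The nodes of a window in the local affine chart that sends equispaced points
    to the integers. *)
Definition rescaled (n theta i k : nat) : R :=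
  (design phi n (i + theta * k) - design phi n i) / (theta%:R * step n i).

Lemma rescaledK (n theta i : nat) : (1 < n)%N -> (0 < i)%N -> (i <= n)%N -> (0 < theta)%N ->
  (fun k => design phi n (i + theta * k)%N) =
  (fun k => design phi n i + (theta%:R * step n i) * rescaled n theta i k).
Proof.
move=> n1 i0 iN th0; apply/funext => k; rewrite /rescaled mulrCA divff ?mulr1 ?subrKC //.
by rewrite mulf_neq0 ?pnatr_eq0 -?lt0n // gt_eqF // step_gt0.
Qed.

(** The mean value theorem replaces a node by the derivative at an intermediate
    point, at distance at most theta l / (n - 1) from the left end of the
    window. *)
Lemma rescaled_close (n theta i k : nat) (l : nat) : (1 < n)%N -> (0 < i)%N -> (0 < theta)%N ->
  (i + theta * l <= n)%N -> (k <= l)%N ->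
  `|rescaled n theta i k - k%:R| <= l%:R * L * (theta * l)%:R / m / (n%:R - 1).
Proof.
move=> n1 i0 th0 iln kl.
have ikn : (i + theta * k <= n)%N by rewrite (leq_trans _ iln) // leq_add2l leq_mul2l kl orbT.
have iN : (i <= n)%N by rewrite (leq_trans _ iln) // leq_addr.
have [xi [x01 /andP[x1 x2] e]] := design_mvt n1 i0 (leq_addr (theta * k) i) ikn.
have s0 := mesh_gt0 n1; have g01 := grid01 n1 i0 iN.
have /andP[p1 _] := phi_slope g01.
have p0 : 0 < derive1 phi (grid n i) by exact: lt_le_trans m_gt0 p1.
have -> : rescaled n theta i k - k%:R =
    k%:R * (derive1 phi xi - derive1 phi (grid n i)) / derive1 phi (grid n i).
  rewrite /rescaled e /step natrD natrM; field.
  by rewrite (gt_eqF p0) (gt_eqF s0) pnatr_eq0 -lt0n th0.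
have xg : `|xi - grid n i| <= (theta * l)%:R / (n%:R - 1).
  rewrite ger0_norm ?subr_ge0 //.
  apply: (@le_trans _ _ (grid n (i + theta * k) - grid n i)); first by rewrite lerD2r.
  rewrite grid_sub ler_wpM2r ?invr_ge0 ?(ltW s0) // natrD addrAC subrr add0r.
  by rewrite ler_nat leq_mul2l kl orbT.
rewrite !normrM normfV (gtr0_norm p0) (ger0_norm (ler0n _ _)).
rewrite -(mulrA _ m^-1) -[X in _ <= X]mulrA.
apply: (@le_trans _ _ (l%:R * (L * ((theta * l)%:R / (n%:R - 1))) / m)); last first.
  by rewrite le_eqVlt; apply/orP; left; apply/eqP; field; rewrite (gt_eqF m_gt0) (gt_eqF s0).
rewrite ler_pM ?invr_ge0 ?(ltW p0) ?mulr_ge0 //; last by rewrite lef_pV2 ?posrE.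
rewrite ler_pM // ?ler_nat //.
by rewrite (le_trans (phi_lip x01 g01)) // ler_wpM2l.
Qed.

End design.

(** * Uniform limit of the ratio function *)

Lemma ler_npowR (R : realType) (x y p : R) : 0 < x -> x <= y -> p <= 0 -> y `^ p <= x `^ p.
Proof.
move=> x0 xy p0; have y0 := lt_le_trans x0 xy.
have [q q0 ->] : exists2 q, 0 <= q & p = - q.
  by exists (- p); rewrite ?oppr_ge0 ?opprK.
rewrite !powRN lef_pV2 ?posrE ?powR_gt0 //.
by apply: ge0_ler_powR; rewrite ?nnegrE // ltW.
Qed.

Lemma quotient_near1 (R : realType) (eps e1 e2 e3 : R) : 0 <= eps -> eps <= 4^-1 ->
  `|e1| <= eps -> `|e2| <= eps -> 0 <= e3 <= eps ->
  `|(1 + e2) / ((1 + e1) * (1 + e3)) - 1| <= 8 * eps.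
Proof.
move=> e0 e4; rewrite !ler_norml => /andP[a1 b1] /andP[a2 b2] /andP[a3 b3].
have d1 : 0 < 1 + e1 by lra.
have d3 : 0 < 1 + e3 by lra.
have d : 3 / 4 <= (1 + e1) * (1 + e3) by nra.
have d0 : 0 < (1 + e1) * (1 + e3) by exact: mulr_gt0.
rewrite lerBrDr ler_pdivlMr // lerBlDr ler_pdivrMr //.
apply/andP; split; nra.
Qed.

Lemma powR_div_ratio (R : realType) (m c s p : R) : 0 < m -> 0 < c -> 0 < s ->
  (m / s) `^ p = (c / m) `^ (- p) * (c / s) `^ p.
Proof.
move=> m0 c0 s0; have -> : m / s = (c / s) * (c / m)^-1.
  by field; rewrite (gt_eqF s0) (gt_eqF m0) (gt_eqF c0).
rewrite powRM ?invr_ge0 ?divr_ge0 ?ltW // mulrC; congr (_ * _).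
by rewrite -powR_inv1 ?divr_ge0 ?ltW // -powRrM mulN1r.
Qed.

Lemma trimmed_indices (n l : nat) : (2 * l < n)%N -> ((n - 1 * l).+1 - (n - 2 * l).+1 = l)%N.
Proof. by lia. Qed.

Lemma ratio_of_approximations (R : realType) (e a1 a2 q D S1 S2 : R) :
  D != 0 -> 0 < a1 -> 0 < a2 -> 0 < q -> 0 <= e -> e <= 4^-1 ->
  `|S1 - D * a1| <= e * `|D| * a1 -> `|S2 - D * (q * a2)| <= e * `|D| * (q * a2) ->
  0 <= a1 - a2 <= e * a2 ->
  S1 != 0 /\ `|S2 / S1 - q| <= 8 * e * q.
Proof.
move=> D0 A1 A2 P2 e0 e4 h1 h2 h3.
have D0' : 0 < `|D| by rewrite normr_gt0.
pose e1 := S1 / (D * a1) - 1; pose e2 := S2 / (D * (q * a2)) - 1; pose e3 := a1 / a2 - 1.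
have n0 : [/\ a1 != 0, a2 != 0 & q != 0] by rewrite !gt_eqF.
have [a10 a20 q0] := n0.
have b1 : `|e1| <= e.
  have -> : e1 = (S1 - D * a1) / (D * a1) by rewrite /e1; field; rewrite a10 D0.
  rewrite normf_div ler_pdivrMr ?normr_gt0 ?mulf_neq0 // normrM (gtr0_norm A1).
  by rewrite [X in _ <= X]mulrA.
have b2 : `|e2| <= e.
  have -> : e2 = (S2 - D * (q * a2)) / (D * (q * a2)) by rewrite /e2; field; rewrite a20 q0 D0.
  rewrite normf_div ler_pdivrMr ?normr_gt0 ?mulf_neq0 // normrM (gtr0_norm (mulr_gt0 P2 A2)).
  by rewrite [X in _ <= X]mulrA.
have b3 : 0 <= e3 <= e.
  have -> : e3 = (a1 - a2) / a2 by rewrite /e3; field.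
  by move/andP: h3 => [h3 h4]; rewrite ler_pdivrMr // h4 andbT divr_ge0 // ltW.
have E1 : S1 = D * (a2 * ((1 + e1) * (1 + e3))) by rewrite /e1 /e3; field; rewrite a10 a20 D0.
have E2 : S2 = D * (q * a2 * (1 + e2)) by rewrite /e2; field; rewrite a20 q0 D0.
have := quotient_near1 e0 e4 b1 b2 b3.
have d1 : 1 + e1 != 0 by move: b1; rewrite ler_norml => /andP[h _]; rewrite gt_eqF //; lra.
have d3 : 1 + e3 != 0 by move: b3 => /andP[h _]; rewrite gt_eqF //; lra.
move=> hq; split; first by rewrite E1 !mulf_neq0.
rewrite E1 E2.
have -> : D * (q * a2 * (1 + e2)) / (D * (a2 * ((1 + e1) * (1 + e3)))) - q =
  ((1 + e2) / ((1 + e1) * (1 + e3)) - 1) * q by field; rewrite D0 a20 d1 d3.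
by rewrite normrM (gtr0_norm P2) ler_wpM2r ?(ltW P2).
Qed.

Lemma index_range (n theta l i : nat) : (theta * l < n)%N ->
  (1 <= i < (n - theta * l).+1)%N -> (0 < i)%N /\ (i + theta * l <= n)%N.
Proof. by move: (theta * l)%N => q h /andP[i0 iN]; split => //; lia. Qed.

Section design_sums.
Variables (R : realType) (phi : R -> R) (m c L : R) (l : nat).
Hypothesis m_gt0 : 0 < m.
Hypothesis L_ge0 : 0 <= L.
Hypothesis phi_derivable : forall x : R, derivable phi x 1.
Hypothesis phi_slope : forall x, 0 <= x <= 1 -> m <= derive1 phi x <= c.
Hypothesis phi_lip : forall x y, 0 <= x <= 1 -> 0 <= y <= 1 ->
  `|derive1 phi x - derive1 phi y| <= L * `|x - y|.
Hypothesis l_gt0 : (0 < l)%N.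

Local Notation nodes n theta i := (fun k => design phi n (i + theta * k)%N).

Lemma rescaled_near (theta : nat) (U : set (nat -> R)) : (0 < theta)%N -> near_idn R l U ->
  \forall n \near \oo, (theta * l < n)%N /\ forall i, (0 < i)%N -> (i + theta * l <= n)%N ->
    U (rescaled phi n theta i).
Proof.
move=> th0 [e /= e0 eU]; near=> n.
have n1 : (1 < n)%N by near: n; exact: nbhs_infty_gt.
split; first by near: n; exact: nbhs_infty_gt.
move=> i i0 iln; apply: eU => k kl.
apply: le_lt_trans (rescaled_close m_gt0 L_ge0 phi_derivable phi_slope phi_lip n1 i0 th0 iln kl) _.
rewrite ltr_pdivrMr ?mesh_gt0 // -ltr_pdivrMl // ltrBrDr.
by near: n; exact: nbhs_infty_gtr.
Unshelve. all: by end_near. Qed.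

(** [f_fun] without the factor [betastar v]. *)
Definition dd_sum (n theta : nat) (v : R) : R :=
  \sum_(1 <= i < (n - theta * l).+1) DG l v (nodes n theta i).
(** The part of the leading term of [dd_sum] that comes from the local spacings. *)
Definition step_sum (n theta : nat) (v : R) : R :=
  \sum_(1 <= i < (n - theta * l).+1) step phi n i `^ (2 * v - 2 * l%:R).

Lemma step_sum_lower (n theta : nat) (v : R) : (1 < n)%N -> (theta * l < n)%N -> v < l%:R ->
  (n - theta * l)%:R * (c / (n%:R - 1)) `^ (2 * v - 2 * l%:R) <= step_sum n theta v.
Proof.
move=> n1 ln vl; have E : ((n - theta * l).+1 - 1 = n - theta * l)%N by rewrite subn1.
rewrite mulr_natl -[in X in X <= _]E -sumr_const_nat /step_sum.
rewrite [X in X <= _]big_nat [X in _ <= X]big_nat; apply: ler_sum => i hi.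
have [i0 iln] := index_range ln hi.
have iN : (i <= n)%N by rewrite (leq_trans _ iln) // leq_addr.
have /andP[_ h] := step_bounds phi_slope n1 i0 iN.
have s0 := step_gt0 m_gt0 phi_slope n1 i0 iN.
by apply: (ler_npowR s0 h); rewrite subr_le0 ler_pM2l // ltW.
Qed.

Lemma step_sum_gt0 (n theta : nat) (v : R) : (1 < n)%N -> (theta * l < n)%N -> v < l%:R ->
  0 < step_sum n theta v.
Proof.
move=> n1 ln vl; apply: lt_le_trans (step_sum_lower n1 ln vl).
rewrite mulr_gt0 ?ltr0n ?subn_gt0 //; apply: powR_gt0.
by rewrite divr_gt0 ?mesh_gt0 // (max_slope_gt0 m_gt0 phi_slope).
Qed.

Lemma dd_sum_close (theta : nat) (eps : R) : (0 < theta)%N -> 0 < eps ->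
  \forall n \near \oo, forall v : R, 0 < v -> v < l%:R ->
    `|dd_sum n theta v - DG l v (idn R) * (theta%:R `^ (2 * v - 2 * l%:R) * step_sum n theta v)| <=
    eps * `|DG l v (idn R)| * (theta%:R `^ (2 * v - 2 * l%:R) * step_sum n theta v).
Proof.
move=> th0 e0; near=> n => v v0 vl.
have n1 : (1 < n)%N by near: n; exact: nbhs_infty_gt.
have [ln H] : (theta * l < n)%N /\ forall i, (0 < i)%N -> (i + theta * l <= n)%N ->
    nodes_up l (rescaled phi n theta i) /\ forall v, 0 < v -> v < l%:R ->
      `|DG l v (rescaled phi n theta i) - DG l v (idn R)| <= eps * `|DG l v (idn R)|.
  by near: n; exact: rescaled_near th0 (DG_close l_gt0 e0).
rewrite /dd_sum /step_sum !mulr_sumr -sumrB [X in `|X| <= _]big_nat [X in _ <= X]big_nat.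
apply: le_trans (ler_norm_sum _ _ _) _; apply: ler_sum => i hi.
have [i0 iln] := index_range ln hi.
have iN : (i <= n)%N by rewrite (leq_trans _ iln) // leq_addr.
have [up cl] := H i i0 iln.
have s0 := step_gt0 m_gt0 phi_slope n1 i0 iN.
have h0 : 0 < theta%:R * step phi n i by apply: mulr_gt0; rewrite ?ltr0n.
rewrite (rescaledK m_gt0 phi_slope n1 i0 iN th0) DG_affine //.
rewrite powRM ?ler0n ?(ltW s0) //.
have := mulr_ge0 (powR_ge0 theta%:R (2 * v - 2 * l%:R)) (powR_ge0 (step phi n i) (2 * v - 2 * l%:R)).
move: (_ * _ `^ _) => Q Q0.
rewrite mulrC -mulrBl normrM (ger0_norm Q0).
by apply: ler_wpM2r => //; exact: cl.
Unshelve. all: by end_near. Qed.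

(** The two sums differ by l terms, each comparable to any term of the sum for
    theta = 2. *)
Lemma step_sum_ratio (eps : R) : 0 < eps ->
  \forall n \near \oo, forall v : R, 0 < v -> v < l%:R ->
    0 <= step_sum n 1 v - step_sum n 2 v <= eps * step_sum n 2 v.
Proof.
move=> e0; near=> n => v v0 vl.
have n1 : (1 < n)%N by near: n; exact: nbhs_infty_gt.
have ln : (2 * l < n)%N by near: n; exact: nbhs_infty_gt.
have s0 := mesh_gt0 R n1.
set p := 2 * v - 2 * l%:R.
have p0 : p <= 0 by rewrite /p; lra.
have cm : m <= c by have /andP[] := phi_slope (introT andP (conj (lexx 0) ler01)); exact: le_trans.
have c0 := max_slope_gt0 m_gt0 phi_slope.
have -> : step_sum n 1 v - step_sum n 2 v =
    \sum_((n - 2 * l).+1 <= i < (n - 1 * l).+1) step phi n i `^ p.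
  have le21 : ((n - 2 * l).+1 <= (n - 1 * l).+1)%N by rewrite ltnS leq_sub2l // leq_mul2r orbT.
  rewrite /step_sum -/p [X in X - _](big_cat_nat (ltn0Sn (n - 2 * l)) le21) /=.
  by rewrite addrAC subrr add0r.
apply/andP; split; first by apply: sumr_ge0 => i _; exact: powR_ge0.
apply: (@le_trans _ _ (\sum_((n - 2 * l).+1 <= i < (n - 1 * l).+1) (m / (n%:R - 1)) `^ p)).
  rewrite [X in X <= _]big_nat [X in _ <= X]big_nat; apply: ler_sum => i /andP[i1 i2].
  have i0 : (0 < i)%N by exact: leq_ltn_trans i1.
  have iN : (i <= n)%N by rewrite (leq_trans (ltnSE i2)) // leq_subr.
  have /andP[h _] := step_bounds phi_slope n1 i0 iN.
  by apply: ler_npowR => //; rewrite divr_gt0.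
rewrite sumr_const_nat.
rewrite trimmed_indices //.
have lb := step_sum_lower n1 ln vl; rewrite -/p in lb.
rewrite (powR_div_ratio p m_gt0 c0 s0).
have cm1 : (c / m) `^ (- p) <= (c / m) `^ (2 * l%:R).
  apply: ler_powR; first by rewrite ler_pdivlMr // mul1r.
  by rewrite /p; lra.
rewrite -[X in X <= _]mulr_natl.
set q := (c / (n%:R - 1)) `^ p in lb *.
have q0 : 0 <= q by exact: powR_ge0.
apply: (@le_trans _ _ (l%:R * (c / m) `^ (2 * l%:R) * q)).
  by rewrite mulrA ler_wpM2r // ler_wpM2l // ler0n.
apply: le_trans (ler_wpM2l (ltW e0) lb).
rewrite mulrA ler_wpM2r // -ler_pdivrMl // mulrC natrB; last exact: ltnW.
rewrite lerBrDr; apply: ltW; near: n; exact: nbhs_infty_gtr.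
Unshelve. all: by end_near. Qed.

(** The factor depending on v alone cancels, so that the relative errors do not
    depend on v. *)
Lemma dd_sum_ratio (eps : R) : 0 < eps ->
  \forall n \near \oo, forall v : R, 0 < v -> v < l%:R ->
    dd_sum n 1 v != 0 /\
    `|dd_sum n 2 v / dd_sum n 1 v - 2 `^ (2 * v - 2 * l%:R)| <= eps * 2 `^ (2 * v - 2 * l%:R).
Proof.
(* [quotient_near1] needs a tolerance of at most 1/4 and multiplies it by 8. *)
move=> e0; pose e := Num.min (eps / 8) 4^-1.
have e_gt0 : 0 < e by rewrite lt_min divr_gt0 //= invr_gt0.
have e4 : e <= 4^-1 by rewrite ge_min lexx orbT.
have e8 : 8 * e <= eps by rewrite mulrC -ler_pdivlMr // ge_min lexx.
near=> n => v v0 vl.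
have n1 : (1 < n)%N by near: n; exact: nbhs_infty_gt.
have l2n : (2 * l < n)%N by near: n; exact: nbhs_infty_gt.
have l1n : (1 * l < n)%N by rewrite (leq_ltn_trans _ l2n) // leq_mul2r orbT.
set p := 2 * v - 2 * l%:R; set D := DG l v (idn R).
have h1 : forall v : R, 0 < v -> v < l%:R ->
    `|dd_sum n 1 v - DG l v (idn R) * (1%:R `^ (2 * v - 2 * l%:R) * step_sum n 1 v)| <=
    e * `|DG l v (idn R)| * (1%:R `^ (2 * v - 2 * l%:R) * step_sum n 1 v).
  by near: n; exact: dd_sum_close.
have h2 : forall v : R, 0 < v -> v < l%:R ->
    `|dd_sum n 2 v - DG l v (idn R) * (2%:R `^ (2 * v - 2 * l%:R) * step_sum n 2 v)| <=
    e * `|DG l v (idn R)| * (2%:R `^ (2 * v - 2 * l%:R) * step_sum n 2 v).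
  by near: n; exact: dd_sum_close.
have h3 : forall v : R, 0 < v -> v < l%:R ->
    0 <= step_sum n 1 v - step_sum n 2 v <= e * step_sum n 2 v.
  by near: n; exact: step_sum_ratio.
have {}h1 := h1 v v0 vl; have {}h2 := h2 v v0 vl; have {}h3 := h3 v v0 vl.
move: h1 h2 h3; rewrite -/p -/D.
have D0 : D != 0 by exact: DG_idn_neq0.
have A1 := step_sum_gt0 n1 l1n vl; have A2 := step_sum_gt0 n1 l2n vl.
have P2 : 0 < 2%:R `^ p :> R by exact: powR_gt0.
rewrite powR1 mul1r.
move=> h1 h2 h3; have [h h'] := ratio_of_approximations D0 A1 A2 P2 (ltW e_gt0) e4 h1 h2 h3.
by split => //; rewrite (le_trans h') // ler_wpM2r // ltW.
Unshelve. all: by end_near. Qed.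

End design_sums.

Lemma continuous_powR_exponent (R : realType) (a b c : R) : 0 < a ->
  continuous (fun v : R => a `^ (b * v - c)).
Proof.
move=> a0 x; rewrite /powR gt_eqF //.
apply: (@continuous_comp _ _ _ (fun v : R => (b * v - c) * ln a) expR); last exact: continuous_expR.
apply: continuousM; last exact: cvg_cst.
apply: continuousB; last exact: cvg_cst.
by apply: continuousM; [exact: cvg_cst|exact: cvg_id].
Qed.

Lemma cvg_G_at0 (R : realType) (s : R) : 0 <= s ->
  G v s @[v --> 0^'+] --> (if s == 0 then 0 else 1 : R).
Proof.
move=> s0; have [->|sn0] := eqVneq s 0.
  by under eq_fun do rewrite G_at0; exact: cvg_cst.
have sp : 0 < s by rewrite lt_neqAle eq_sym sn0.
have : expR (2 * ln s * v) @[v --> 0^'+] --> expR (2 * ln s * 0).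
  apply: cvg_at_right_filter; apply: (@continuous_comp _ _ _ (fun v => 2 * ln s * v) expR).
    by apply: continuousM; [exact: cvg_cst|exact: cvg_id].
  exact: continuous_expR.
rewrite mulr0 expR0; apply: cvg_trans; apply: near_eq_cvg; near=> v.
have v0 : 0 < v by near: v; exact: nbhs_right_gt.
have v1 : v < 1%:R by near: v; exact: nbhs_right_lt.
rewrite /G (negbTE sn0); case: ifPn => [vi|_].
  have [[|p] vE //] := int_lt_natr (ltW v0) v1 vi.
  by move: v0; rewrite vE ltxx.
by rewrite /powR (negbTE sn0); congr expR; ring.
Unshelve. all: by end_near. Qed.

(** In the limit the kernel is the indicator of distinct points, and the
    coefficients sum to 0. *)
Lemma cvg_DG_at0 (R : realType) (l : nat) (x : nat -> R) : (0 < l)%N -> nodes_up l x ->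
  DG l v x @[v --> 0^'+] --> - \sum_(0 <= k < l.+1) ddc l x k ^+ 2.
Proof.
move=> l0 up.
have -> : - \sum_(0 <= k < l.+1) ddc l x k ^+ 2 = \sum_(0 <= k < l.+1) \sum_(0 <= k' < l.+1)
    ddc l x k * ddc l x k' * (if `|x k - x k'| == 0 then 0 else 1).
  have z : \sum_(0 <= k < l.+1) ddc l x k = 0.
    by have := ddc_poly up l0; under eq_bigr do rewrite expr0 mulr1.
  rewrite -[LHS]add0r -[X in X - _](mul0r (\sum_(0 <= k' < l.+1) ddc l x k')) -{1}z mulr_suml -sumrB.
  rewrite [LHS]big_nat [RHS]big_nat; apply: eq_bigr => k /andP[_ kl].
  rewrite mulr_sumr -[X in _ - X](sum_delta (fun k' => ddc l x k' ^+ 2) kl) -sumrB.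
  rewrite [LHS]big_nat [RHS]big_nat; apply: eq_bigr => k' /andP[_ k'l].
  rewrite normr_eq0; have [->|kk'] := eqVneq k' k.
    by rewrite subrr eqxx mulr0 mul1r expr2 subrr.
  by rewrite (negbTE (nodes_up_neq up _ _ kk')) // mulr1 mul0r subr0.
apply: cvg_sum_le => k kl; apply: cvg_sum_le => k' k'l.
by apply: cvgM; [exact: cvg_cst|exact: cvg_G_at0].
Qed.

Section ratio_function.
Variables (R : realType) (phi : R -> R) (m c L : R) (l : nat) (betastar : R -> R).
Hypothesis m_gt0 : 0 < m.
Hypothesis L_ge0 : 0 <= L.
Hypothesis phi_derivable : forall x : R, derivable phi x 1.
Hypothesis phi_slope : forall x, 0 <= x <= 1 -> m <= derive1 phi x <= c.
Hypothesis phi_lip : forall x y, 0 <= x <= 1 -> 0 <= y <= 1 ->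
  `|derive1 phi x - derive1 phi y| <= L * `|x - y|.
Hypothesis l_gt0 : (0 < l)%N.
Hypothesis betastar_neq0 : forall v : R, 0 < v -> v < l%:R -> betastar v != 0.

Lemma design_nodes_up (n theta i : nat) : (1 < n)%N -> (0 < theta)%N -> (0 < i)%N ->
  (i + theta * l <= n)%N -> nodes_up l (fun k => design phi n (i + theta * k)%N).
Proof.
move=> n1 th0 i0 iln k kl; apply: (design_increasing m_gt0 phi_derivable phi_slope n1).
- by rewrite addn_gt0 i0.
- by rewrite ltn_add2l ltn_pmul2l.
by rewrite (leq_trans _ iln) // leq_add2l leq_mul2l kl orbT.
Qed.

Lemma f_fun_dd_sum (n theta : nat) (v : R) : (1 < n)%N -> (0 < theta)%N ->
  f_fun betastar (design phi n) n theta l v = betastar v * dd_sum phi l n theta v.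
Proof.
move=> n1 th0; rewrite f_fun_DG // => i j i0 ij jn.
exact: (design_increasing m_gt0 phi_derivable phi_slope n1).
Qed.

(** A nonzero limit is what makes the ratio converge at 0+. *)
Lemma cvg_dd_sum_at0 (n theta : nat) : (1 < n)%N -> (0 < theta)%N -> (theta * l < n)%N ->
  exists2 g : R, g < 0 & dd_sum phi l n theta v @[v --> 0^'+] --> g.
Proof.
move=> n1 th0 ln.
have [N NE] : exists N, (n - theta * l)%N = N.+1.
  by exists (n - theta * l).-1; rewrite prednK // subn_gt0.
have up i : (i <= N)%N -> nodes_up l (fun k => design phi n (i.+1 + theta * k)%N).
  by move=> iN; apply: design_nodes_up => //; move: NE; move: (theta * l)%N => q NE; lia.
pose g i := \sum_(0 <= k < l.+1) ddc l (fun k => design phi n (i.+1 + theta * k)%N) k ^+ 2.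
have g0 i : (i <= N)%N -> 0 < g i.
  move=> iN; rewrite /g big_nat_recl //= ltr_pwDl //; last first.
    by apply: sumr_ge0 => k _; exact: sqr_ge0.
  by rewrite lt_neqAle sqr_ge0 eq_sym sqrf_eq0 ddc_neq0 //; exact: up.
exists (\sum_(0 <= i < N.+1) - g i).
  rewrite sumrN oppr_lt0 big_nat_recl //= ltr_pwDl ?g0 //.
  rewrite big_nat; apply: sumr_ge0 => i /andP[_ iN]; exact/ltW/g0.
rewrite /dd_sum NE; under eq_fun do rewrite big_add1 /=.
by apply: cvg_sum_le => i iN; apply: cvg_DG_at0 => //; exact: up.
Qed.

(** For v = 0 the bound passes to the limit that defines the ratio function
    there. *)
Lemma F_fun_close (M eps : R) : M < l%:R -> 0 < eps ->
  \forall n \near \oo, forall v : R, 0 <= v -> v <= M ->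
    `|F_fun betastar (design phi n) n l v - 2 `^ (2 * v - 2 * l%:R)| <=
    eps * 2 `^ (2 * v - 2 * l%:R).
Proof.
move=> Ml e0; near=> n.
have n1 : (1 < n)%N by near: n; exact: nbhs_infty_gt.
have ln : (2 * l < n)%N by near: n; exact: nbhs_infty_gt.
have l1n : (1 * l < n)%N by rewrite (leq_ltn_trans _ ln) // leq_mul2r orbT.
have H : forall v : R, 0 < v -> v < l%:R -> dd_sum phi l n 1 v != 0 /\
    `|dd_sum phi l n 2 v / dd_sum phi l n 1 v - 2 `^ (2 * v - 2 * l%:R)| <=
    eps * 2 `^ (2 * v - 2 * l%:R).
  by near: n; exact: (dd_sum_ratio m_gt0 L_ge0 phi_derivable phi_slope phi_lip l_gt0 e0).
have ratioE (v : R) : 0 < v -> v < l%:R ->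
    f_fun betastar (design phi n) n 2 l v / f_fun betastar (design phi n) n 1 l v =
    dd_sum phi l n 2 v / dd_sum phi l n 1 v.
  move=> v0 vl; rewrite !f_fun_dd_sum // invfM mulrACA divff ?mul1r //.
  exact: betastar_neq0.
move=> v; rewrite le_eqVlt /F_fun => /predU1P[<-|v0] vM; last first.
  have vl : v < l%:R by exact: le_lt_trans Ml.
  by rewrite gt_eqF // ratioE //; have [] := H v v0 vl.
rewrite eqxx; set f := fun v : R => _.
have near_f : \forall v \near (0:R)^'+, dd_sum phi l n 2 v / dd_sum phi l n 1 v = f v.
  near=> v'.
  have v'0 : 0 < v' by near: v'; exact: nbhs_right_gt.
  have v'l : v' < l%:R by near: v'; apply: nbhs_right_lt; rewrite ltr0n.
  by rewrite /f ratioE.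
have [g1 g10 c1] := cvg_dd_sum_at0 n1 (ltn0Sn 0) l1n.
have [g2 _ c2] := cvg_dd_sum_at0 n1 (ltn0Sn 1) ln.
have cf : f v @[v --> 0^'+] --> g2 / g1.
  apply: cvg_trans (near_eq_cvg near_f) _.
  by apply: cvgM => //; apply: cvgV => //; rewrite lt_eqF.
have -> : lim (f v @[v --> 0^'+]) = g2 / g1 by exact: cvg_lim cf.
have cp : 2 `^ (2 * v - 2 * l%:R) @[v --> (0:R)^'+] --> (2 `^ (2 * 0 - 2 * l%:R) : R).
  by apply: cvg_at_right_filter; exact: (@continuous_powR_exponent _ 2 2 (2 * l%:R)).
have c3 : eps * 2 `^ (2 * v - 2 * l%:R) - `|f v - 2 `^ (2 * v - 2 * l%:R)| @[v --> 0^'+] -->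
    eps * 2 `^ (2 * 0 - 2 * l%:R) - `|g2 / g1 - 2 `^ (2 * 0 - 2 * l%:R)|.
  apply: cvgB; first by apply: cvgM => //; exact: cvg_cst.
  by apply: cvg_norm; exact: cvgB.
rewrite -subr_ge0; apply: (cvgr_to_ge c3); near=> v'.
have v'0 : 0 < v' by near: v'; exact: nbhs_right_gt.
have v'l : v' < l%:R by near: v'; apply: nbhs_right_lt; rewrite ltr0n.
by rewrite subr_ge0 /f ratioE //; have [] := H v' v'0 v'l.
Unshelve. all: by end_near. Qed.

End ratio_function.

(** * Covariances of the divided differences *)

Lemma is_derive_ddc_sum (R : realType) (l : nat) (y : nat -> R) (h h' : nat -> R -> R) (u : R) :
  (forall k, (k <= l)%N -> is_derive u 1 (h k) (h' k u)) ->
  is_derive u 1 (fun z => \sum_(0 <= k < l.+1) ddc l y k * h k z)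
    (\sum_(0 <= k < l.+1) ddc l y k * h' k u).
Proof.
move=> dh; rewrite big_mkord; under eq_fun do rewrite big_mkord.
apply: is_derive_bigsum => k.
have d := dh k (leq_ord k).
by apply: is_derive_eq; rewrite /GRing.scale /=; ring.
Qed.

(** The mean value theorem for divided differences, first in u and then in v. *)
Lemma bilin_difference_mvt (R : realType) (l : nat) (x y : nat -> R) (K : nat -> R -> R) :
  nodes_up l x -> nodes_up l y ->
  (forall j, (j < 2 * l)%N -> forall z : R, x 0%N - y l <= z <= x l - y 0%N ->
     is_derive z 1 (K j) (K j.+1 z)) ->
  exists2 z, x 0%N - y l <= z <= x l - y 0%N &
    `|bilin l x y (fun u v => K 0%N (u - v))| = `|K (2 * l)%N z|.
Proof.
move=> upx upy dK.
have yb k : (k <= l)%N -> y 0%N <= y k <= y l.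
  by move=> kl; rewrite !(nodes_up_le upy) ?kl ?leqnn.
pose g j (u : R) := \sum_(0 <= k < l.+1) ddc l y k * K j (u - y k).
have dg j : (j < l)%N -> forall u : R, x 0%N <= u <= x l -> is_derive u 1 (g j) (g j.+1 u).
  move=> jl u /andP[u1 u2]; 
  apply: (@is_derive_ddc_sum _ l y (fun k z => K j (z - y k)) (fun k z => K j.+1 (z - y k))) => k kl.
  have /andP[y1 y2] := yb k kl.
  have d : is_derive (u - y k) 1 (K j) (K j.+1 (u - y k)).
    apply: dK; first by rewrite (leq_trans jl) // leq_pmull.
    by rewrite lerB // lerB.
  have d1 : is_derive u 1 (fun z : R => z - y k) 1 by apply: is_derive_eq; rewrite subr0.
  have := @is_derive1_comp R (K j) (fun z => z - y k) u _ _ d d1.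
  by rewrite mulr1.
have [xi /andP[xi1 xi2] e1] := divided_difference_mvt upx dg.
pose h j (v : R) := (-1) ^+ j * K (l + j)%N (xi - v).
have dh j : (j < l)%N -> forall v : R, y 0%N <= v <= y l -> is_derive v 1 (h j) (h j.+1 v).
  move=> jl v /andP[v1 v2].
  have d : is_derive (xi - v) 1 (K (l + j)%N) (K (l + j).+1 (xi - v)).
    apply: dK; first by rewrite mul2n -addnn ltn_add2l.
    by rewrite lerB // lerB.
  have d1 : is_derive v 1 (fun z : R => xi - z) (- 1) by apply: is_derive_eq; rewrite add0r mul1r.
  have d2 := @is_derive1_comp R (K (l + j)%N) (fun z => xi - z) v _ _ d d1.
  apply: is_derive_eq; rewrite /h /GRing.scale /= exprS addnS; ring.
have [eta /andP[et1 et2] e2] := divided_difference_mvt upy dh.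
exists (xi - eta); first by rewrite lerB // lerB.
have -> : bilin l x y (fun u v => K 0%N (u - v)) = \sum_(0 <= k < l.+1) ddc l x k * g 0%N (x k).
  rewrite /bilin /g; apply: eq_bigr => k _; rewrite mulr_sumr.
  by apply: eq_bigr => k' _; rewrite mulrA.
rewrite e1.
have -> : g l xi = \sum_(0 <= k < l.+1) ddc l y k * h 0%N (y k).
  by apply: eq_bigr => k _; rewrite /h expr0 mul1r addn0.
by rewrite e2 /h normrM normrX normrN1 expr1n mul1r mul2n addnn.
Qed.

(** The total size of the coefficients, which bounds a difference by the size of
    the function. *)
Definition weight (R : realType) (l : nat) (x : nat -> R) : R :=
  \sum_(0 <= k < l.+1) `|ddc l x k|.

Lemma weight_ge0 (R : realType) (l : nat) (x : nat -> R) : 0 <= weight l x.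
Proof. by apply: sumr_ge0 => k _; exact: normr_ge0. Qed.

Lemma norm_bilin_le (R : realType) (l : nat) (x y : nat -> R) (H : R -> R -> R) (B : R) :
  (forall k k', (k <= l)%N -> (k' <= l)%N -> `|H (x k) (y k')| <= B) ->
  `|bilin l x y H| <= weight l x * weight l y * B.
Proof.
move=> HB; rewrite /bilin /weight mulr_suml mulr_suml.
apply: le_trans (ler_norm_sum _ _ _) _; rewrite big_nat [leRHS]big_nat.
apply: ler_sum => k /andP[_ kl]; rewrite mulr_sumr mulr_suml.
apply: le_trans (ler_norm_sum _ _ _) _; rewrite big_nat [leRHS]big_nat.
apply: ler_sum => k' /andP[_ k'l]; rewrite !normrM ler_wpM2l ?mulr_ge0 //.
exact: HB.
Qed.

Lemma weight_affine (R : realType) (l : nat) (x : nat -> R) (a h : R) : 0 < h ->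
  weight l (fun k => a + h * x k) = h ^- l * weight l x.
Proof.
move=> h0; rewrite /weight mulr_sumr big_nat [RHS]big_nat.
apply: eq_bigr => k /andP[_ kl]; rewrite ddc_affine // normrM.
by rewrite ger0_norm // invr_ge0 exprn_ge0 // ltW.
Qed.

Lemma weight_near_idn (R : realType) (l : nat) :
  \forall x \near near_idn R l, weight l x <= weight l (idn R) + 1.
Proof.
have cw : weight l x @[x --> near_idn R l] --> weight l (idn R).
  apply: cvg_sum_le => k kl; apply: cvg_norm.
  by apply: (@cvg_ddc _ _ _ _ _ _ id) => // i il; exact: cvg_near_idn.
have /cvgrPdist_le /(_ 1 ltr01) := cw.
by apply: filterS => x; rewrite ler_distl => /andP[h _]; rewrite -lerBlDr.
Qed.

Lemma half_le_subn (R : realType) (n w : nat) : (2 * w < n)%N -> n%:R / 2 <= (n - w)%:R :> R.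
Proof. by move=> wn; rewrite ler_pdivrMr // -natrM ler_nat; lia. Qed.

Section covariance_estimates.
Variables (R : realType) (phi : R -> R) (m c L : R) (l : nat).
Hypothesis m_gt0 : 0 < m.
Hypothesis L_ge0 : 0 <= L.
Hypothesis phi_derivable : forall x : R, derivable phi x 1.
Hypothesis phi_slope : forall x, 0 <= x <= 1 -> m <= derive1 phi x <= c.
Hypothesis phi_lip : forall x y, 0 <= x <= 1 -> 0 <= y <= 1 ->
  `|derive1 phi x - derive1 phi y| <= L * `|x - y|.
Hypothesis l_gt0 : (0 < l)%N.
Variables (Kt : R -> R) (beta : nat -> R) (b nu : R) (r : R -> R -> R) (tau Cr delta : R).
Hypothesis b_neq0 : b != 0.
Hypothesis nu_gt0 : 0 < nu.
Hypothesis nu_lt : nu < l%:R.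
Hypothesis KtE : forall x y : R, Kt (x - y) =
  \sum_(0 <= j < (Num.truncn nu).+1) beta j * `|x - y| ^+ (2 * j) + b * G nu `|x - y| + r x y.
Hypothesis tau_gt0 : 0 < tau.
Hypothesis delta_gt0 : 0 < delta.
Hypothesis r_small : forall x y : R, `|x - y| < delta -> `|r x y| <= Cr * `|x - y| `^ (2 * nu + tau).

Local Notation nodes n theta i := (fun k => design phi n (i + theta * k)%N).
Let q : R := 2 * l%:R - 2 * nu.

Lemma q_gt0 : 0 < q.
Proof. by rewrite /q -mulrBr mulr_gt0 // subr_gt0. Qed.

(** The polynomial part of the covariance has degree less than 2 l, since nu <
    l. *)
Lemma bilin_Kt (x : nat -> R) : nodes_up l x ->
  bilin l x x (fun u v => Kt (u - v)) = b * DG l nu x + bilin l x x r.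
Proof.
move=> up; rewrite (eq_bilin (H' := fun u v => (\sum_(0 <= j < (Num.truncn nu).+1)
   beta j * `|u - v| ^+ (2 * j) + b * G nu `|u - v|) + r u v)) => [|k k' _ _]; last exact: KtE.
rewrite bilinD bilinD bilinZ bilin_sum; congr (_ + _).
rewrite [X in X + _]big_nat big1 ?add0r // => j /andP[_ jn].
rewrite bilinZ bilin_even_poly ?mulr0 //.
by apply: (leq_trans jn); rewrite truncn_lt_nat // ltW.
Qed.

Lemma scaled_step_ge (n theta i : nat) : (1 < n)%N -> (0 < i)%N -> (i <= n)%N -> (0 < theta)%N ->
  m / (n%:R - 1) <= theta%:R * step phi n i.
Proof.
move=> n1 i0 iN th0; have /andP[h _] := step_bounds phi_slope n1 i0 iN.
apply: (le_trans h); rewrite ler_peMl ?ler1n //.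
exact/ltW/(step_gt0 m_gt0 phi_slope n1 i0 iN).
Qed.

(** Uniform versions, over all windows, of the scaling of the coefficients and
    of [DG]. *)
Lemma local_bounds (theta : nat) : (0 < theta)%N -> exists2 K : R, 0 < K &
  \forall n \near \oo, forall i, (0 < i)%N -> (i + theta * l <= n)%N ->
    [/\ nodes_up l (nodes n theta i),
        weight l (nodes n theta i) <= K * (n%:R - 1) ^+ l &
        `|DG l nu (nodes n theta i)| <= K * (n%:R - 1) `^ q].
Proof.
move=> th0; pose K1 := m ^- l * (weight l (idn R) + 1).
pose K2 := m `^ (- q) * (2 * `|DG l nu (idn R)|).
have mi0 : 0 <= m ^- l by rewrite invr_ge0 exprn_ge0 // ltW.
have K10 : 0 <= K1 by rewrite mulr_ge0 // addr_ge0 // weight_ge0.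
have K20 : 0 <= K2 by rewrite !mulr_ge0 ?powR_ge0.
exists (K1 + K2 + 1); first by rewrite ltr_wpDl // addr_ge0.
near=> n => i i0 iln.
have n1 : (1 < n)%N by near: n; exact: nbhs_infty_gt.
have [ln H] : (theta * l < n)%N /\ forall i, (0 < i)%N -> (i + theta * l <= n)%N ->
    (weight l (rescaled phi n theta i) <= weight l (idn R) + 1) /\
    (nodes_up l (rescaled phi n theta i) /\ forall v, 0 < v -> v < l%:R ->
      `|DG l v (rescaled phi n theta i) - DG l v (idn R)| <= 1 * `|DG l v (idn R)|).
  near: n; have fI := @filterI _ _ (near_idn_filter R l) _ _ (weight_near_idn R l) (DG_close l_gt0 (@ltr01 R)).
  exact: (rescaled_near m_gt0 L_ge0 phi_derivable phi_slope phi_lip th0 fI).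
have iN : (i <= n)%N by rewrite (leq_trans _ iln) // leq_addr.
have [hw [up hd]] := H i i0 iln.
have s0 := mesh_gt0 R n1.
have hstep := scaled_step_ge n1 i0 iN th0.
have ms0 : 0 < m / (n%:R - 1) by rewrite divr_gt0.
have h0 : 0 < theta%:R * step phi n i by exact: lt_le_trans hstep.
split.
- exact: (design_nodes_up m_gt0 phi_derivable phi_slope n1 th0 i0 iln).
- rewrite (rescaledK m_gt0 phi_slope n1 i0 iN th0) weight_affine //.
  apply: (@le_trans _ _ ((m / (n%:R - 1)) ^- l * (weight l (idn R) + 1))).
    apply: ler_pM => //; rewrite ?weight_ge0 ?invr_ge0 ?exprn_ge0 ?(ltW h0) //.
    by rewrite lef_pV2 ?posrE ?exprn_gt0 // lerXn2r ?nnegrE ?(ltW h0) ?(ltW ms0).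
  rewrite exprMn exprVn invfM invrK mulrAC -/K1.
  apply: ler_wpM2r; first by rewrite exprn_ge0 // ltW.
  by rewrite -addrA lerDl addr_ge0.
rewrite (rescaledK m_gt0 phi_slope n1 i0 iN th0) DG_affine // normrM ger0_norm ?powR_ge0 //.
have -> : 2 * nu - 2 * l%:R = - q by rewrite /q opprB.
apply: (@le_trans _ _ ((m / (n%:R - 1)) `^ (- q) * (2 * `|DG l nu (idn R)|))).
  apply: ler_pM; rewrite ?powR_ge0 //.
    by apply: ler_npowR => //; rewrite oppr_le0 ltW // q_gt0.
  have := hd nu nu_gt0 nu_lt; rewrite mul1r => hd'.
  rewrite -[X in `|X|](subrK (DG l nu (idn R))) (le_trans (ler_normD _ _)) //.
  by rewrite mulr_natl mulr2n lerD2r.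
rewrite powRM ?invr_ge0 ?(ltW m_gt0) ?(ltW s0) // -[(_)^-1]powR_inv1 ?(ltW s0) // -powRrM mulrNN mul1r.
rewrite mulrAC -/K2; apply: ler_wpM2r; first exact: powR_ge0.
by rewrite addrAC lerDr addr_ge0.
Unshelve. all: by end_near. Qed.

(** The windows have diameter O(1/n), where the remainder is O(n^(- 2nu - tau)),
    and the coefficients are O(n^l). *)
Lemma remainder_bound (theta : nat) : (0 < theta)%N -> exists2 K : R, 0 < K &
  \forall n \near \oo, forall i, (0 < i)%N -> (i + theta * l <= n)%N ->
    `|bilin l (nodes n theta i) (nodes n theta i) r| <= K * (n%:R - 1) `^ (q - tau).
Proof.
move=> th0; have [K1 K10 H1] := local_bounds th0.
have c0 := max_slope_gt0 m_gt0 phi_slope.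
pose p := 2 * nu + tau; have p0 : 0 < p by rewrite addr_gt0 // mulr_gt0.
pose K := K1 ^+ 2 * `|Cr| * (c * (theta * l)%:R) `^ p.
have K0 : 0 <= K by rewrite mulr_ge0 ?powR_ge0 // mulr_ge0 // sqr_ge0.
exists (K + 1); first by rewrite ltr_wpDl.
near=> n => i i0 iln.
have n1 : (1 < n)%N by near: n; exact: nbhs_infty_gt.
have s0 := mesh_gt0 R n1.
have [up hw _] : [/\ nodes_up l (nodes n theta i),
    weight l (nodes n theta i) <= K1 * (n%:R - 1) ^+ l &
    `|DG l nu (nodes n theta i)| <= K1 * (n%:R - 1) `^ q].
  by move: i i0 iln; near: n.
set h := c * (theta * l)%:R / (n%:R - 1).
have h0 : 0 <= h by rewrite divr_ge0 ?mulr_ge0 // ltW.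
have hdelta : h < delta.
  rewrite /h ltr_pdivrMr // -ltr_pdivrMl // ltrBrDr.
  by near: n; exact: nbhs_infty_gtr.
have gap k k' : (k <= k')%N -> (k' <= l)%N ->
    `|design phi n (i + theta * k)%N - design phi n (i + theta * k')%N| <= h.
  move=> kk' k'l; rewrite distrC.
  have ikk : (i + theta * k <= i + theta * k')%N by rewrite leq_add2l leq_mul2l kk' orbT.
  have ikn : (i + theta * k' <= n)%N by rewrite (leq_trans _ iln) // leq_add2l leq_mul2l k'l orbT.
  have ik0 : (0 < i + theta * k)%N by rewrite addn_gt0 i0.
  have /andP[a1 a2] := design_increment phi_derivable phi_slope n1 ik0 ikk ikn.
  have nn : 0 <= ((i + theta * k')%:R - (i + theta * k)%:R) / (n%:R - 1) :> R.
    by rewrite divr_ge0 ?(ltW s0) // subr_ge0 ler_nat.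
  rewrite ger0_norm; last by rewrite (le_trans _ a1) // mulr_ge0 // ltW.
  apply: (le_trans a2); rewrite /h -mulrA ler_wpM2l ?(ltW c0) // ler_wpM2r ?invr_ge0 ?(ltW s0) //.
  rewrite lerBlDr -natrD ler_nat addnCA leq_add2l (@leq_trans (theta * l)%N) //.
    by rewrite leq_mul2l k'l orbT.
  exact: leq_addr.
apply: (@le_trans _ _ ((K1 * (n%:R - 1) ^+ l) * (K1 * (n%:R - 1) ^+ l) * (`|Cr| * h `^ p))).
  apply: (@le_trans _ _ (weight l (nodes n theta i) * weight l (nodes n theta i) * (`|Cr| * h `^ p))).
    apply: norm_bilin_le => k k' kl k'l.
    have g : `|design phi n (i + theta * k)%N - design phi n (i + theta * k')%N| <= h.
      have [kk'|/ltnW kk'] := leqP k k'; first exact: gap.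
      by rewrite distrC; exact: gap.
    apply: (le_trans (r_small (le_lt_trans g hdelta))).
    apply: (@le_trans _ _ (`|Cr| * `|design phi n (i + theta * k)%N - design phi n (i + theta * k')%N| `^ p)).
      by apply: ler_wpM2r; [exact: powR_ge0|exact: ler_norm].
    by apply: ler_wpM2l => //; apply: ge0_ler_powR => //; rewrite ltW.
  apply: ler_wpM2r; first by rewrite mulr_ge0 ?powR_ge0.
  by apply: ler_pM => //; exact: weight_ge0.
have -> : (K1 * (n%:R - 1) ^+ l) * (K1 * (n%:R - 1) ^+ l) * (`|Cr| * h `^ p) = K * (n%:R - 1) `^ (q - tau).
  rewrite /h powRM ?invr_ge0 ?(ltW s0) ?mulr_ge0 ?(ltW c0) //.
  rewrite -[(_)^-1]powR_inv1 ?(ltW s0) // -powRrM mulN1r.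
  have -> : q - tau = (2 * l)%:R - p by rewrite /q /p natrM; ring.
  rewrite (@powRD _ (n%:R - 1) (2 * l)%:R (- p)) ?(gt_eqF s0) ?implybT // powR_mulrn ?(ltW s0) // mul2n -addnn exprD /K.
  by move: (_ `^ p) (_ `^ - p) (_ ^+ l) => u v w; ring.
by apply: ler_wpM2r; rewrite ?powR_ge0 // lerDl.
Unshelve. all: by end_near. Qed.

(** The leading term does not vanish ([DG_idn_neq0]), and all windows contribute
    with the same sign. *)
Lemma dd_sum_lower (theta : nat) : (0 < theta)%N -> exists2 k0 : R, 0 < k0 &
  \forall n \near \oo, k0 * n%:R * (n%:R - 1) `^ q <= `|dd_sum phi l n theta nu|.
Proof.
move=> th0; have c0 := max_slope_gt0 m_gt0 phi_slope.
have D0 : 0 < `|DG l nu (idn R)| by rewrite normr_gt0 DG_idn_neq0.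
pose k1 := `|DG l nu (idn R)| / 2 * theta%:R `^ (- q) * c `^ (- q).
have k10 : 0 < k1 by rewrite !mulr_gt0 ?powR_gt0 ?ltr0n.
exists (k1 / 2); first by rewrite divr_gt0.
near=> n.
have n1 : (1 < n)%N by near: n; exact: nbhs_infty_gt.
have ln : (2 * (theta * l) < n)%N by near: n; exact: nbhs_infty_gt.
have s0 := mesh_gt0 R n1.
have cl : forall v : R, 0 < v -> v < l%:R ->
    `|dd_sum phi l n theta v - DG l v (idn R) * (theta%:R `^ (2 * v - 2 * l%:R) * step_sum phi l n theta v)| <=
    2^-1 * `|DG l v (idn R)| * (theta%:R `^ (2 * v - 2 * l%:R) * step_sum phi l n theta v).
  by near: n; exact: (dd_sum_close m_gt0 L_ge0 phi_derivable phi_slope phi_lip l_gt0 th0).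
have {}cl := cl nu nu_gt0 nu_lt.
have lb : (n - theta * l)%:R * (c / (n%:R - 1)) `^ (2 * nu - 2 * l%:R) <= step_sum phi l n theta nu.
  have ln1 : (theta * l < n)%N by rewrite (leq_ltn_trans _ ln) // leq_pmull.
  exact: (step_sum_lower m_gt0 phi_slope n1 ln1 nu_lt).
have nq : 2 * nu - 2 * l%:R = - q by rewrite /q opprB.
rewrite nq in cl lb.
have nn : n%:R / 2 <= (n - theta * l)%:R :> R.
  exact: half_le_subn.
have cs : (c / (n%:R - 1)) `^ (- q) = c `^ (- q) * (n%:R - 1) `^ q.
  by rewrite powRM ?invr_ge0 ?(ltW s0) ?(ltW c0) // -[(_)^-1]powR_inv1 ?(ltW s0) // -powRrM mulrNN mul1r.
rewrite cs in lb.
have SS : n%:R / 2 * (c `^ (- q) * (n%:R - 1) `^ q) <= step_sum phi l n theta nu.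
  by apply: le_trans lb; apply: ler_wpM2r; rewrite ?mulr_ge0 ?powR_ge0.
set W := theta%:R `^ (- q) in cl *; have W0 : 0 < W by rewrite powR_gt0 // ltr0n.
have S0 : 0 <= step_sum phi l n theta nu by apply: sumr_ge0 => i _; exact: powR_ge0.
apply: (@le_trans _ _ (2^-1 * `|DG l nu (idn R)| * (W * step_sum phi l n theta nu))).
  apply: (@le_trans _ _ (2^-1 * `|DG l nu (idn R)| * (W * (n%:R / 2 * (c `^ (- q) * (n%:R - 1) `^ q))))).
    by rewrite /k1 -/W le_eqVlt; apply/orP; left; apply/eqP; ring.
  by rewrite !ler_wpM2l // ?mulr_ge0 // ltW.
have := ler_normB (dd_sum phi l n theta nu)
  (dd_sum phi l n theta nu - DG l nu (idn R) * (W * step_sum phi l n theta nu)).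
rewrite opprB addrC subrK; move: cl.
rewrite [`|DG _ _ _ * _|]normrM (ger0_norm (mulr_ge0 (ltW W0) S0)).
move: (W * _) (dd_sum _ _ _ _ _) `|DG l nu (idn R)| => w e D h1 h2; lra.
Unshelve. all: by end_near. Qed.

Lemma eventually_powR_ge (X p : R) : 0 < p -> \forall n \near \oo, X <= (n%:R - 1) `^ p.
Proof.
move=> p0; near=> n.
apply: (@le_trans _ _ (Num.max X 0)); first by rewrite le_max lexx.
have X0 : 0 <= Num.max X 0 by rewrite le_max lexx orbT.
have -> : Num.max X 0 = (Num.max X 0 `^ p^-1) `^ p.
  by rewrite -powRrM mulVf ?gt_eqF // powRr1.
have h : Num.max X 0 `^ p^-1 <= n%:R - 1.
  by rewrite lerBrDr; apply: ltW; near: n; exact: nbhs_infty_gtr.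
apply: ge0_ler_powR => //; rewrite ?nnegrE ?powR_ge0 //; first exact: ltW.
exact: le_trans (powR_ge0 _ _) h.
Unshelve. all: by end_near. Qed.

Local Notation cov n theta := (dd_cov Kt l (fun i => nodes n theta i.+1)).

(** Only the remainder of the covariance is left, which is smaller than the
    leading term by n^(- tau). *)
Lemma expected_variation_close (theta : nat) (eps : R) : (0 < theta)%N -> 0 < eps ->
  \forall n \near \oo, `|\sum_(0 <= i < n - theta * l) cov n theta i i - b * dd_sum phi l n theta nu|
    <= eps * `|b * dd_sum phi l n theta nu|.
Proof.
move=> th0 e0; have [K K0 HK] := remainder_bound th0; have [k0 k00 Hk] := dd_sum_lower th0.
have b0 : 0 < `|b| by rewrite normr_gt0.
near=> n.
have n1 : (1 < n)%N by near: n; exact: nbhs_infty_gt.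
have ln : (theta * l < n)%N by near: n; exact: nbhs_infty_gt.
have s0 := mesh_gt0 R n1.
have hr : forall i, (0 < i)%N -> (i + theta * l <= n)%N ->
    `|bilin l (nodes n theta i) (nodes n theta i) r| <= K * (n%:R - 1) `^ (q - tau).
  by near: n.
have hk : k0 * n%:R * (n%:R - 1) `^ q <= `|dd_sum phi l n theta nu| by near: n.
have ht : K / (eps * `|b| * k0) <= (n%:R - 1) `^ tau by near: n; exact: eventually_powR_ge.
have -> : \sum_(0 <= i < n - theta * l) cov n theta i i - b * dd_sum phi l n theta nu =
    \sum_(0 <= i < n - theta * l) bilin l (nodes n theta i.+1) (nodes n theta i.+1) r.
  rewrite /dd_sum big_add1 /= mulr_sumr -sumrB [LHS]big_nat [RHS]big_nat.
  apply: eq_bigr => i /andP[_ iN]; rewrite /dd_cov bilin_Kt; first by rewrite addrAC subrr add0r.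
  by apply: (design_nodes_up m_gt0 phi_derivable phi_slope n1 th0) => //; rewrite addSn addnC -ltn_subRL.
rewrite normrM mulrA; apply: (@le_trans _ _ (eps * `|b| * (k0 * n%:R * (n%:R - 1) `^ q))); last first.
  by apply: ler_wpM2l => //; rewrite mulr_ge0 // ltW.
apply: (@le_trans _ _ (\sum_(0 <= i < n - theta * l) K * (n%:R - 1) `^ (q - tau))).
  apply: le_trans (ler_norm_sum _ _ _) _; rewrite big_nat [leRHS]big_nat.
  by apply: ler_sum => i /andP[_ iN]; apply: hr => //; rewrite addSn addnC -ltn_subRL.
rewrite sumr_const_nat subn0 -[X in X <= _]mulr_natl.
have st : 0 < (n%:R - 1) `^ tau by exact: powR_gt0.
have hK : K * (n%:R - 1) `^ (- tau) <= eps * `|b| * k0.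
  rewrite powRN ler_pdivrMr // -ler_pdivrMl ?mulr_gt0 //.
  by rewrite mulrC.
have -> : K * (n%:R - 1) `^ (q - tau) = (K * (n%:R - 1) `^ (- tau)) * (n%:R - 1) `^ q.
  by rewrite (@powRD _ (n%:R - 1) q (- tau)) ?(gt_eqF s0) ?implybT //; ring.
have nn : (n - theta * l)%:R <= n%:R :> R by rewrite ler_nat leq_subr.
have sq : 0 <= (n%:R - 1) `^ q by exact: powR_ge0.
apply: (@le_trans _ _ (n%:R * (eps * `|b| * k0 * (n%:R - 1) `^ q))).
  apply: ler_pM => //; last exact: ler_wpM2r.
  by apply: mulr_ge0 => //; apply: mulr_ge0; [exact: ltW|exact: powR_ge0].
by rewrite le_eqVlt; apply/orP; left; apply/eqP; ring.
Unshelve. all: by end_near. Qed.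

Hypothesis phi0 : phi 0 = 0.
Hypothesis phi1 : phi 1 = 1.
Hypothesis cov_le_diag : forall (N : nat) (x : nat -> nat -> R),
  (forall i, (i < N)%N -> nodes_up l (x i)) ->
  forall i j, (i < N)%N -> (j < N)%N ->
    `|dd_cov Kt l x i j| <= (dd_cov Kt l x i i + dd_cov Kt l x j j) / 2.
Hypothesis Kt_derive : forall j, (j < 2 * l)%N -> forall t : R, 0 < t -> t <= 1 ->
  is_derive t 1 (derive1n j Kt) (derive1n j.+1 Kt t).
Variable CK : R.
Hypothesis Kt_bound : forall t : R, 0 < t -> t <= 1 ->
  `|derive1n (2 * l) Kt t| <= CK * t `^ (2 * nu - 2 * l%:R).

Lemma design01 (n i : nat) : (1 < n)%N -> (0 < i)%N -> (i <= n)%N -> 0 <= design phi n i <= 1.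
Proof.
move=> n1 i0 iN; have s0 := mesh_gt0 R n1.
have d1 : design phi n 1 = 0 by rewrite /design subrr mul0r.
have dn : design phi n n = 1 by rewrite /design divff // gt_eqF.
have inc a a' : (0 < a)%N -> (a <= a')%N -> (a' <= n)%N -> design phi n a <= design phi n a'.
  move=> a0; rewrite leq_eqVlt => /predU1P[->//|aa] an.
  exact/ltW/(design_increasing m_gt0 phi_derivable phi_slope n1).
by rewrite -{1}d1 -{1}dn !inc // ltnW.
Qed.

Lemma diagonal_bound (theta : nat) : (0 < theta)%N -> exists2 K : R, 0 < K &
  \forall n \near \oo, forall i, (i < n - theta * l)%N -> `|cov n theta i i| <= K * (n%:R - 1) `^ q.
Proof.
move=> th0; have [K1 K10 H1] := local_bounds th0; have [K2 K20 H2] := remainder_bound th0.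
exists (`|b| * K1 + K2); first by rewrite ltr_wpDl // mulr_ge0 // ltW.
near=> n => i iN.
have n2 : (2 < n)%N by near: n; exact: nbhs_infty_gt.
have n1 := ltnW n2; have s0 := mesh_gt0 R n1.
have s1 : 1 <= n%:R - 1 :> R by rewrite lerBrDr (_ : 1 + 1 = 2%:R) // ler_nat ltnW.
have iln : (i.+1 + theta * l <= n)%N by rewrite addSn addnC -ltn_subRL.
have [up _ hD] : [/\ nodes_up l (nodes n theta i.+1),
    weight l (nodes n theta i.+1) <= K1 * (n%:R - 1) ^+ l &
    `|DG l nu (nodes n theta i.+1)| <= K1 * (n%:R - 1) `^ q].
  by move: i.+1 (ltn0Sn i) iln; near: n.
have hr : `|bilin l (nodes n theta i.+1) (nodes n theta i.+1) r| <= K2 * (n%:R - 1) `^ (q - tau).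
  by move: i.+1 (ltn0Sn i) iln; near: n.
rewrite /dd_cov bilin_Kt // mulrDl (le_trans (ler_normD _ _)) // lerD //.
  by rewrite normrM -mulrA ler_wpM2l.
apply: (le_trans hr); apply: ler_wpM2l; first exact: ltW.
by apply: ler_powR => //; rewrite lerBlDr lerDl ltW.
Unshelve. all: by end_near. Qed.

(** The covariance function is smooth at the lags between the two windows, and
    its derivative of order 2 l is evaluated at a lag comparable to their
    distance. *)
Lemma far_covariance_bound (theta n i j : nat) : (1 < n)%N -> (0 < theta)%N ->
  (j + 2 * (theta * l) <= i)%N -> (i < n - theta * l)%N ->
  `|cov n theta i j| <= `|CK| * ((m / 4) `^ (- q) * (n%:R - 1) `^ q * ((i - j).+1)%:R `^ (- q)).
Proof.
move=> n1 th0 ij iN; have s0 := mesh_gt0 R n1.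
have tl0 : (0 < theta * l)%N by rewrite muln_gt0 th0.
have iln : (i.+1 + theta * l <= n)%N by rewrite addSn addnC -ltn_subRL.
have jln : (j.+1 + theta * l <= i.+1)%N.
  by move: (theta * l)%N ij => w; clear; lia.
have upi := design_nodes_up m_gt0 phi_derivable phi_slope n1 th0 (ltn0Sn i) iln.
have iN' : (i.+1 <= n)%N by rewrite (leq_trans _ iln) // leq_addr.
have upj := design_nodes_up m_gt0 phi_derivable phi_slope n1 th0 (ltn0Sn j) (leq_trans jln iN').
set x := nodes n theta i.+1 in upi; set y := nodes n theta j.+1 in upj.
(* The windows are at least m (i - j - theta l) / (n - 1) apart, and i - j >= 2
   theta l makes this at least g. *)
pose g := m / 4 * (((i - j).+1)%:R / (n%:R - 1)).
have g0 : 0 < g by rewrite mulr_gt0 ?divr_gt0.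
have gx : g <= x 0%N - y l.
  rewrite /x /y muln0 addn0.
  have /andP[h _] := design_increment phi_derivable phi_slope n1 (ltn0Sn _ : (0 < j.+1 + theta * l)%N) jln iN'.
  apply: le_trans h; rewrite /g -mulrA; apply: ler_wpM2l; first exact: ltW.
  rewrite mulrA; apply: ler_wpM2r; first by rewrite invr_ge0 ltW.
  rewrite mulrC ler_pdivrMr // -natrB // -natrM ler_nat.
  by move: (theta * l)%N ij tl0 => w; clear; lia.
have x1 : x l - y 0%N <= 1.
  have /andP[_ h1] := design01 n1 (ltn0Sn _ : (0 < i.+1 + theta * l)%N) iln.
  have y0n : (j.+1 + theta * 0 <= n)%N.
    by rewrite muln0 addn0 (leq_trans _ iN') // (leq_trans _ jln) // leq_addr.
  have /andP[h2 _] := design01 n1 (ltn0Sn _ : (0 < j.+1 + theta * 0)%N) y0n.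
  by rewrite lerBlDr (le_trans h1) // lerDl.
have [z /andP[z1 z2] e] := @bilin_difference_mvt R l x y (fun k => derive1n k Kt) upi upj
  (fun k kl z hz => Kt_derive kl (lt_le_trans g0 (le_trans gx (proj1 (andP hz))))
     (le_trans (proj2 (andP hz)) x1)).
have z0 : 0 < z by exact: lt_le_trans g0 (le_trans gx z1).
have gz : g <= z by exact: le_trans gx z1.
rewrite (_ : `|cov n theta i j| = `|derive1n (2 * l) Kt z|); last exact: e.
apply: (le_trans (Kt_bound z0 (le_trans z2 x1))).
have -> : 2 * nu - 2 * l%:R = - q by rewrite /q opprB.
apply: (@le_trans _ _ (`|CK| * z `^ (- q))).
  by apply: ler_wpM2r; [exact: powR_ge0|exact: ler_norm].
apply: ler_wpM2l => //.
apply: (@le_trans _ _ (g `^ (- q))).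
  by apply: ler_npowR => //; rewrite oppr_le0 ltW // q_gt0.
have m4 : 0 <= m / 4 by rewrite divr_ge0 // ltW.
have s1 : 0 <= (n%:R - 1)^-1 :> R by rewrite invr_ge0 ltW.
have as0 : 0 <= ((i - j).+1)%:R / (n%:R - 1) :> R by rewrite mulr_ge0.
have -> : g `^ (- q) = (m / 4) `^ (- q) * (((i - j).+1)%:R / (n%:R - 1)) `^ (- q).
  by rewrite /g -powRM.
have -> : (((i - j).+1)%:R / (n%:R - 1)) `^ (- q) =
    ((i - j).+1)%:R `^ (- q) * (n%:R - 1)^-1 `^ (- q) by rewrite -powRM.
rewrite -[(n%:R - 1)^-1]powR_inv1 ?(ltW s0) // -powRrM mulrNN mul1r.
by rewrite [X in _ * X <= _]mulrC mulrA.
Qed.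

(** Windows that are far apart are covered by [far_covariance_bound]; for the
    others, whose distance is bounded, the variances suffice. *)
Lemma covariance_decay (theta : nat) : (0 < theta)%N -> exists2 K : R, 0 < K &
  \forall n \near \oo, forall i j, (j <= i)%N -> (i < n - theta * l)%N ->
    `|cov n theta i j| <= K * (n%:R - 1) `^ q * ((i - j).+1)%:R `^ (- q).
Proof.
move=> th0; have [K1 K10 H1] := diagonal_bound th0.
pose w : R := (2 * (theta * l))%:R.
have w1 : 1 <= w by rewrite ler1n !muln_gt0 /= th0.
pose K2 := `|CK| * (m / 4) `^ (- q).
have K20 : 0 <= K2 by rewrite mulr_ge0 ?powR_ge0.
have K30 : 0 <= K1 * w `^ q by rewrite mulr_ge0 ?powR_ge0 // ltW.
exists (K1 * w `^ q + K2 + 1); first by rewrite ltr_wpDl // addr_ge0.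
near=> n => i j ji iN.
have n1 : (1 < n)%N by near: n; exact: nbhs_infty_gt.
have s0 := mesh_gt0 R n1.
set a : R := ((i - j).+1)%:R.
have sa : 0 <= (n%:R - 1) `^ q * a `^ (- q) by rewrite mulr_ge0 ?powR_ge0.
have [far|near] := leqP (j + 2 * (theta * l)) i.
  apply: (le_trans (far_covariance_bound n1 th0 far iN)); rewrite -/a.
  rewrite [X in X <= _](_ : _ = K2 * ((n%:R - 1) `^ q * a `^ (- q))); last by rewrite /K2; ring.
  rewrite -[X in _ <= X]mulrA; apply: ler_wpM2r => //.
  by rewrite addrAC lerDr addr_ge0.
(* Here i - j + 1 <= w, so that the gap factor is at least w^(- q). *)
have hd : forall i, (i < n - theta * l)%N -> `|cov n theta i i| <= K1 * (n%:R - 1) `^ q by near: n.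
have jN : (j < n - theta * l)%N by exact: leq_ltn_trans ji iN.
have up k : (k < n - theta * l)%N -> nodes_up l (nodes n theta k.+1).
  move=> kN; apply: (design_nodes_up m_gt0 phi_derivable phi_slope n1 th0) => //.
  by rewrite addSn addnC -ltn_subRL.
have a1 : a <= w.
  by rewrite ler_nat; move: (2 * (theta * l))%N near ji => v; clear; lia.
have a0 : 0 < a by rewrite ltr0n.
have wa : 1 <= w `^ q * a `^ (- q).
  rewrite powRN ler_pdivlMr ?powR_gt0 // mul1r.
  by apply: ge0_ler_powR; rewrite ?nnegrE ?(ltW a0) ?(ltW q_gt0) // (le_trans _ w1).
apply: (@le_trans _ _ (K1 * (n%:R - 1) `^ q)).
  apply: (le_trans (cov_le_diag up iN jN)).
  rewrite ler_pdivrMr // mulr_natr mulr2n; apply: lerD.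
    exact: le_trans (ler_norm _) (hd _ iN).
  exact: le_trans (ler_norm _) (hd _ jN).
apply: (@le_trans _ _ (K1 * w `^ q * ((n%:R - 1) `^ q * a `^ (- q)))).
  rewrite [leRHS](_ : _ = K1 * (n%:R - 1) `^ q * (w `^ q * a `^ (- q))); last by ring.
  by rewrite ler_peMr // mulr_ge0 ?powR_ge0 // ltW.
rewrite -[X in _ <= X]mulrA; apply: ler_wpM2r => //.
by rewrite -addrA lerDl addr_ge0.
Unshelve. all: by end_near. Qed.

End covariance_estimates.

(** * Frobenius norm of a decaying covariance *)

Lemma powRD_gt0 (R : realType) (a p q : R) : 0 < a -> a `^ (p + q) = a `^ p * a `^ q.
Proof. by move=> a0; rewrite powRD // (gt_eqF a0) implybT. Qed.

(** (1 + 1/n)^kap <= 1 + 1/(2n), as kap <= 1/2. *)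
Lemma powR_increment (R : realType) (n : nat) (kap : R) : (0 < n)%N -> 0 < kap -> kap <= 2^-1 ->
  2 * n%:R `^ (1 - kap) + n.+1%:R `^ (- kap) <= 2 * n.+1%:R `^ (1 - kap).
Proof.
move=> n0 k0 k2.
have N0 : 0 < n%:R :> R by rewrite ltr0n.
have N1 : 0 < n.+1%:R :> R by rewrite ltr0n.
rewrite !powRD_gt0 // !powRr1 ?(ltW N0) ?(ltW N1) //.
have S : n.+1%:R = n%:R + 1 :> R by rewrite -natr1.
set a := n%:R `^ (- kap); set c := n.+1%:R `^ (- kap).
have c0 : 0 < c by exact: powR_gt0.
have ac : a <= c * (1 + (2 * n%:R)^-1).
  have -> : a = c * (1 + n%:R^-1) `^ kap.
    have e1 : n.+1%:R = n%:R * (1 + n%:R^-1) :> R by rewrite S mulrDr mulr1 divff // gt_eqF.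
    have h0 : 0 <= 1 + n%:R^-1 :> R by rewrite addr_ge0 // invr_ge0 ltW.
    by rewrite /a /c e1 powRM ?(ltW N0) // -mulrA -powRD_gt0 ?addNr ?powRr0 ?mulr1 //.
  apply: ler_wpM2l; first exact: ltW.
  apply: (@le_trans _ _ ((1 + n%:R^-1) `^ (2^-1))).
    by apply: ler_powR => //; rewrite lerDl invr_ge0 ltW.
  have p0 : 0 <= 1 + n%:R^-1 :> R by rewrite addr_ge0 // invr_ge0 ltW.
  have q0 : 0 <= 1 + (2 * n%:R)^-1 :> R by rewrite addr_ge0 // invr_ge0 mulr_ge0 // ltW.
  rewrite powR12_sqrt // -ler_sqr ?nnegrE ?sqrtr_ge0 // sqr_sqrtr //.
  rewrite sqrrD expr1n mul1r -addrA lerD2l.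
  have -> : (2 * n%:R)^-1 *+ 2 = n%:R^-1 :> R by rewrite -mulr_natr; field; rewrite gt_eqF.
  by rewrite lerDl sqr_ge0.
apply: (@le_trans _ _ (2 * (n%:R * (c * (1 + (2 * n%:R)^-1))) + c)).
  by rewrite lerD2r ler_pM2l // ler_pM2l.
rewrite S le_eqVlt; apply/orP; left; apply/eqP; field.
by rewrite gt_eqF.
Qed.

Lemma sum_powR_le (R : realType) (n : nat) (kap : R) : 0 < kap -> kap <= 2^-1 ->
  \sum_(0 <= k < n) k.+1%:R `^ (- kap) <= 2 * n%:R `^ (1 - kap).
Proof.
move=> k0 k2; elim: n => [|[|n] IH]; first by rewrite big_geq // mulr_ge0 ?powR_ge0.
  by rewrite big_nat1 !powR1 mulr1 ler1n.
rewrite big_nat_recr //=; apply: le_trans (powR_increment (ltn0Sn n) k0 k2).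
by rewrite lerD2r.
Qed.

(** Each row is bounded by the two one-sided sums of a. *)
Lemma sum_by_gap_le (R : realType) (N : nat) (f : nat -> nat -> R) (a : nat -> R) :
  (forall k, 0 <= a k) -> (forall i j, f i j = f j i) ->
  (forall i j, (j <= i)%N -> (i < N)%N -> f i j <= a (i - j)%N) ->
  \sum_(0 <= i < N) \sum_(0 <= j < N) f i j <= N%:R * (2 * \sum_(0 <= k < N) a k).
Proof.
move=> a0 fsym fa.
pose low i j := if (j <= i)%N then a (i - j)%N else 0.
have low0 i j : 0 <= low i j by rewrite /low; case: ifP.
have f_low i j : (i < N)%N -> (j < N)%N -> f i j <= low i j + low j i.
  move=> iN jN; have [ji|ij] := leqP j i.
    by rewrite (le_trans (fa _ _ ji iN)) // /low ji lerDl low0.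
  by rewrite fsym (le_trans (fa _ _ (ltnW ij) jN)) // {2}/low (ltnW ij) lerDr low0.
have row i : (i < N)%N -> \sum_(0 <= j < N) low i j <= \sum_(0 <= k < N) a k.
  move=> iN; rewrite (big_cat_nat (leq0n i.+1) iN) /=.
  rewrite [X in _ + X <= _](_ : _ = 0) ?addr0; last first.
    by rewrite big_nat big1 // => j /andP[ij _]; rewrite /low leqNgt ij.
  rewrite big_nat_rev /= add0n [X in _ <= X](big_cat_nat (leq0n i.+1) iN) /=.
  apply: ler_wpDr; first by apply: sumr_ge0 => k _.
  rewrite big_nat [leRHS]big_nat; apply: ler_sum => k /andP[_ ki].
  by rewrite /low subSS leq_subr subKn.
have low_sum : \sum_(0 <= i < N) \sum_(0 <= j < N) low i j <= N%:R * \sum_(0 <= k < N) a k.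
  apply: (@le_trans _ _ (\sum_(0 <= i < N) \sum_(0 <= k < N) a k)).
    by rewrite big_nat [leRHS]big_nat; apply: ler_sum => i /andP[_ iN]; exact: row.
  by rewrite sumr_const_nat subn0 mulr_natl.
apply: (@le_trans _ _ (\sum_(0 <= i < N) \sum_(0 <= j < N) (low i j + low j i))).
  rewrite big_nat [leRHS]big_nat; apply: ler_sum => i /andP[_ iN].
  by rewrite big_nat [leRHS]big_nat; apply: ler_sum => j /andP[_ jN]; exact: f_low.
under eq_bigr do rewrite big_split.
rewrite big_split /= [X in _ + X]exchange_big /= mulrCA mulr2n mulrDl mul1r.
exact: lerD.
Qed.

Lemma sq_norm_le (R : realType) (N n : nat) (S : nat -> nat -> R) (A q kap : R) :
  (N <= n)%N -> (0 < n)%N -> 0 <= A -> 0 < kap -> kap <= 2^-1 -> kap <= 2 * q ->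
  (forall i j, S i j = S j i) ->
  (forall i j, (j <= i)%N -> (i < N)%N -> `|S i j| <= A * ((i - j).+1)%:R `^ (- q)) ->
  sq_norm N 0 S <= (2 * A * n%:R `^ (1 - kap / 2)) ^+ 2.
Proof.
move=> Nn n0 A0 k0 k2 kq Ssym SA; rewrite /sq_norm.
have H := @sum_by_gap_le R N (fun i j => S i j ^+ 2) (fun k => A ^+ 2 * k.+1%:R `^ (- kap)).
apply: (le_trans (H _ _ _)).
- by move=> k; rewrite mulr_ge0 ?sqr_ge0 ?powR_ge0.
- by move=> i j; rewrite Ssym.
- move=> i j ji iN; set a : R := ((i - j).+1)%:R.
  have a1 : 1 <= a by rewrite ler1n.
  rewrite -real_normK ?num_real //.
  apply: (@le_trans _ _ ((A * a `^ (- q)) ^+ 2)).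
    by rewrite ler_sqr ?nnegrE ?mulr_ge0 ?powR_ge0 // SA.
  rewrite exprMn; apply: ler_wpM2l; first exact: sqr_ge0.
  rewrite expr2 -powRD_gt0 ?(lt_le_trans ltr01) //.
  by apply: ler_powR => //; lra.
have N0 : 0 <= n%:R :> R by [].
rewrite -mulr_sumr; apply: (@le_trans _ _ (n%:R * (2 * (A ^+ 2 * (2 * n%:R `^ (1 - kap)))))).
  apply: ler_pM; rewrite ?mulr_ge0 ?sqr_ge0 ?ler_nat //.
    by apply: sumr_ge0 => k _; exact: powR_ge0.
  rewrite ler_pM2l //; apply: ler_wpM2l; first exact: sqr_ge0.
  apply: (le_trans (sum_powR_le N k0 k2)); rewrite ler_pM2l //.
  apply: ge0_ler_powR; rewrite ?nnegrE ?ler_nat //; lra.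
have nn : 0 < n%:R :> R by rewrite ltr0n.
rewrite !exprMn [_ `^ _ ^+ 2]expr2 -powRD_gt0 //.
have -> : 1 - kap / 2 + (1 - kap / 2) = 1 + (1 - kap) by field.
rewrite (powRD_gt0 1 (1 - kap) nn) powRr1 //.
by rewrite le_eqVlt; apply/orP; left; apply/eqP; ring.
Qed.

(** * Almost sure convergence of the variations *)

(** A stretched exponential decays faster than n^(-2); the form of the bound
    makes the series telescope. *)
Lemma exp_powR_summable (R : realType) (c del C : R) : 0 < c -> 0 < del -> 0 <= C ->
  exists2 B : R, 0 <= B & forall n : nat, (0 < n)%N ->
    C * expR (- (c * n%:R `^ del)) <= B / (n.+1%:R * n.+2%:R).
Proof.
move=> c0 d0 C0.
(* With k del >= 2, the k-th power of n^del dominates n^2; and (n + 1) (n + 2)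
   <= 6 n^2. *)
have [k k0] : exists k : nat, 2 / del < k%:R.
  exists (Num.truncn (2 / del)).+1; exact: truncnS_gt.
have kp : 0 < k%:R :> R by apply: lt_trans k0; rewrite divr_gt0.
have ck : 0 < (c / k%:R) ^+ k by rewrite exprn_gt0 // divr_gt0.
exists (6 * C / (c / k%:R) ^+ k); first by rewrite divr_ge0 ?mulr_ge0 // ltW.
move=> n n0; have N1 : 1 <= n%:R :> R by rewrite ler1n.
have N0 : 0 < n%:R :> R by exact: lt_le_trans N1.
have E : (c / k%:R) ^+ k * n%:R ^+ 2 <= expR (c * n%:R `^ del).
  have -> : c * n%:R `^ del = (c * n%:R `^ del / k%:R) *+ k.
    by rewrite -[RHS]mulr_natr divfK // gt_eqF.
  rewrite -[X in expR X]mulr_natl expRM_natl.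
  apply: (@le_trans _ _ ((c * n%:R `^ del / k%:R) ^+ k)); last first.
    rewrite lerXn2r ?nnegrE ?expR_ge0 //; first by rewrite mulr_ge0 ?mulr_ge0 ?powR_ge0 ?invr_ge0 // ltW.
    by apply: le_trans (expR_ge1Dx _); rewrite lerDr.
  rewrite [X in _ <= X ^+ _]mulrAC [X in _ <= X]exprMn; apply: ler_wpM2l; first exact: ltW.
  rewrite -[X in _ <= X]powR_mulrn ?powR_ge0 // -powRrM -powR_mulrn ?(ltW N0) //.
  by apply: ler_powR => //; rewrite mulrC -ler_pdivrMr // ltW.
have E0 : 0 < (c / k%:R) ^+ k * n%:R ^+ 2 by rewrite mulr_gt0 // exprn_gt0.
have P0 : 0 < n.+1%:R * n.+2%:R :> R by rewrite mulr_gt0.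
rewrite expRN; apply: (@le_trans _ _ (C * ((c / k%:R) ^+ k * n%:R ^+ 2)^-1)).
  by apply: ler_wpM2l => //; rewrite lef_pV2 ?posrE ?expR_gt0.
rewrite invfM mulrA -[X in _ <= X]mulrA [6 * C]mulrC -!mulrA; apply: ler_wpM2l => //.
rewrite mulrCA; apply: ler_wpM2l; first by rewrite invr_ge0 ltW.
rewrite ler_pdivlMr // mulrC ler_pdivrMr ?exprn_gt0 // -!natrX -!natrM ler_nat.
by move: n0; clear; rewrite -mulnn; nia.
Qed.

(** The Borel-Cantelli lemma, with the telescoping bound of [exp_powR_summable]. *)
Lemma ae_eventually_not (R : realType) (d : measure_display) (T : measurableType d)
    (P : probability T R) (A : nat -> set T) (B : R) : 0 <= B ->
  (forall n, measurable (A n)) ->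
  (\forall n \near \oo, (P (A n) <= (B / (n.+1%:R * n.+2%:R))%:E)%E) ->
  {ae P, forall w, \forall n \near \oo, ~ A n w}.
Proof.
move=> B0 mA [n0 _ Hn].
pose F k := A (n0 + k)%N.
have PF k : (P (F k) <= (B / (k.+1%:R * k.+2%:R))%:E)%E.
  apply: (le_trans (Hn (n0 + k)%N (leq_addr _ _))); rewrite lee_fin.
  apply: ler_wpM2l => //; rewrite lef_pV2 ?posrE ?mulr_gt0 // ler_pM // ler_nat ltnS ?ltnS; exact: leq_addl.
have mF k : measurable (F k) by exact: mA.
have sumP : (\sum_(0 <= k <oo) P (F k) < +oo)%E.
  apply: (@le_lt_trans _ _ B%:E); last exact: ltry.
  apply: lime_le; first by apply: is_cvg_nneseries => k _ _; exact: measure_ge0.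
  apply: nearW => K; apply: (@le_trans _ _ (\sum_(0 <= k < K) (B / (k.+1%:R * k.+2%:R))%:E)%E).
    by apply: lee_sum => k _; exact: PF.
  rewrite sumEFin lee_fin.
  have -> : \sum_(0 <= k < K) B / (k.+1%:R * k.+2%:R) = B * (1 - K.+1%:R^-1).
    elim: K => [|K IH]; first by rewrite big_geq // invr1 subrr mulr0.
    rewrite big_nat_recr //= IH -mulrDr; congr (_ * _).
    have -> : K.+2%:R = K.+1%:R + 1 :> R by rewrite -natr1.
    by field; rewrite !gt_eqF // addr_gt0.
  by rewrite ler_piMr // gerBl invr_ge0.
have P0 := lim_sup_set_cvg0 mF sumP.
exists (lim_sup_set F); split => //.
  by apply: bigcap_measurable => // k _; apply: bigcup_measurable => j _.
move=> w /= nw n _; apply: contrapT => h; apply: nw.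
exists (n0 + n)%N => // j /= nj Aj; apply: h.
exists (j - n0)%N => /=; first by rewrite leq_subRL // (leq_trans _ nj) // leq_addr.
by rewrite /F subnKC // (leq_trans _ nj) // leq_addr.
Qed.

Section variation_consistency.
Variables (R : realType) (d : measure_display) (T : measurableType d).
Variables (P : probability T R) (X : R -> {RV P >-> R}) (mu : R) (Kt : R -> R).
Hypothesis hgauss : gaussian_process X.
Hypothesis hmean : forall x : R, ('E_P[X x] = mu%:E)%E.
Hypothesis hcov : forall x y : R, (covariance P (X x) (X y) = (Kt (x - y))%:E)%E.
Variables (phi : R -> R) (m c L : R) (l : nat).
Hypothesis m_gt0 : 0 < m.
Hypothesis L_ge0 : 0 <= L.
Hypothesis phi_derivable : forall x : R, derivable phi x 1.
Hypothesis phi_slope : forall x, 0 <= x <= 1 -> m <= derive1 phi x <= c.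
Hypothesis phi_lip : forall x y, 0 <= x <= 1 -> 0 <= y <= 1 ->
  `|derive1 phi x - derive1 phi y| <= L * `|x - y|.
Hypothesis l_gt0 : (0 < l)%N.
Variables (beta : nat -> R) (b nu : R) (r : R -> R -> R) (tau Cr delta CK : R).
Hypothesis b_neq0 : b != 0.
Hypothesis nu_gt0 : 0 < nu.
Hypothesis nu_lt : nu < l%:R.
Hypothesis KtE : forall x y : R, Kt (x - y) =
  \sum_(0 <= j < (Num.truncn nu).+1) beta j * `|x - y| ^+ (2 * j) + b * G nu `|x - y| + r x y.
Hypothesis tau_gt0 : 0 < tau.
Hypothesis delta_gt0 : 0 < delta.
Hypothesis r_small : forall x y : R, `|x - y| < delta -> `|r x y| <= Cr * `|x - y| `^ (2 * nu + tau).
Hypothesis phi0 : phi 0 = 0.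
Hypothesis phi1 : phi 1 = 1.
Hypothesis Kt_derive : forall j, (j < 2 * l)%N -> forall t : R, 0 < t -> t <= 1 ->
  is_derive t 1 (derive1n j Kt) (derive1n j.+1 Kt t).
Hypothesis Kt_bound : forall t : R, 0 < t -> t <= 1 ->
  `|derive1n (2 * l) Kt t| <= CK * t `^ (2 * nu - 2 * l%:R).

Local Notation nodes n theta := (fun i k => design phi n (i.+1 + theta * k)%N).
Local Notation V n theta w :=
  (quad_var (design phi n) n theta l (fun i => X (design phi n i) w)).

Lemma quad_varE (n theta : nat) (w : T) :
  V n theta w = \sum_(0 <= i < n - theta * l) ddX X l (nodes n theta) i w ^+ 2.
Proof. by rewrite /quad_var big_add1. Qed.

(** The Frobenius norm is at most a constant times n^(- kap/2) times the mean,
    so that the exponent in the tail bound is at least a constant times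
    n^(kap/2). *)
Lemma variation_tail (theta : nat) (eps : R) : (0 < theta)%N -> 0 < eps ->
  exists2 B : R, 0 <= B & \forall n \near \oo,
    (P [set w | (eps * `|b * dd_sum phi l n theta nu| <=
       `|V n theta w - \sum_(0 <= i < n - theta * l) dd_cov Kt l (nodes n theta) i i|)%R] <=
     (B / (n.+1%:R * n.+2%:R))%:E)%E.
Proof.
move=> th0 e0.
have cov_diag (N : nat) (x : nat -> nat -> R) (xup : forall i, (i < N)%N -> nodes_up l (x i)) :=
  dd_cov_le_diag hgauss hmean hcov l_gt0 xup.
have [K K0 HK] := covariance_decay m_gt0 L_ge0 phi_derivable phi_slope phi_lip l_gt0
  nu_gt0 nu_lt KtE tau_gt0 delta_gt0 r_small phi0 phi1 cov_diag Kt_derive Kt_bound th0.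
have [k0 k00 Hk] := dd_sum_lower m_gt0 L_ge0 phi_derivable phi_slope phi_lip l_gt0 nu_gt0 nu_lt th0.
set q := 2 * l%:R - 2 * nu in HK Hk.
have q0 : 0 < q by exact: q_gt0.
(* The squared covariances decay with exponent 2 q; [sum_powR_le] needs an
   exponent at most 1/2. *)
pose kap : R := Num.min (2 * q) 2^-1.
have kap0 : 0 < kap by rewrite lt_min mulr_gt0 //= invr_gt0.
have kap2 : kap <= 2^-1 by rewrite ge_min lexx orbT.
have kapq : kap <= 2 * q by rewrite ge_min lexx.
have b0 : 0 < `|b| by rewrite normr_gt0.
pose c1 := eps * `|b| * k0 / (32 * K).
have c10 : 0 < c1 by rewrite divr_gt0 ?mulr_gt0.
have kaph : 0 < kap / 2 by rewrite divr_gt0.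
have [B B0 HB] := exp_powR_summable c10 kaph (mulr_ge0 (ler0n R 2) (expR_ge0 64^-1)).
exists B => //; near=> n.
have n1 : (1 < n)%N by near: n; exact: nbhs_infty_gt.
have n0 := ltnW n1; have s0 := mesh_gt0 R n1; have N0 : 0 < n%:R :> R by rewrite ltr0n.
have sq0 : 0 < (n%:R - 1) `^ q by exact: powR_gt0.
have hK : forall i j, (j <= i)%N -> (i < n - theta * l)%N ->
    `|dd_cov Kt l (nodes n theta) i j| <= K * (n%:R - 1) `^ q * ((i - j).+1)%:R `^ (- q).
  by near: n.
have hk : k0 * n%:R * (n%:R - 1) `^ q <= `|dd_sum phi l n theta nu| by near: n.
have xup i : (i < n - theta * l)%N -> nodes_up l (nodes n theta i).
  move=> iN; apply: (design_nodes_up m_gt0 phi_derivable phi_slope n1 th0) => //.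
  by rewrite addSn addnC -ltn_subRL.
have A0 : 0 <= K * (n%:R - 1) `^ q by rewrite mulr_ge0 // ltW.
have SF := sq_norm_le (leq_subr (theta * l) n) n0 A0 kap0 kap2 kapq
  (dd_cov_sym hcov l (nodes n theta)) hK.
set F := 2 * (K * (n%:R - 1) `^ q) * n%:R `^ (1 - kap / 2) in SF.
have F0 : 0 < F by rewrite /F !mulr_gt0 ?powR_gt0.
under eq_set do rewrite quad_varE.
apply: (le_trans (dd_tail hgauss hmean hcov l_gt0 xup _ F0 SF)).
apply: (@le_trans _ _ (2 * expR 64^-1 * expR (- (c1 * n%:R `^ (kap / 2))))%:E); last first.
  by rewrite lee_fin; exact: HB.
rewrite lee_fin -[X in _ <= X]mulrA ler_pM2l // -expRD ler_expR lerD2l lerN2.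
rewrite ler_pdivlMr; last by rewrite mulr_gt0.
apply: (@le_trans _ _ (eps * `|b| * (k0 * n%:R * (n%:R - 1) `^ q))); last first.
  by rewrite normrM [X in _ <= X]mulrA ler_wpM2l // mulr_ge0 // ltW.
rewrite /F (powRD_gt0 1 (- (kap / 2)) N0) powRr1 ?(ltW N0) // powRN.
have pk : n%:R `^ (kap / 2) != 0 by rewrite gt_eqF // powR_gt0.
rewrite le_eqVlt; apply/orP; left; apply/eqP; rewrite /c1.
move: (_ `^ (kap / 2)) pk (_ `^ q) => u u0 v; field.
by rewrite u0 gt_eqF.
Unshelve. all: by end_near. Qed.

Lemma measurable_quad_var (n theta : nat) : measurable_fun setT (fun w => V n theta w).
Proof.
under eq_fun do rewrite quad_varE.
by apply: measurable_sum => i; apply: measurable_funX; exact: measurable_ddX.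
Qed.

Lemma variation_close_ae (theta : nat) (eps : R) : (0 < theta)%N -> 0 < eps ->
  {ae P, forall w, \forall n \near \oo,
    `|V n theta w - b * dd_sum phi l n theta nu| <= eps * `|b * dd_sum phi l n theta nu|}.
Proof.
move=> th0 e0; have e20 : 0 < eps / 2 by rewrite divr_gt0.
have [B B0 HB] := variation_tail th0 e20.
have EC := expected_variation_close m_gt0 L_ge0 phi_derivable phi_slope phi_lip l_gt0 b_neq0
  nu_gt0 nu_lt KtE tau_gt0 delta_gt0 r_small th0 e20.
have mA n : measurable [set w | (eps / 2 * `|b * dd_sum phi l n theta nu| <=
       `|V n theta w - \sum_(0 <= i < n - theta * l) dd_cov Kt l (nodes n theta) i i|)%R].
  have mf : measurable_fun setT (fun w =>
      `|V n theta w - \sum_(0 <= i < n - theta * l) dd_cov Kt l (nodes n theta) i i|).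
    by apply: measurableT_comp => //; apply: measurable_funB => //; exact: measurable_quad_var.
  by rewrite -[X in measurable X]setTI; exact: measurable_fun_le.
apply: filterS (ae_eventually_not B0 mA HB) => w Hw.
apply: filterS2 EC Hw => n ec /negP; rewrite -ltNge => h.
rewrite -(subrK (\sum_(0 <= i < n - theta * l) dd_cov Kt l (nodes n theta) i i) (V n theta w)) -addrA.
apply: (le_trans (ler_normD _ _)); rewrite [X in _ <= X * _](splitr eps) mulrDl.
by apply: lerD => //; exact: ltW.
Qed.

End variation_consistency.

(** At nu the normalised ratio is within 3 eps of 1, hence also at the
    minimiser; the ratio of the two values of F is then close to 1, and so is
    that of their limits qh and q0. *)
Lemma min_contrast_ratio (R : realType) (eps e1 e2 a0 ah rho Fn Fh q0 qh : R) :
  0 <= eps -> eps <= 16^-1 -> `|e1| <= eps -> `|e2| <= eps -> `|a0| <= eps -> `|ah| <= eps ->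
  0 < q0 -> 0 < qh -> Fn = q0 * (1 + a0) -> Fh = qh * (1 + ah) ->
  rho * Fn = (1 + e1) / (1 + e2) -> (rho * Fh - 1) ^+ 2 <= (rho * Fn - 1) ^+ 2 ->
  `|qh / q0 - 1| <= 16 * eps.
Proof.
move=> ep0 ep1 h1 h2 h0 hh q00 qh0 Fn_E Fh_E xE.
have B (z : R) : `|z| <= eps -> - eps <= z /\ z <= eps by rewrite ler_norml => /andP[].
have [{}h1 h1'] := B _ h1; have [{}h2 h2'] := B _ h2.
have [{}h0 h0'] := B _ h0; have [{}hh hh'] := B _ hh.
have d2 : 0 < 1 + e2 by lra.
have d0 : 0 < 1 + a0 by lra.
have dh : 0 < 1 + ah by lra.
have xb : `|rho * Fn - 1| <= 3 * eps.
  rewrite xE ler_norml lerBrDr lerBlDr ler_pdivlMr // ler_pdivrMr //.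
  by apply/andP; split; nra.
rewrite -[X in X <= _ -> _]real_normK ?num_real // -[X in _ <= X -> _]real_normK ?num_real //.
rewrite ler_sqr ?nnegrE // => yx; have yb := le_trans yx xb.
have x0 : 0 < rho * Fn by rewrite xE divr_gt0 //; lra.
have -> : qh / q0 = (rho * Fh) * (1 + a0) / ((rho * Fn) * (1 + ah)).
  rewrite Fh_E Fn_E; have rho0 : rho != 0 by apply: contraTneq x0 => ->; rewrite mul0r ltxx.
  by field; rewrite rho0 !gt_eqF.
move: xb yb x0; rewrite !ler_norml; move: (rho * Fn) (rho * Fh) => x y.
move=> /andP[xb xb'] /andP[yb yb'] x0.
have den : 0 < x * (1 + ah) by exact: mulr_gt0.
rewrite lerBrDr lerBlDr ler_pdivlMr // ler_pdivrMr //.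
have dx : 0 <= 1 - 3 * eps by lra.
have de : 0 <= 1 - eps by lra.
have lo z e (hz : 1 - 3 * eps <= z) (he : - eps <= e) : (1 - 3 * eps) * (1 - eps) <= z * (1 + e).
  by apply: ler_pM => //; lra.
have hi z e (hz0 : 0 <= z) (he0 : 0 <= 1 + e) (hz : z <= 1 + 3 * eps) (he : e <= eps) :
    z * (1 + e) <= (1 + 3 * eps) * (1 + eps).
  by apply: ler_pM => //; lra.
have ye : 1 - 3 * eps <= y by lra.
have xe : 1 - 3 * eps <= x by lra.
have ye' : y <= 1 + 3 * eps by lra.
have xe' : x <= 1 + 3 * eps by lra.
have y1 := lo _ _ ye h0; have y2 := hi _ _ (le_trans dx ye) (ltW d0) ye' h0'.
have x1 := lo _ _ xe hh; have x2 := hi _ _ (ltW x0) (ltW dh) xe' hh'.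
have s1 : 0 <= 1 - 16 * eps by lra.
have s2 : 0 <= 1 + 16 * eps by lra.
apply/andP; split.
  apply: le_trans y1; rewrite addrC; apply: le_trans (ler_wpM2l s1 x2) _.
  rewrite -subr_ge0 (_ : _ - _ = 8 * eps + 64 * eps ^+ 2 + 48 * (eps * eps ^+ 2)); last by ring.
  by rewrite !addr_ge0 ?mulr_ge0 ?sqr_ge0.
apply: (le_trans y2); rewrite [X in _ <= X * _]addrC; apply: le_trans (ler_wpM2l s2 x1).
rewrite -subr_ge0 (_ : _ - _ = 8 * eps * (1 - 8 * eps) + 48 * (eps * eps ^+ 2)); last by ring.
by rewrite addr_ge0 ?mulr_ge0 ?sqr_ge0 //; lra.
Qed.

(** * Minimisers of the contrast *)

(** The map x |-> 2^(2x) is increasing with value 1 at 0. *)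
Lemma powR2_near1 (R : realType) (eta : R) : 0 < eta ->
  exists2 eps : R, 0 < eps & eps <= 16^-1 /\
    forall x : R, `|2 `^ (2 * x) - 1| <= 16 * eps -> `|x| <= eta.
Proof.
move=> eta0.
have incr (x y : R) : x < y -> 2 `^ (2 * x) < 2 `^ (2 * y).
  move=> xy; rewrite /powR pnatr_eq0 /= ltr_expR ltr_pM2r ?ltr_pM2l //.
  by rewrite ln_gt0 // ltr1n.
have one : 2 `^ (2 * 0) = 1 :> R by rewrite mulr0 powRr0.
have up : 0 < 2 `^ (2 * eta) - 1 by rewrite subr_gt0 -{1}one incr.
have dn : 0 < 1 - 2 `^ (2 * - eta) by rewrite subr_gt0 -[ltRHS]one incr // oppr_lt0.
(* The factor 32 instead of 16 makes the inequality below strict. *)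
pose e := Num.min 16^-1 (Num.min (2 `^ (2 * eta) - 1) (1 - 2 `^ (2 * - eta)) / 32).
have e1 : e <= 16^-1 by rewrite ge_min lexx.
have e2 : 32 * e <= 2 `^ (2 * eta) - 1.
  by rewrite mulrC -ler_pdivlMr // ge_min orbC ler_pM2r ?invr_gt0 // ge_min lexx.
have e3 : 32 * e <= 1 - 2 `^ (2 * - eta).
  by rewrite mulrC -ler_pdivlMr // ge_min orbC ler_pM2r ?invr_gt0 // ge_min lexx orbT.
have e0 : 0 < e by rewrite lt_min invr_gt0 ltr0n /= divr_gt0 // lt_min up dn.
exists e => //; split => // x; clearbody e; rewrite !ler_norml => /andP[h1 h2].
apply/andP; split; rewrite leNgt; apply/negP => hx; have := incr _ _ hx; lra.
Qed.

Lemma exists_inv_lt (R : realType) (eps : R) : 0 < eps -> exists k : nat, k.+1%:R^-1 <= eps.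
Proof.
move=> e0; exists (Num.truncn eps^-1).
by rewrite invf_ple ?posrE // ltW // truncnS_gt.
Qed.

Lemma norm_ratio_sub1 (R : realType) (eps v f : R) : f != 0 ->
  `|v - f| <= eps * `|f| -> `|v / f - 1| <= eps.
Proof.
move=> f0 h; have -> : v / f - 1 = (v - f) / f by field.
by rewrite normf_div ler_pdivrMr ?normr_gt0.
Qed.

Lemma minimizer_close (R : realType) (eps V1 V2 f1 f2 Fn Fh nu h p : R) :
  0 <= eps -> eps <= 16^-1 -> f1 != 0 -> f2 != 0 ->
  `|V1 - f1| <= eps * `|f1| -> `|V2 - f2| <= eps * `|f2| -> Fn = f2 / f1 ->
  `|Fn - 2 `^ (2 * nu - p)| <= eps * 2 `^ (2 * nu - p) ->
  `|Fh - 2 `^ (2 * h - p)| <= eps * 2 `^ (2 * h - p) ->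
  (V1 * Fh / V2 - 1) ^+ 2 <= (V1 * Fn / V2 - 1) ^+ 2 ->
  `|2 `^ (2 * (h - nu)) - 1| <= 16 * eps.
Proof.
move=> e0 e16 f10 f20 v1 v2 FnE fn fh.
have q0 : 0 < 2 `^ (2 * nu - p) :> R by exact: powR_gt0.
have qh : 0 < 2 `^ (2 * h - p) :> R by exact: powR_gt0.
have -> : 2 `^ (2 * (h - nu)) = 2 `^ (2 * h - p) / 2 `^ (2 * nu - p) :> R.
  rewrite -powRB ?pnatr_eq0 ?implybT //; congr (_ `^ _); ring.
move: q0 qh fn fh; move: (2 `^ (2 * nu - p)) (2 `^ (2 * h - p)) => q0 qh q0_gt0 qh_gt0.
rewrite -{2}(gtr0_norm q0_gt0) -{2}(gtr0_norm qh_gt0).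
have q0n : q0 != 0 by rewrite gt_eqF.
have qhn : qh != 0 by rewrite gt_eqF.
move=> /(norm_ratio_sub1 q0n) a0 /(norm_ratio_sub1 qhn) ah.
have e1 := norm_ratio_sub1 f10 v1; have e2 := norm_ratio_sub1 f20 v2.
have V20 : V2 != 0.
  apply: contraTneq e2 => ->; rewrite mul0r sub0r normrN normr1 -ltNge.
  by apply: (le_lt_trans e16); rewrite invf_lt1 // ltr1n.
rewrite mulrAC [V1 * Fn / V2]mulrAC => hmin.
apply: (min_contrast_ratio e0 e16 e1 e2 a0 ah q0_gt0 qh_gt0 _ _ _ hmin).
- by field.
- by field.
by rewrite ![1 + (_ - 1)]addrC !subrK FnE; field; rewrite V20 f10 f20.
Qed.

Theorem theorem2 (R : realType) (d : measure_display) (T : measurableType d)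
    (P : probability T R)
    (l : nat) (M nu : R)
    (hl : (0 < l)%N) (hnu : 0 < nu) (hnuM : nu <= M) (hMl : M < l%:R)
    (hl10 : (l <= 10)%N)
    (X : R -> {RV P >-> R}) (mu : R) (Kt : R -> R)
    (hgauss : gaussian_process X)
    (hmean : forall x : R, ('E_P[X x] = mu%:E)%E)
    (hcov : forall x y : R, (covariance P (X x) (X y) = (Kt (x - y))%:E)%E)
    (beta : nat -> R) (betastar : R -> R) (r : R -> R -> R) (tau : R)
    (hbetastar : forall v : R, 0 < v -> v < l%:R -> betastar v != 0)
    (hKt : forall x y : R,
       Kt (x - y) =
         \sum_(0 <= j < (Num.truncn nu).+1) beta j * `|x - y| ^+ (2 * j)
         + betastar nu * G nu `|x - y| + r x y)
    (htau : 0 < tau) (hr : bigO_diagonal r (2 * nu + tau))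
    (phi : R -> R)
    (hphi : twice_continuously_differentiable phi)
    (hphi0 : phi 0 = 0) (hphi1 : phi 1 = 1)
    (hphi' : exists2 m : R, is_min (derive1 phi @` `[0, 1]) m & 0 < m)
    (hsmooth : exists a b : R,
       (`]0, 1] `<=` `]a, b[) /\ continuous_nth_derivative_on (2 * l) Kt a b)
    (hbound : exists C : R, forall t : R, t \in `]0, 1] ->
       `|derive1n (2 * l) Kt t| <= C * t `^ (2 * nu - 2 * l%:R))
    (nuhat : nat -> T -> R)
    (hnuhat : forall (n : nat) (w : T), (2 * l < n)%N ->
       let t := design phi n in
       let crit := contrast betastar t n l (fun i => X (t i) w) in
       nuhat n w \in `[0, M] /\
       is_min (crit @` `[0, M]) (crit (nuhat n w))) :
  {ae P, forall w : T, nuhat n w @[n --> \oo] --> nu}.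
Proof.
have nul : nu < l%:R by exact: le_lt_trans hMl.
have [d1 _ _] := hphi.
have [m [c [L [m0 L0 slope lip]]]] := C2_bounds hphi hphi'.
have [Cr [delta [delta0 hrs]]] := hr.
have [a [b [hab [hder _]]]] := hsmooth.
have [CK hCK] := hbound.
have b0 := hbetastar nu hnu nul.
have in01 (t : R) : 0 < t -> t <= 1 -> t \in `]0, 1] by move=> t0 t1; rewrite in_itv /= t0.
have Kt_derive j : (j < 2 * l)%N -> forall t : R, 0 < t -> t <= 1 ->
    is_derive t 1 (derive1n j Kt) (derive1n j.+1 Kt t).
  move=> jl t t0 t1; apply: DeriveDef; first by apply: hder => //; apply/hab; exact: in01.
  by rewrite derive1nS derive1E.
have Kt_bound (t : R) : 0 < t -> t <= 1 -> `|derive1n (2 * l) Kt t| <= CK * t `^ (2 * nu - 2 * l%:R).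
  by move=> t0 t1; apply: hCK; exact: in01.
have close theta (eps : R) (th0 : (0 < theta)%N) (e0 : 0 < eps) :=
  variation_close_ae hgauss hmean hcov m0 L0 d1 slope lip hl b0 hnu nul hKt htau delta0 hrs
    hphi0 hphi1 Kt_derive Kt_bound th0 e0.
(* Countably many tolerances, for a single null set. *)
have pos k : 0 < k.+1%:R^-1 :> R by rewrite invr_gt0.
have close1 := ae_foralln (fun k => close 1%N _ (ltn0Sn 0) (pos k)).
have close2 := ae_foralln (fun k => close 2%N _ (ltn0Sn 1) (pos k)).
apply: filterS2 close1 close2 => w hV1 hV2.
apply/cvgrPdist_le => eta eta0.
have [eps e0 [e16 heta]] := powR2_near1 eta0.
have [k ke] := exists_inv_lt e0.
have [k1 k10 S1] := dd_sum_lower m0 L0 d1 slope lip hl hnu nul (ltn0Sn 0).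
have [k2 k20 S2] := dd_sum_lower m0 L0 d1 slope lip hl hnu nul (ltn0Sn 1).
have FC := F_fun_close m0 L0 d1 slope lip hl hbetastar hMl e0.
near=> n.
have n1 : (1 < n)%N by near: n; exact: nbhs_infty_gt.
have ln : (2 * l < n)%N by near: n; exact: nbhs_infty_gt.
have [hin [_ hmin]] := hnuhat n w ln.
move: hin; rewrite in_itv /= => /andP[nh0 nhM].
have N0 : 0 < n%:R * (n%:R - 1) `^ (2 * l%:R - 2 * nu) :> R.
  by rewrite mulr_gt0 ?powR_gt0 ?mesh_gt0 // ltr0n ltnW.
have nz1 : betastar nu * dd_sum phi l n 1 nu != 0.
  rewrite mulf_neq0 // -normr_gt0; apply: (@lt_le_trans _ _ (k1 * n%:R * (n%:R - 1) `^ (2 * l%:R - 2 * nu))).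
    by rewrite -mulrA mulr_gt0.
  by near: n.
have nz2 : betastar nu * dd_sum phi l n 2 nu != 0.
  rewrite mulf_neq0 // -normr_gt0; apply: (@lt_le_trans _ _ (k2 * n%:R * (n%:R - 1) `^ (2 * l%:R - 2 * nu))).
    by rewrite -mulrA mulr_gt0.
  by near: n.
have v1 : `|quad_var (design phi n) n 1 l (fun i => X (design phi n i) w) - betastar nu * dd_sum phi l n 1 nu|
    <= k.+1%:R^-1 * `|betastar nu * dd_sum phi l n 1 nu| by near: n; exact: hV1.
have v2 : `|quad_var (design phi n) n 2 l (fun i => X (design phi n i) w) - betastar nu * dd_sum phi l n 2 nu|
    <= k.+1%:R^-1 * `|betastar nu * dd_sum phi l n 2 nu| by near: n; exact: hV2.
have fc : forall v : R, 0 <= v -> v <= M ->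
    `|F_fun betastar (design phi n) n l v - 2 `^ (2 * v - 2 * l%:R)| <= eps * 2 `^ (2 * v - 2 * l%:R).
  by near: n.
have Fnu : F_fun betastar (design phi n) n l nu =
    (betastar nu * dd_sum phi l n 2 nu) / (betastar nu * dd_sum phi l n 1 nu).
  by rewrite /F_fun gt_eqF // !(f_fun_dd_sum l betastar m0 d1 slope).
have {hmin} := hmin (contrast betastar (design phi n) n l (fun i => X (design phi n i) w) nu).
have nu0M : exists2 x : R, `[0, M]%classic x &
    contrast betastar (design phi n) n l (fun i => X (design phi n i) w) x =
    contrast betastar (design phi n) n l (fun i => X (design phi n i) w) nu.
  by exists nu => //=; rewrite in_itv /= (ltW hnu).
move=> /(_ nu0M); rewrite /contrast.
have fh := fc _ nh0 nhM; have fn := fc nu (ltW hnu) hnuM.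
move: v1 v2 Fnu fh fn nz1 nz2.
move: (quad_var _ _ 1 _ _) (quad_var _ _ 2 _ _) (betastar nu * dd_sum phi l n 1 nu)
  (betastar nu * dd_sum phi l n 2 nu) (F_fun _ _ _ _ nu) (F_fun _ _ _ _ (nuhat n w)).
move=> V1 V2 f1 f2 Fn Fh v1 v2 FnE fh fn nz1 nz2 hmin.
rewrite distrC; apply: heta.
have v1' := le_trans v1 (ler_wpM2r (normr_ge0 f1) ke).
have v2' := le_trans v2 (ler_wpM2r (normr_ge0 f2) ke).
exact: (minimizer_close (ltW e0) e16 nz1 nz2 v1' v2' FnE fn fh hmin).
Unshelve. all: by end_near. Qed.
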